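(* Let $1\leq p<\infty$, let $(a,b)\subset\mathbb{R}$ be a bounded interval, and let $F\in C^1[a,b]$ be real valued with $F(a)=0$ and such that $(a,b)$ is forward invariant under $F$. Moreover, let $h\in W^{1,\infty}[a,b]$ (complex valued) be such that 1) $h(x)=h(a)\in\mathbb{R}$ for all $x\in\{F=0\}$ (in particular $h(a)$ is real), 2) the function $[a,b]\to\mathbb{C}$, $y\mapsto\frac{h(y)-h(a)}{F(y)}$ (taken to be $0$ where $F$ vanishes) belongs to $L^\infty[a,b]$. Then, for the $C_0$-semigroup $S_{F,h}$ on $W^{1,p}_*[a,b]$, the following are equivalent: (i) $S_{F,h}$ is chaotic. (ii) $\lambda(\{F=0\})=0$ and for every connected component $C$ of $(a,b)\setminus\{F=0\}$ $$\int_C\exp\Big(-p\int_x^w\frac{F'(y)+h(a)}{F(y)}\,dy\Big)\,d\lambda(w)<\infty$$ for some $x\in C$ (equivalently, for all $x\in C$; that is, (i) is equivalent to (ii) both when (ii) is read with ''for some $x\in C$'' and when it is read with ''for all $x\in C$'').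
   Context: $\lambda$ denotes Lebesgue measure, and $\{F=0\}:=\{x\in(a,b): F(x)=0\}$. For $x_0\in(a,b)$, let $\varphi(\cdot,x_0)$ be the unique maximal solution of $\dot x=F(x)$, $x(0)=x_0$ in $(a,b)$, with maximal open interval of definition $J(x_0)\ni0$. The interval $(a,b)$ is called forward invariant under $F$ if $[0,\infty)\subset J(x_0)$ for every $x_0\in(a,b)$. For $t\geq 0$ put $h_t(x)=\exp\big(\int_0^t h(\varphi(s,x))\,ds\big)$. $W^{1,p}[a,b]$ is the usual Sobolev space of complex-valued functions (identified with their continuous representatives on $[a,b]$), and $W^{1,p}_*[a,b]:=\{f\in W^{1,p}[a,b]: f(a)=0\}$, a closed subspace. Under the hypotheses of the theorem, it is known that the operators $$(S(t)f)(x)=h_t(x)f(\varphi(t,x)),\quad t\geq0,$$ define a $C_0$-semigroup on $W^{1,p}[a,b]$ that leaves $W^{1,p}_*[a,b]$ invariant; its restriction to $W^{1,p}_*[a,b]$ is denoted $S_{F,h}$. Its generator is $f\mapsto Ff'+hf$ with domain $\{f\in W^{1,p}_*[a,b]: Ff''\in L^p[a,b]\}$ (distributional derivatives). A $C_0$-semigroup $T$ on a separable Banach space $X$ is chaotic if it is hypercyclic, i.e. there is $x\in X$ such that $\{T(t)x: t\geq 0\}$ is dense in $X$, and if the set of periodic points $\{x\in X:\exists\,t>0,\ T(t)x=x\}$ is dense in $X$. *)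

(* Defs.v *)
From HB Require Import structures.
From mathcomp Require Import all_boot all_order all_algebra.
From mathcomp Require Import complex.
From mathcomp Require Import all_classical all_reals all_analysis.

Set Implicit Arguments.
Unset Strict Implicit.
Unset Printing Implicit Defensive.

Import Order.TTheory GRing.Theory Num.Theory.
Import numFieldNormedType.Exports.

Local Open Scope classical_set_scope.
Local Open Scope ring_scope.
Local Open Scope complex_scope.

Section Chaos.
Context {R : realType} {V : zmodType}.
Variables (X : set V) (norm : V -> \bar R).

Definition dense_in (A : set V) :=
  forall y, X y -> forall e : R, 0 < e ->
    exists2 z, A z & (norm (z - y) < e%:E)%E.

Definition hypercyclic (T : R -> V -> V) :=
  exists2 x, X x & dense_in [set T t x | t in [set t | 0 <= t]].

Definition periodic_points (T : R -> V -> V) : set V :=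
  [set x | X x /\ exists2 t, 0 < t & T t x = x].

Definition chaotic (T : R -> V -> V) :=
  hypercyclic T /\ dense_in (periodic_points T).

End Chaos.

Section ComplexValued.
Context {R : realType}.
Notation mu := (@lebesgue_measure R).

Definition cexp (z : R[i]) : R[i] :=
  (expR (complex.Re z))%:C * (cos (complex.Im z) +i* sin (complex.Im z)).

Definition cint (D : set R) (f : R -> R[i]) : R[i] :=
  (\int[mu]_(x in D) complex.Re (f x)) +i* (\int[mu]_(x in D) complex.Im (f x)).

Definition ccontinuous_on (D : set R) (f : R -> R[i]) :=
  {within D, continuous (f : R -> R[i]^o)}.

Definition cLnorm (D : set R) (p : \bar R) (f : R -> R[i]) : \bar R :=
  Lnorm mu p ((fun x => (ComplexField.Normc.normc (f x))%:E) \_ D).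

Definition inLp (D : set R) (p : \bar R) (f : R -> R[i]) :=
  [/\ measurable_fun D (fun x => complex.Re (f x)),
      measurable_fun D (fun x => complex.Im (f x)) &
      (cLnorm D p f < +oo)%E].

Definition clocally_integrable (D : set R) (f : R -> R[i]) :=
  locally_integrable D (fun x => complex.Re (f x)) /\
  locally_integrable D (fun x => complex.Im (f x)).

End ComplexValued.

Section Sobolev.
Context {R : realType}.
Variables (a b : R).

(* C_c^oo(a, b); real-valued test functions suffice, by complex linearity. *)
Definition test_function (phi : R -> R) :=
  (forall n x, derivable (derive1n n phi) x 1) /\
  exists K : set R, [/\ compact K, K `<=` `]a, b[ &
                        forall x, ~ K x -> phi x = 0].

Definition is_weak_derivative (f g : R -> R[i]) :=
  [/\ clocally_integrable `]a, b[ f, clocally_integrable `]a, b[ g &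
      forall phi, test_function phi ->
        cint `]a, b[ (fun x => f x * (derive1 phi x)%:C) =
        - cint `]a, b[ (fun x => g x * (phi x)%:C)].

(* Any choice will do: weak derivatives are unique up to a null set. *)
Definition weak_deriv (f : R -> R[i]) : R -> R[i] :=
  xget 0 [set g | is_weak_derivative f g].

(* W^{1,p}[a, b]; f is the continuous representative, and only its values on
   [a, b] matter. *)
Definition sobolev (p : \bar R) (f : R -> R[i]) :=
  [/\ ccontinuous_on `[a, b] f, inLp `[a, b] p f &
      exists2 g, is_weak_derivative f g & inLp `[a, b] p g].

Definition sobolev_norm (p : \bar R) (f : R -> R[i]) : \bar R :=
  (cLnorm `[a, b] p f + cLnorm `[a, b] p (weak_deriv f))%E.

(* W^{1,p}_*[a, b]; elements are extended by 0 outside [a, b], so that equality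
   in the space is Leibniz equality. *)
Definition sobolev_star (p : \bar R) : set (R -> R[i]) :=
  [set f | [/\ sobolev p f, f a = 0 & forall x, ~ `[a, b]%classic x -> f x = 0]].

(* Continuous representative on [a, b] of a function given on (a, b),
   extended by 0 outside [a, b]. *)
Definition cont_rep (g : R -> R[i]) : R -> R[i] := fun x =>
  if (a < x) && (x < b) then g x
  else if x == a then lim ((g y : R[i]^o) @[y --> a^'+])
  else if x == b then lim ((g y : R[i]^o) @[y --> b^'-])
  else 0.

End Sobolev.

Section Semiflow.
Context {R : realType}.
Variables (a b : R) (F : R -> R).

(* C^1[a, b]: F' exists on (a, b) and extends continuously to [a, b]. *)
Definition C1_on :=
  [/\ {within `[a, b], continuous F},
      forall x, a < x < b -> derivable F x 1 &
      exists2 G : R -> R, {within `[a, b], continuous G} &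
        forall x, a < x < b -> derive1 F x = G x].

Definition is_solution (x0 : R) (J : set R) (u : R -> R) :=
  [/\ open J, is_interval J, J 0, u 0 = x0 &
      forall t, J t -> a < u t < b /\ is_derive t (1 : R) u (F (u t))].

Definition is_maximal_solution (x0 : R) (J : set R) (u : R -> R) :=
  is_solution x0 J u /\
  forall K v, is_solution x0 K v -> J `<=` K ->
    (forall t, J t -> v t = u t) -> K = J.

(* By uniqueness xget determines J, and u on J; the values of u outside J are
   irrelevant. If there were no maximal solution, J would be empty. *)
Definition maximal_solution (x0 : R) : set R * (R -> R) :=
  xget (set0, cst 0) [set Ju | is_maximal_solution x0 Ju.1 Ju.2].

Definition Jmax (x0 : R) : set R := (maximal_solution x0).1.

Definition flow (t x0 : R) : R := (maximal_solution x0).2 t.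

Definition forward_invariant :=
  forall x0, a < x0 < b -> [set t | 0 <= t] `<=` Jmax x0.

Definition zeros : set R := [set x | a < x < b /\ F x = 0].

Variable h : R -> R[i].

Definition h_ (t x : R) : R[i] := cexp (cint `[0, t] (fun s => h (flow s x))).

Definition S_ (t : R) (f : R -> R[i]) : R -> R[i] :=
  cont_rep a b (fun x => h_ t x * f (flow t x)).

(* The oriented integral from x to w. *)
Definition oint (x w : R) (g : R -> R) : R :=
  if x <= w then \int[lebesgue_measure]_(y in `[x, w]) g y
  else - \int[lebesgue_measure]_(y in `[w, x]) g y.

Definition is_component (A C : set R) :=
  exists2 z, A z & C = connected_component A z.

(* For real h(a), Re (h a) is h(a) itself as an element of R. *)
Definition component_integral (p : R) (C : set R) (x : R) : \bar R :=
  (\int[lebesgue_measure]_(w in C)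
     (expR (- p * oint x w
        (fun y => (derive1 F y + complex.Re (h a)) / F y))%R)%:E)%E.

Definition cond_some (p : R) :=
  lebesgue_measure zeros = 0%E /\
  forall C, is_component (`]a, b[ `\` zeros) C ->
    exists2 x, C x & (component_integral p C x < +oo)%E.

Definition cond_all (p : R) :=
  lebesgue_measure zeros = 0%E /\
  forall C, is_component (`]a, b[ `\` zeros) C ->
    forall x, C x -> (component_integral p C x < +oo)%E.

End Semiflow.

(* Main.v *)
Require Import Defs.
From HB Require Import structures.
From mathcomp Require Import all_boot all_order all_algebra.
From mathcomp Require Import complex.
From mathcomp Require Import all_classical all_reals all_analysis.
From mathcomp Require Import measurable_realfun ess_sup_inf.
From mathcomp Require Import ring lra.

Set Implicit Arguments.
Unset Strict Implicit.
Unset Printing Implicit Defensive.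

Import Order.TTheory GRing.Theory Num.Theory.
Import numFieldNormedType.Exports.

Local Open Scope classical_set_scope.
Local Open Scope ring_scope.
Local Open Scope complex_scope.

(* Either side of the equivalence forces F < 0 on ]a, b] and c = h(a) > 0. Indeed hypercyclicity
fails for c <= 0, since orbits are then bounded in the supremum norm, and a periodic point vanishes
at every zero of F in ]a, b] when c > 0. Conversely 1 / |F| is not integrable at a zero of F, so that
the integral in (ii) diverges at an endpoint of a component unless F and c have these signs. Hence
]a, b[ is the only component, and tau with tau' = 1 / F, tau(b) = 0 is a time coordinate, in which
(ii) reads: w = |F|^-p exp (- p c tau) is integrable.

Necessity. Along the orbit y_n of a point where a t-periodic f does not vanish, |f(y_n)| is
comparable to exp (- c t n); the p-energy of f' on [y_(n+1), y_n] then dominates the integral of w.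

Sufficiency. With A' = h / F, the functions v(tau) exp (- A) satisfy
S(t) (v(tau) exp (- A)) = v(tau + t) exp (- A), so the semigroup becomes a translation. If
|v|, |v'| <= B Phi(tau) for a suitable Phi that increases to infinity and with Phi(tau)^p w
integrable, then the Sobolev norm is at most C B. The compactly supported v give a dense subspace;
placing translated copies of a countable dense family (resp. of a single v) so far apart that Phi
dominates them gives a hypercyclic vector (resp. periodic points). *)

(** * Calculus on intervals *)

Section Calculus.
Context {R : realType}.
Notation mu := (@lebesgue_measure R).
Implicit Types (f g k : R -> R) (a b c d x y : R).

(** Hypotheses 1) and 2) enter through the pointwise bound |h - h(a)| <= M |F|. As F keeps one sign
    along an orbit, the integral of |F| over it is the distance travelled, at most b - a; so
    |h_t(x)| agrees with exp (c t) up to the factor exp (M (b - a)), uniformly in x and t. Forward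
    invariance excludes F > 0, since an orbit would then reach b in finite time.

    The derivative of v(tau) exp (- A) is (v' - h v) exp (- A) / F, and |exp (- A) / F|^p is at most
    a constant times w; this is how w governs the Sobolev norm. A profile v may grow, but at most
    like exp (c tau / 2), half the decay rate of exp (- A), so that the function still tends to 0 at
    a.

    Norms are handled through their p-th powers, and Hoelder's inequality through y <= e + e^(1 - p)
    y^p, which covers p = 1 as well, with e adjusted at each use. Triangle inequalities then hold up
    to constants, which is harmless for density. Weak derivatives are tied to increments by testing
    against smooth plateaus. *)

Definition clamp (a b x : R) : R := Num.max a (Num.min x b).

Lemma clamp_id (a b x : R) : a <= x <= b -> clamp a b x = x.
Proof. by move=> /andP[ax xb]; rewrite /clamp (min_idPl xb) (max_idPr ax). Qed.

Lemma clamp_itv (a b x : R) : a <= b -> a <= clamp a b x <= b.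
Proof. by move=> ab; rewrite /clamp le_max lexx/= ge_max ab/= ge_min lexx orbT. Qed.

Lemma clamp_continuous (a b : R) : continuous (clamp a b).
Proof.
apply: (@max_fun_continuous _ _ R (cst a) (fun x => Num.min x b)).
  by move=> x; exact: cvg_cst.
by apply: (@min_fun_continuous _ _ R id (cst b)) => x; [exact: cvg_id|exact: cvg_cst].
Qed.

(** Extends a function continuous on [[a, b]] to the whole line, which turns one-sided continuity at
    the ends into ordinary continuity. *)
Lemma continuous_clamp (T : topologicalType) (a b : R) (f : R -> T) : a <= b ->
  {within `[a, b], continuous f} -> continuous (f \o clamp a b).
Proof.
move=> ab /subspace_continuousP cf x.
have cab : `[a, b]%classic (clamp a b x) by rewrite /= in_itv/= clamp_itv.
move=> A nA; have /(@clamp_continuous a b x _) := cf _ cab A nA.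
by apply: (@filterS _ (nbhs x)) => y /=; apply; rewrite /= in_itv/= clamp_itv.
Qed.

Lemma is_derive_continuous f x d : is_derive x (1:R) f d -> {for x, continuous f}.
Proof. by move=> df; apply: differentiable_continuous; apply/derivable1_diffP. Qed.

Lemma is_derive_derive1 f x d : is_derive x (1:R) f d -> derive1 f x = d.
Proof. by move=> df; rewrite derive1E derive_val. Qed.

Lemma within_continuous_itv f a b :
  (forall x, a <= x <= b -> {for x, continuous f}) ->
  {within `[a, b], continuous f}.
Proof.
by move=> cf; apply: continuous_in_subspaceT => x /set_mem/=; rewrite in_itv; apply: cf.
Qed.

Lemma derivable_oo_LR f a b : (forall x, a <= x <= b -> derivable f x 1) ->
  a <= b -> derivable_oo_LRcontinuous f a b.
Proof.
move=> df ab.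
have cf x : a <= x <= b -> f y @[y --> x] --> f x.
  by move=> /df dfx; apply: differentiable_continuous; exact/derivable1_diffP.
split.
- by move=> x /[!in_itv]/= /andP[ax xb]; apply: df; rewrite !ltW.
- by apply: cvg_at_right_filter; apply: cf; rewrite lexx.
- by apply: cvg_at_left_filter; apply: cf; rewrite lexx andbT.
Qed.

Lemma integrable_continuous_itv f a b :
  (forall x, a <= x <= b -> {for x, continuous f}) ->
  mu.-integrable `[a, b] (EFin \o f).
Proof.
move=> cf; apply: continuous_compact_integrable; first exact: segment_compact.
exact: within_continuous_itv.
Qed.

Lemma FTC2e f F a b : a <= b ->
  (forall x, a <= x <= b -> is_derive x (1:R) F (f x)) ->
  (forall x, a <= x <= b -> {for x, continuous f}) ->
  (\int[mu]_(x in `[a, b]) (f x)%:E = (F b - F a)%:E)%E.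
Proof.
rewrite le_eqVlt => /predU1P[<- _ _|ab dF cf].
  by rewrite set_itv1 integral_set1 subrr.
rewrite (@continuous_FTC2 _ f F)//.
- exact: within_continuous_itv.
- apply: derivable_oo_LR; last exact: ltW.
  by move=> x /dF dFx.
- by move=> x /[!in_itv]/= /andP[ax xb]; apply: is_derive_derive1; apply: dF; rewrite !ltW.
Qed.

Lemma FTC2 f F a b : a <= b ->
  (forall x, a <= x <= b -> is_derive x (1:R) F (f x)) ->
  (forall x, a <= x <= b -> {for x, continuous f}) ->
  \int[mu]_(x in `[a, b]) f x = F b - F a.
Proof. by move=> ab dF cf; rewrite /Rintegral (FTC2e ab dF cf). Qed.

Lemma oint_FTC f F a b :
  (forall x, Num.min a b <= x <= Num.max a b -> is_derive x (1:R) F (f x)) ->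
  (forall x, Num.min a b <= x <= Num.max a b -> {for x, continuous f}) ->
  oint a b f = F b - F a.
Proof.
rewrite /oint; case: leP => [ab dF cf|ab dF cf]; first exact: FTC2.
by rewrite (FTC2 (ltW ab) dF cf) opprB.
Qed.

Lemma Rintegral_itv_split f a b c : a <= b -> b <= c ->
  mu.-integrable `[a, c] (EFin \o f) ->
  \int[mu]_(x in `[a, c]) f x =
  \int[mu]_(x in `[a, b]) f x + \int[mu]_(x in `[b, c]) f x.
Proof.
move=> ab bc fi.
have fbc : mu.-integrable `]b, c] (EFin \o f).
  by apply: integrableS fi => //; apply: subset_itvr; rewrite bnd_simp.
rewrite -(Rintegral_itv_obnd_cbnd fbc) -(@Rintegral_itvB _ f (BLeft a) (BRight c) b fi) ?bnd_simp//.
by rewrite addrC subrK.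
Qed.

(** The primitive is the oriented integral from a base point [x0] of [D]; differentiability at x is
    a local matter, settled by the integral from a common left end. *)
Lemma primitive_exists k (D : set R) : open D -> is_interval D ->
  (forall x, D x -> {for x, continuous k}) ->
  exists K : R -> R, forall x, D x -> is_derive x (1:R) K (k x).
Proof.
move=> oD iD ck; have [->|/set0P[x0 Dx0]] := eqVneq D set0; first by exists (cst 0).
have subD u v : D u -> D v -> forall z, u <= z <= v -> D z.
  by move=> Du Dv z uzv; exact: iD Du Dv _ uzv.
exists (fun x => oint x0 x k) => x Dx.
have nD y : D y -> exists2 r : R, 0 < r & forall z, `|y - z| < r -> D z.
  by move=> Dy; have /nbhs_ballP[r/= r0 rD] := open_nbhs_nbhs (conj oD Dy); exists r.
have [e [e0 De Dex]] : exists e : R, [/\ 0 < e,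
    forall z, `|x0 - z| <= e -> D z & forall z, `|x - z| <= e -> D z].
  have [r r0 rD] := nD _ Dx0; have [r' r'0 r'D] := nD _ Dx.
  exists (Num.min r r' / 2); split; first by rewrite divr_gt0// lt_min r0.
    by move=> z xz; apply: rD; move: xz; case: (leP r r') => H; lra.
  by move=> z xz; apply: r'D; move: xz; case: (leP r r') => H; lra.
(* [[u, w]] lies in [D] and has both [x0] and x in its interior. On it the oriented integral is
   [G y - G x0], whatever the order of [x0] and y. *)
pose u := Num.min x0 x - e; pose w := Num.max x0 x + e.
have [xw x0w] : x < w /\ x0 < w by rewrite /w; case: (leP x0 x) => H; split; lra.
have [ux ux0] : u < x /\ u < x0 by rewrite /u; case: (leP x0 x) => H; split; lra.
have Du : D u.
  by rewrite /u; case: leP => _; [apply: De|apply: Dex]; rewrite opprB addrC subrK gtr0_norm.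
have Dw : D w.
  by rewrite /w; case: leP => _; [apply: Dex|apply: De];
    rewrite opprD addrA subrr add0r normrN gtr0_norm.
have ki : mu.-integrable `[u, w] (EFin \o k).
  by apply: integrable_continuous_itv => z uzw; apply: ck; exact: subD uzw.
pose G y := \int[mu]_(t in `[u, y]) k t.
have ointE y : u <= y -> y <= w -> oint x0 y k = G y - G x0.
  move=> uy yw; rewrite /oint /G; case: leP => [x0y|/ltW yx0].
    have -> := Rintegral_itv_split (ltW ux0) x0y.
      by rewrite addrAC subrr add0r.
    by apply: integrableS ki => //; apply: subset_itvl; rewrite bnd_simp.
  have -> := Rintegral_itv_split uy yx0.
    by rewrite opprD addrA subrr add0r.
  by apply: integrableS ki => //; apply: subset_itvl; rewrite bnd_simp ltW.
have [dG G'] := continuous_FTC1_closed xw ki ux (ck _ Dx).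
have dGx : is_derive x (1:R) (fun y => G y - G x0) (k x).
  apply: is_derive_eq.
    apply: is_deriveB; apply: DeriveDef dG _; rewrite -derive1E; exact: G'.
  by rewrite subr0.
apply: near_eq_is_derive dGx.
near=> y; rewrite ointE//; apply: ltW.
  by near: y; exact: lt_nbhsr.
by near: y; exact: lt_nbhsl.
Unshelve. all: by end_near. Qed.

Lemma MVT_is_derive f (df : R -> R) a b : a <= b ->
  (forall x, a <= x <= b -> is_derive x (1:R) f (df x)) ->
  exists2 c : R, a <= c <= b & f b - f a = df c * (b - a).
Proof.
move=> ab dF; have [||c] := @MVT_segment R f df a b ab.
- by move=> x /[!in_itv]/= /andP[ax xb]; apply: dF; rewrite !ltW.
- by apply: within_continuous_itv => x /dF; exact: is_derive_continuous.
- by rewrite in_itv/= => acb E; exists c.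
Qed.

Lemma is_derive_ge0_le f (df : R -> R) a b : a <= b ->
  (forall x, a <= x <= b -> is_derive x (1:R) f (df x)) ->
  (forall x, a <= x <= b -> 0 <= df x) -> f a <= f b.
Proof.
move=> ab dF df0; have [c cab] := MVT_is_derive ab dF.
by move/eqP; rewrite subr_eq => /eqP ->; rewrite lerDr mulr_ge0 ?df0// subr_ge0.
Qed.

Lemma is_derive_ext f g x (d : R) : f =1 g ->
  is_derive x (1:R) f d -> is_derive x (1:R) g d.
Proof. by move=> /funext ->. Qed.

Lemma is_derive_cong f x (u v : R) :
  is_derive x (1:R) f u -> u = v -> is_derive x (1:R) f v.
Proof. by move=> H <-. Qed.

Lemma is_derive_fD f g x (u v : R) :
  is_derive x (1:R) f u -> is_derive x (1:R) g v ->
  is_derive x (1:R) (fun y => f y + g y) (u + v).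
Proof. by move=> df dg; apply: is_deriveD. Qed.

Lemma is_derive_fB f g x (u v : R) :
  is_derive x (1:R) f u -> is_derive x (1:R) g v ->
  is_derive x (1:R) (fun y => f y - g y) (u - v).
Proof. by move=> df dg; apply: is_deriveB. Qed.

Lemma is_derive_fN f x (u : R) :
  is_derive x (1:R) f u -> is_derive x (1:R) (fun y => - f y) (- u).
Proof. by move=> df; apply: is_deriveN. Qed.

Lemma is_derive_fM f g x (u v : R) :
  is_derive x (1:R) f u -> is_derive x (1:R) g v ->
  is_derive x (1:R) (fun y => f y * g y) (u * g x + f x * v).
Proof.
move=> df dg; apply: (is_derive_cong (is_deriveM df dg)).
by rewrite /GRing.scale/= addrC [X in X + _]mulrC.
Qed.

Lemma is_derive_fX f n x (u : R) :
  is_derive x (1:R) f u ->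
  is_derive x (1:R) (fun y => f y ^+ n) (n%:R * f x ^+ n.-1 * u).
Proof.
move=> df; apply: is_derive_ext (is_deriveX n df) => y.
by elim: n => [|n IH]; rewrite ?expr0// !exprS -IH.
Qed.

Lemma is_derive_fZ c f x (u : R) :
  is_derive x (1:R) f u -> is_derive x (1:R) (fun y => c * f y) (c * u).
Proof. by move=> df; apply: is_deriveZ. Qed.

Lemma is_derive_fcomp f g x (u v : R) :
  is_derive (g x) (1:R) f u -> is_derive x (1:R) g v ->
  is_derive x (1:R) (fun y => f (g y)) (u * v).
Proof. by move=> df dg; apply: is_derive1_comp. Qed.

Lemma is_derive_fV f x (u : R) : f x != 0 ->
  is_derive x (1:R) f u -> is_derive x (1:R) (fun y => (f y)^-1) (- u * (f x)^-1 ^+ 2).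
Proof.
move=> fx0 df; apply: (is_derive_cong (is_deriveV fx0 df)).
by rewrite exprVn /GRing.scale/= mulNr mulrC mulNr.
Qed.

Lemma is_derive_affine c d x : is_derive x (1:R) (fun y => c * y + d) c.
Proof.
have dx := is_derive_fZ c (is_derive_id x (1:R)).
apply: (is_derive_cong (is_derive_fD dx (is_derive_cst d x _))).
by rewrite mulr1 addr0.
Qed.

Lemma is_derive_near f g x (d : R) : (\near x, f x = g x) ->
  is_derive x (1:R) f d -> is_derive x (1:R) g d.
Proof. exact: near_eq_is_derive. Qed.

Lemma is_derive_sqr_bound f (C : R) : (forall x, `|f x| <= C * x ^+ 2) ->
  is_derive (0:R) (1:R) f 0.
Proof.
move=> fC; have f0 : f 0 = 0.
  by apply/eqP; rewrite -normr_le0 (le_trans (fC 0))// expr0n mulr0.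
have cvg0 : h^-1 *: (f (h *: (1:R) + 0) - f 0) @[h --> 0^'] --> (0:R).
  apply/cvgrPdist_le => /= e e0; near=> h.
  have h0 : h != 0 by near: h; exact: nbhs_dnbhs_neq.
  rewrite sub0r normrN /GRing.scale/= mulr1 addr0 f0 subr0 normrM normfV.
  rewrite ler_pdivrMl ?normr_gt0// (le_trans (fC _))//.
  rewrite -(real_normK (num_real h)) expr2 mulrCA ler_wpM2l// mulrC.
  have : `|h| < e / (`|C| + 1).
    by near: h; apply: dnbhs0_lt; rewrite divr_gt0// ltr_wpDl.
  rewrite ltr_pdivlMr ?ltr_wpDl// => he.
  rewrite (le_trans _ (ltW he))// ler_wpM2l// (le_trans (ler_norm C))// lerDl//.
by apply: DeriveDef; [apply/cvg_ex; exists 0|apply/cvg_lim].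
Unshelve. all: by end_near. Qed.

Section Integrable.
Variable A : set R.
Hypothesis mA : measurable A.

Lemma integrable_fZ (K : R) f : mu.-integrable A (EFin \o f) ->
  mu.-integrable A (EFin \o (fun x => K * f x)).
Proof. by move=> fi; have := @integrableZl _ _ _ mu A mA K _ fi; apply: eq_integrable. Qed.

Lemma integrable_fD f g : mu.-integrable A (EFin \o f) ->
  mu.-integrable A (EFin \o g) -> mu.-integrable A (EFin \o (fun x => f x + g x)).
Proof. by move=> fi gi; have := @integrableD _ _ _ mu A mA _ _ fi gi; apply: eq_integrable. Qed.

Lemma integrable_fB f g : mu.-integrable A (EFin \o f) ->
  mu.-integrable A (EFin \o g) -> mu.-integrable A (EFin \o (fun x => f x - g x)).
Proof. by move=> fi gi; have := @integrableB _ _ _ mu A mA _ _ fi gi; apply: eq_integrable. Qed.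

Lemma integrable_measurable f : mu.-integrable A (EFin \o f) -> measurable_fun A f.
Proof. by move=> /integrableP[/measurable_EFinP]. Qed.

Lemma integrable_le f g : measurable_fun A f -> (forall x, A x -> `|f x| <= g x) ->
  mu.-integrable A (EFin \o g) -> mu.-integrable A (EFin \o f).
Proof.
move=> mf fg gi; apply: (@le_integrable _ _ _ mu A mA _ _ _ _ gi); first exact/measurable_EFinP.
by move=> x Ax; rewrite /= lee_fin (le_trans (fg x Ax))// ler_norm.
Qed.

Lemma integrable_fM_bounded f g (K : R) : mu.-integrable A (EFin \o f) ->
  measurable_fun A g -> (forall x, A x -> `|g x| <= K) ->
  mu.-integrable A (EFin \o (fun x => f x * g x)).
Proof.
move=> fi mg gK; have mf := integrable_measurable fi.
have Kfi := integrable_fZ K (integrable_norm fi).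
apply: integrable_le Kfi; first exact: measurable_funM.
by move=> x Ax; rewrite normrM mulrC ler_wpM2r// gK.
Qed.

Lemma integrable_cst (K : R) : (mu A < +oo)%E -> mu.-integrable A (EFin \o cst K).
Proof.
move=> Aoo; apply/integrableP; split; first by apply/measurable_EFinP; exact: measurable_cst.
rewrite [ltLHS](_ : _ = (`|K|%:E * mu A)%E) ?lte_mul_pinfty ?lee_fin//.
by rewrite -(@integral_cst _ _ _ mu A mA).
Qed.

End Integrable.

Lemma lebesgue_measure_itv_lty (b1 b2 : bool) a b :
  (mu [set` Interval (BSide b1 a) (BSide b2 b)] < +oo)%E.
Proof. by rewrite lebesgue_measure_itv/=; case: ifP => _; rewrite ?ltry// -EFinD ltry. Qed.

End Calculus.

(** * A smooth step function *)

Section Smooth.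
Context {R : realType}.
Implicit Types (f g : R -> R) (n k : nat).

(** Recursion on the derivative of f, instead of derivability of each iterated derivative: stability
    under sums, products and inverses is then a plain induction on n. *)
Fixpoint differentiable_n n f : Prop :=
  if n is m.+1 then (forall x, derivable f x 1) /\ differentiable_n m (derive1 f)
  else True.

Lemma differentiable_nP f :
  (forall n x, derivable (derive1n n f) x 1) <-> forall n, differentiable_n n f.
Proof.
split=> [df n|df n].
  elim: n f df => // n IH f df; split; first exact: (df 0%N).
  by apply: IH => m x; have := df m.+1 x; rewrite derive1Sn.
elim: n f df => [|n IH] f df x; first by have [] := df 1%N.
by rewrite derive1Sn; apply: IH => m; have [] := df m.+1.
Qed.

Lemma differentiable_nS n f (df : R -> R) :
  (forall x, is_derive x (1:R) f (df x)) ->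
  differentiable_n n df -> differentiable_n n.+1 f.
Proof.
move=> fdf dn; split; first by move=> x; have := fdf x.
by have -> : derive1 f = df by apply/funext => x; exact: is_derive_derive1.
Qed.

Lemma differentiable_nSP n f : differentiable_n n.+1 f ->
  forall x, is_derive x (1:R) f (derive1 f x).
Proof. by move=> [+ _] x => /(_ x) /derivableP; rewrite derive1E. Qed.

Lemma differentiable_nW n f : differentiable_n n.+1 f -> differentiable_n n f.
Proof. by elim: n f => // n IH f [df /IH]. Qed.

Lemma differentiable_n_cst n (c : R) : differentiable_n n (cst c).
Proof.
elim: n c => // n IH c.
exact: (@differentiable_nS _ _ (cst 0) (fun x => is_derive_cst _ _ _) (IH 0)).
Qed.

Lemma differentiable_nD n f g : differentiable_n n f -> differentiable_n n g ->
  differentiable_n n (fun x => f x + g x).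
Proof.
elim: n f g => // n IH f g df dg.
have d x := is_derive_fD (differentiable_nSP df x) (differentiable_nSP dg x).
apply: (differentiable_nS d).
by apply: IH; [case: df|case: dg].
Qed.

Lemma differentiable_nM n f g : differentiable_n n f -> differentiable_n n g ->
  differentiable_n n (fun x => f x * g x).
Proof.
elim: n f g => // n IH f g df dg.
have d x := is_derive_fM (differentiable_nSP df x) (differentiable_nSP dg x).
apply: (differentiable_nS d).
by apply: differentiable_nD; apply: IH; do ?exact: differentiable_nW; [case: df|case: dg].
Qed.

Lemma differentiable_nV n f : (forall x, f x != 0) -> differentiable_n n f ->
  differentiable_n n (fun x => (f x)^-1).
Proof.
move=> f0; elim: n => // n IH df.
have d x : is_derive x (1:R) (fun x => (f x)^-1) ((-1) * derive1 f x * ((f x)^-1 * (f x)^-1)).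
  apply: (is_derive_cong (is_derive_fV (f0 x) (differentiable_nSP df x))).
  by rewrite expr2 mulN1r.
apply: (differentiable_nS d).
have dV := IH (differentiable_nW df); do ?apply: differentiable_nM => //.
  exact: differentiable_n_cst.
by case: df.
Qed.

Lemma differentiable_n_affine n f (c d : R) : differentiable_n n f ->
  differentiable_n n (fun x => f (c * x + d)).
Proof.
elim: n f => // n IH f df.
have dd x : is_derive x (1:R) (fun x => f (c * x + d)) (derive1 f (c * x + d) * c).
  exact: is_derive_fcomp (differentiable_nSP df _) (is_derive_affine c d x).
apply: (differentiable_nS dd).
apply: differentiable_nM; last exact: differentiable_n_cst.
by apply: IH; case: df.
Qed.

(** The functions x^-k exp (- 1 / x), extended by 0. The power is carried along because the
    derivative of a member is a combination of two other members, so that all are smooth by one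
    induction. *)
Definition flat k (x : R) : R := if 0 < x then x^-1 ^+ k * expR (- x^-1) else 0.

Lemma flat_ge0 k x : 0 <= flat k x.
Proof.
by rewrite /flat; case: ifP => // x0; rewrite mulr_ge0 ?expR_ge0// exprn_ge0// invr_ge0 ltW.
Qed.

(** With y = 1 / x this is y^(k + 1) <= (k + 1)! exp y, one term of the exponential series. *)
Lemma flat_bound k x : flat k x <= (k.+1`!)%:R * `|x|.
Proof.
rewrite /flat; case: ifP => x0; last by rewrite mulr_ge0.
have y0 : 0 <= x^-1 by rewrite invr_ge0 ltW.
rewrite gtr0_norm// expRN -[X in _ <= _ * X]invrK.
rewrite ler_pdivrMr ?expR_gt0// mulrAC ler_pdivlMr ?invr_gt0// -exprSr.
rewrite mulrC -ler_pdivrMr ?ltr0n ?fact_gt0//.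
by apply: le_trans (expR_ge1Dxn k y0); rewrite lerDr.
Qed.

Lemma is_derive_flat k x :
  is_derive x (1:R) (flat k) (- k%:R * flat k.+1 x + flat k.+2 x).
Proof.
have [x0|x0|->] := ltgtP x 0.
- have -> : - k%:R * flat k.+1 x + flat k.+2 x = 0.
    by rewrite /flat ltNge (ltW x0)/= mulr0 addr0.
  apply: is_derive_near (is_derive_cst (0:R) x (1:R)).
  near=> y; rewrite /flat ifF//; apply/negbTE; rewrite -leNgt ltW//.
  by near: y; exact: lt_nbhsl.
- have -> : - k%:R * flat k.+1 x + flat k.+2 x =
      k%:R * x^-1 ^+ k.-1 * (- 1 * x^-1 ^+ 2) * expR (- x^-1) +
      x^-1 ^+ k * (expR (- x^-1) * - (- 1 * x^-1 ^+ 2)).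
    rewrite /flat x0; case: k => [|k /=]; rewrite ?mul0r ?oppr0 ?mul0r ?add0r !exprS; ring.
  suff : is_derive x (1:R) (fun y => y^-1 ^+ k * expR (- y^-1))
      (k%:R * x^-1 ^+ k.-1 * (- 1 * x^-1 ^+ 2) * expR (- x^-1) +
       x^-1 ^+ k * (expR (- x^-1) * - (- 1 * x^-1 ^+ 2))).
    apply: is_derive_near.
    near=> y; rewrite /flat ifT//; near: y; exact: lt_nbhsr.
  have dV : is_derive x (1:R) (fun y : R => y^-1) (- 1 * x^-1 ^+ 2).
    have x0' : id x != 0 by rewrite gt_eqF.
    exact: is_derive_fV x0' (is_derive_id x (1:R)).
  have dX : is_derive x (1:R) (fun y : R => y^-1 ^+ k)
    (k%:R * x^-1 ^+ k.-1 * (- 1 * x^-1 ^+ 2)) := is_derive_fX k dV.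
  exact: is_derive_fM dX (is_derive_fcomp (is_derive_expR _) (is_derive_fN dV)).
- have -> : - k%:R * flat k.+1 0 + flat k.+2 0 = 0.
    by rewrite /flat ltxx mulr0 addr0.
  (* Since [flat k y] = y [flat k.+1 y], the linear bound for [flat k.+1] yields a quadratic one for
     [flat k]; hence the factorial of k + 2. *)
  apply: (@is_derive_sqr_bound _ _ (k.+2`!)%:R) => y.
  rewrite ger0_norm ?flat_ge0//.
  have [y0|y0] := ltP 0 y; last first.
    by rewrite /flat ltNge y0/= mulr_ge0 ?sqr_ge0.
  have -> : flat k y = y * flat k.+1 y.
    by rewrite /flat y0 exprS !mulrA mulfV ?mul1r// gt_eqF.
  rewrite expr2 mulrCA ler_wpM2l ?(ltW y0)//.
  by rewrite -[X in _ <= _ * X](gtr0_norm y0) flat_bound.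
Unshelve. all: by end_near. Qed.

Lemma differentiable_n_flat n k : differentiable_n n (flat k).
Proof.
elim: n k => // n IH k; apply: differentiable_nS (is_derive_flat k) _.
by apply: differentiable_nD => //; apply: differentiable_nM => //; exact: differentiable_n_cst.
Qed.

(** The classical smooth transition f(x) / (f(x) + f(1 - x)), equal to 0 up to 0 and to 1 from 1 on;
    1 - x is spelt as an affine map to fit [differentiable_n_affine]. *)
Definition step (x : R) : R := flat 0 x / (flat 0 x + flat 0 (- 1 * x + 1)).

Lemma step_den_gt0 x : 0 < flat 0 x + flat 0 (- 1 * x + 1).
Proof.
have f0 y : 0 < y -> 0 < flat 0 y by move=> y0; rewrite /flat y0 mul1r expR_gt0.
have [x0|x0] := ltP 0 x; first by rewrite ltr_pwDl ?f0// flat_ge0.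
by rewrite ltr_wpDl ?flat_ge0// f0//; lra.
Qed.

Lemma step0 x : x <= 0 -> step x = 0.
Proof. by move=> x0; rewrite /step {1}/flat ltNge x0 mul0r. Qed.

Lemma step1 x : 1 <= x -> step x = 1.
Proof.
move=> x1; rewrite /step [flat 0 (- 1 * x + 1)]/flat ifF ?addr0; last first.
  by apply/negbTE; rewrite -leNgt; lra.
by rewrite divff//; have := step_den_gt0 x; rewrite [flat 0 (- 1 * x + 1)]/flat ifF ?addr0
  => [/lt0r_neq0//|]; apply/negbTE; rewrite -leNgt; lra.
Qed.

Lemma differentiable_n_step n : differentiable_n n step.
Proof.
apply: differentiable_nM; first exact: differentiable_n_flat.
apply: differentiable_nV; first by move=> x; rewrite gt_eqF// step_den_gt0.
apply: differentiable_nD; first exact: differentiable_n_flat.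
by apply: differentiable_n_affine; exact: differentiable_n_flat.
Qed.

Lemma is_derive_step x : is_derive x (1:R) step (derive1 step x).
Proof. exact: differentiable_nSP (differentiable_n_step 1) x. Qed.

Lemma step_derive1_continuous : continuous (derive1 step).
Proof.
have d2 : differentiable_n 1 (derive1 step) by case: (differentiable_n_step 2).
move=> x.
have dx := differentiable_nSP d2 x.
exact: (is_derive_continuous dx).
Qed.

(** As [flat 0] has derivative [flat 2], the quotient rule leaves a numerator made of products of
    values of [flat], all nonnegative. *)
Lemma step_derive1_ge0 x : 0 <= derive1 step x.
Proof.
have dfl k y : is_derive y (1:R) (fun z => flat k z) (- k%:R * flat k.+1 y + flat k.+2 y).
  exact: is_derive_flat.
have dflc y : is_derive y (1:R) (fun z => flat 0 (- 1 * z + 1))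
    ((- 0%:R * flat 1 (- 1 * y + 1) + flat 2 (- 1 * y + 1)) * - 1).
  exact: is_derive_fcomp (dfl 0%N _) (is_derive_affine _ _ _).
have den0 : flat 0 x + flat 0 (- 1 * x + 1) != 0 by rewrite gt_eqF ?step_den_gt0.
have dden := is_derive_fD (dfl 0%N x) (dflc x).
have := is_derive_fM (dfl 0%N x) (@is_derive_fV R _ x _ den0 dden).
move=> /is_derive_derive1 ->.
have := step_den_gt0 x.
have := @flat_ge0 0 x; have := @flat_ge0 2 x.
have := @flat_ge0 0 (- 1 * x + 1); have := @flat_ge0 2 (- 1 * x + 1).
set A := flat 0 x; set B := flat 0 (- 1 * x + 1).
set A2 := flat 2 x; set B2 := flat 2 (- 1 * x + 1) => hB2 hB hA2 hA hAB.
rewrite !mulNr !mul0r !oppr0 !add0r.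
rewrite [leRHS](_ : _ = (A2 * B + A * B2) * (A + B)^-1 ^+ 2); last first.
  by field; rewrite gt_eqF.
by rewrite mulr_ge0 ?exprn_ge0 ?invr_ge0 ?(ltW hAB)// addr_ge0 ?mulr_ge0.
Qed.

Lemma step_itv x : 0 <= step x <= 1.
Proof.
rewrite /step divr_ge0 ?flat_ge0 ?(ltW (step_den_gt0 _))//=.
by rewrite ler_pdivrMr ?step_den_gt0// mul1r lerDl flat_ge0.
Qed.

End Smooth.

(** * Weak derivatives of real functions *)

Section WeakDerivative.
Context {R : realType}.
Notation mu := (@lebesgue_measure R).
Implicit Types (f g u v phi : R -> R) (a b c d x y : R).

Lemma step_derive1_eq0 x : (x < 0) || (1 < x) -> derive1 step x = 0.
Proof.
move=> /orP[x0|x1]; apply: is_derive_derive1.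
  apply: is_derive_near (is_derive_cst (0:R) x (1:R)); near=> y.
  by rewrite step0// ltW//; near: y; exact: lt_nbhsl.
apply: is_derive_near (is_derive_cst (1:R) x (1:R)); near=> y.
by rewrite step1// ltW//; near: y; exact: lt_nbhsr.
Unshelve. all: by end_near. Qed.

(** A smooth version of the indicator of [c, d], rising on [c, c + e] and falling on [d - e, d]. The
    sign of the derivative on each half makes its absolute mass 1 there, so that integrating u
    against it averages u near c and near d. *)
Lemma plateau_function a b c d (e : R) : a < c -> d < b -> 0 < e -> 2 * e < d - c ->
  exists phi (dphi : R -> R), [/\ test_function a b phi,
    forall x, is_derive x (1:R) phi (dphi x), continuous dphi &
    [/\ forall x, 0 <= phi x <= 1,
        forall x, (x <= c) || (d <= x) -> phi x = 0,
        forall x, c + e <= x <= d - e -> phi x = 1 &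
    [/\ forall x, c <= x <= (c + d) / 2 -> 0 <= dphi x,
        forall x, (c + d) / 2 <= x <= d -> dphi x <= 0,
        forall x, c + e < x < d - e -> dphi x = 0 &
        forall x, (x < c) || (d < x) -> dphi x = 0]]].
Proof.
move=> ac db e0 ecd.
pose l x := e^-1 * x + - (e^-1 * c); pose r x := - e^-1 * x + e^-1 * d.
have lE x : l x = (x - c) / e by rewrite /l mulrBl; ring.
have rE x : r x = (d - x) / e by rewrite /r mulrBl; ring.
pose phi x := step (l x) * step (r x).
pose dphi x := derive1 step (l x) * e^-1 * step (r x) +
               step (l x) * (derive1 step (r x) * - e^-1).
have dl x : is_derive x (1:R) (fun y => step (l y)) (derive1 step (l x) * e^-1).
  exact: is_derive_fcomp (is_derive_step _) (is_derive_affine _ _ _).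
have dr x : is_derive x (1:R) (fun y => step (r y)) (derive1 step (r x) * - e^-1).
  exact: is_derive_fcomp (is_derive_step _) (is_derive_affine _ _ _).
have dphiE x : is_derive x (1:R) phi (dphi x) := is_derive_fM (dl x) (dr x).
have phi0 x : (x <= c) || (d <= x) -> phi x = 0.
  by move=> /orP[xc|dx]; rewrite /phi; [rewrite step0 ?mul0r//|rewrite [X in _ * X]step0 ?mulr0//];
    rewrite ?lE ?rE pmulr_lle0 ?invr_gt0// subr_le0.
have l1 x : c + e < x -> 1 < l x.
  by move=> xe; rewrite lE ltr_pdivlMr// mul1r ltrBrDl.
have r1 x : x < d - e -> 1 < r x.
  by move=> xe; rewrite rE ltr_pdivlMr// mul1r ltrBrDl -ltrBrDr.
have einv0 : 0 < e^-1 by rewrite invr_gt0.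
exists phi, dphi; split => //; last split => //; last split.
- split.
    apply/differentiable_nP => n; apply: differentiable_nM.
      exact: differentiable_n_affine (differentiable_n_step n).
    exact: differentiable_n_affine (differentiable_n_step n).
  exists `[c, d]%classic; split; first exact: segment_compact.
    by apply: subset_itv; rewrite bnd_simp.
  move=> x /= /negP; rewrite in_itv/= negb_and -!ltNge => H; apply: phi0.
  by case/orP: H => /ltW ->; rewrite ?orbT.
- have cl : continuous l by move=> x; exact: is_derive_continuous (is_derive_affine _ _ _).
  have cr : continuous r by move=> x; exact: is_derive_continuous (is_derive_affine _ _ _).
  have cs : continuous (@step R) by move=> x; exact: is_derive_continuous (is_derive_step x).
  have cs' := @step_derive1_continuous R.
  move=> x; apply: cvgD.
    apply: cvgM; last by apply: continuous_comp; [exact: cr|exact: cs].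
    by apply: cvgM; [apply: continuous_comp; [exact: cl|exact: cs']|exact: cvg_cst].
  apply: cvgM; first by apply: continuous_comp; [exact: cl|exact: cs].
  by apply: cvgM; [apply: continuous_comp; [exact: cr|exact: cs']|exact: cvg_cst].
- move=> x; have /andP[? ?] := step_itv (l x); have /andP[? ?] := step_itv (r x).
  by rewrite /phi mulr_ge0//= mulr_ile1.
- move=> x /andP[cx xd]; rewrite /phi !step1 ?mulr1//.
    by rewrite rE ler_pdivlMr// mul1r lerBrDl -lerBrDr.
  by rewrite lE ler_pdivlMr// mul1r lerBrDl.
- move=> x /andP[cx xm]; rewrite /dphi (@step_derive1_eq0 (r x)) ?r1 ?orbT//; last by lra.
  have /andP[? ?] := step_itv (r x).
  by rewrite mul0r mulr0 addr0 mulr_ge0// mulr_ge0 ?step_derive1_ge0 ?(ltW einv0)//.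
- move=> x /andP[mx xd]; rewrite /dphi (@step_derive1_eq0 (l x)) ?l1 ?orbT//; last by lra.
  have /andP[? ?] := step_itv (l x).
  by rewrite !mul0r add0r mulrN mulrN oppr_le0 mulr_ge0// mulr_ge0 ?step_derive1_ge0 ?(ltW einv0)//.
- move=> x /andP[cx xd]; rewrite /dphi (@step_derive1_eq0 (l x)) ?l1 ?orbT//.
  by rewrite (@step_derive1_eq0 (r x)) ?r1 ?orbT// !(mul0r, mulr0) addr0.
- move=> x /orP[xc|dx].
    have lx : l x < 0 by rewrite lE pmulr_llt0// subr_lt0.
    by rewrite /dphi step_derive1_eq0 ?lx// (step0 (ltW lx)) !mul0r addr0.
  have rx : r x < 0 by rewrite rE pmulr_llt0// subr_lt0.
  by rewrite /dphi (@step_derive1_eq0 (r x)) ?rx// (step0 (ltW rx)) !(mul0r,mulr0) addr0.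
Qed.

Lemma Rintegral_support f (A B : set R) : A `<=` B ->
  (forall x, B x -> ~ A x -> f x = 0) ->
  \int[mu]_(x in B) f x = \int[mu]_(x in A) f x.
Proof.
move=> AB f0; rewrite Rintegral_mkcond [RHS]Rintegral_mkcond; congr (\int[mu]_x _).
apply/funext => x; rewrite /patch; case: ifPn => [/set_mem Bx|].
  by case: ifPn => // /negP; rewrite inE => /(f0 x Bx).
case: ifPn => // /set_mem /AB Bx; by rewrite notin_setE.
Qed.

Definition real_weak_derivative a b u v :=
  [/\ locally_integrable `]a, b[ u, locally_integrable `]a, b[ v &
      forall phi, test_function a b phi ->
        \int[mu]_(x in `]a, b[) (u x * derive1 phi x) =
        - \int[mu]_(x in `]a, b[) (v x * phi x)].

Lemma locally_integrable_itv u a b c d : locally_integrable `]a, b[ u ->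
  a < c -> d < b -> mu.-integrable `[c, d] (EFin \o u).
Proof.
move=> [mu_ _ iu] ac db; have cdab : `[c, d]%classic `<=` `]a, b[%classic.
  by apply: subset_itv; rewrite bnd_simp.
apply/integrableP; split.
  by apply/measurable_EFinP; apply: measurable_funS mu_.
by apply: iu => //; exact: segment_compact.
Qed.

(** Test with a plateau [phi] on [c, d]. The integral of u [phi'] is close to u(c) - u(d) by
    continuity of u; the integral of v [phi] differs from that of v by the contribution of the two
    short ramps. There are three errors, for u(c), u(d) and v, each at most e'/3. *)
Lemma real_weak_derivative_FTC a b u v :
  (forall x, a < x < b -> {for x, continuous u}) -> real_weak_derivative a b u v ->
  forall c d, a < c -> c <= d -> d < b -> \int[mu]_(x in `[c, d]) v x = u d - u c.
Proof.
move=> cu [lu lv uv] c d ac; rewrite le_eqVlt => /predU1P[<- _|cd db].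
  by rewrite set_itv1 Rintegral_set1 subrr.
have vi := locally_integrable_itv lv ac db.
have ui := locally_integrable_itv lu ac db.
apply/eqP; rewrite -subr_eq0 -normr_eq0; apply/eqP/le_anti; rewrite normr_ge0 andbT.
apply/ler_addgt0Pl => e' e'0; rewrite addr0; set e := e' / 3.
have e0 : 0 < e by rewrite divr_gt0.
have -> : e' = e + e + e by rewrite /e; field.
(* Absolute continuity of the integral of |v|, used for the union of the two ramps, of measure at
   most 2 [del]. *)
have [d0 [d00 Hd0]] : exists d0 : R, 0 < d0 /\
    (forall A, measurable A -> (mu A < d0%:E)%E ->
       \int[mu]_(x in A) `|(v \_ `[c, d]) x| < e).
  apply: integral_normr_continuous => //.
  by rewrite -restrict_EFin; apply/integrable_restrict => //=; rewrite setTI.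
have nbu (z : R) : a < z < b -> exists2 r : R, 0 < r & forall x, `|z - x| < r -> `|u x - u z| <= e.
  move=> /cu /cvgrPdist_le /(_ e e0) /nbhs_ballP[r/= r0 rH]; exists r => // x xr.
  by rewrite distrC; apply: rH.
have [rc rc0 Hc] := nbu c ltac:(by rewrite ac (lt_trans cd)).
have [rd rd0 Hd] := nbu d ltac:(by rewrite db (lt_trans ac)).
have [del [del0 delcd delc deld deld0]] : exists del : R,
    [/\ 0 < del, 2 * del < d - c, del < rc, del < rd & 2 * del < d0].
  pose m := Num.min (Num.min rc rd) (Num.min (d - c) d0).
  have m0 : 0 < m by rewrite !lt_min rc0 rd0 d00 subr_gt0 cd.
  have [m1 m2 m3 m4] : [/\ m <= rc, m <= rd, m <= d - c & m <= d0].
    by rewrite /m !ge_min !lexx ?orbT.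
  by move: m m0 m1 m2 m3 m4 => m; clear; exists (m / 3); split; lra.
have [phi [dphi [tphi dphiE cdphi [phi01 phi0 phi1 [dphi_ge dphi_le dphi_mid dphi_out]]]]] :=
  plateau_function ac db del0 delcd.
have phiE : derive1 phi = dphi by apply/funext => x; exact: is_derive_derive1.
have cphi : continuous phi by move=> x; exact: is_derive_continuous (dphiE x).
have cdab : `[c, d]%classic `<=` `]a, b[%classic.
  by apply: subset_itv; rewrite bnd_simp.
have := uv _ tphi; rewrite phiE.
rewrite (Rintegral_support cdab); last first.
  move=> x _ /negP; rewrite /= in_itv/= negb_and -!ltNge => /dphi_out ->.
  by rewrite mulr0.
rewrite (Rintegral_support cdab); last first.
  move=> x _ /negP; rewrite /= in_itv/= negb_and -!ltNge => H; rewrite phi0 ?mulr0//.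
  by case/orP : H => /ltW ->; rewrite ?orbT.
have mphi (A : set R) : measurable A -> measurable_fun A phi.
  by move=> mA; apply: measurable_funTS; exact: continuous_measurable_fun.
have vphii : mu.-integrable `[c, d] (EFin \o (fun x => v x * phi x)).
  apply: (integrable_fM_bounded _ (K := 1)) => //; first exact: mphi.
  by move=> x _; have /andP[p0 p1] := phi01 x; rewrite ger0_norm.
have Hv : `|\int[mu]_(x in `[c, d]) v x - \int[mu]_(x in `[c, d]) (v x * phi x)| <= e.
  rewrite -RintegralB//.
  have wi : mu.-integrable `[c, d] (EFin \o (fun x => v x - v x * phi x)).
    exact: integrable_fB.
  rewrite (le_trans (le_normr_Rintegral _ wi))//.
  pose A : set R := `[c, c + del]%classic `|` `[d - del, d]%classic.
  have mA : measurable A by apply: measurableU.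
  have muA : (mu A < d0%:E)%E.
    apply: (@le_lt_trans _ _ (mu [set` `[c, (c + del)%R]] + mu [set` `[(d - del)%R, d]])%E).
      by apply: measureU2.
    rewrite !lebesgue_measure_itv/= !lte_fin.
    rewrite ltrDl del0 gtrBl del0 -!EFinD lte_fin.
    by rewrite [ltLHS](_ : _ = 2 * del)//; ring.
  apply: le_trans (ltW (Hd0 A mA muA)).
  have vcdi : mu.-integrable setT (EFin \o (fun x => `|(v \_ `[c, d]) x|)).
    have : mu.-integrable setT (EFin \o (v \_ `[c, d])).
      by rewrite -restrict_EFin; apply/integrable_restrict => //=; rewrite setTI.
    by move/integrable_norm.
  have Acd : A `<=` `[c, d].
    move=> x; rewrite /A/= !in_itv/=; move: del0 delcd; clear.
    by move=> ? ? [] /andP[? ?]; apply/andP; split; lra.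
  rewrite (_ : \int[mu]_(x in A) _ = \int[mu]_(x in `[c, d]) ((fun x => `|(v \_ `[c, d]) x|) \_ A) x); last first.
    by rewrite -Rintegral_mkcondr setIC setIidl.
  apply: le_Rintegral => //.
  - exact: integrable_norm.
  - rewrite -restrict_EFin; apply/integrable_restrict => //=.
    apply: (@integrableS _ _ _ mu setT) vcdi => //; exact: measurableI.
  move=> x xcd; rewrite /patch; case: ifPn => [_|xA].
    rewrite ifT ?inE//.
    have -> : v x - v x * phi x = v x * (1 - phi x) by ring.
    have /andP[p0 p1] := phi01 x.
    by rewrite normrM ler_piMr// ger0_norm; move: p0 p1; clear; lra.
  rewrite phi1 ?mulr1 ?subrr ?normr0//.
  move: xcd xA; rewrite notin_setE /A/= !in_itv/= => /andP[cx xd] /not_orP[].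
  rewrite cx xd /= andbT => /negP; rewrite -ltNge => /ltW -> /negP.
  by rewrite -ltNge => /ltW ->.
set m := (c + d) / 2.
have [cm md] : c <= m /\ m <= d by rewrite /m !midf_le ?ltW.
have phim : phi m = 1 by apply: phi1; rewrite /m; lra.
have phic : phi c = 0 by apply: phi0; rewrite lexx.
have phid : phi d = 0 by apply: phi0; rewrite lexx orbT.
have cdi x y : mu.-integrable `[x, y] (EFin \o dphi).
  by apply: integrable_continuous_itv => z _; exact: cdphi.
(* One half of the plateau at a time: |[dphi]| has mass 1 and lives where u is within e of [u z].
   The factor |[dphi x]| on both sides of the hypothesis makes it void where [dphi] vanishes. *)
have Hhalf z y1 y2 : a < z < b -> a < y1 -> y1 <= y2 -> y2 < b ->
    (forall x, y1 <= x <= y2 -> `|u x - u z| * `|dphi x| <= e * `|dphi x|) ->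
    \int[mu]_(x in `[y1, y2]) `|dphi x| = 1 ->
    `|\int[mu]_(x in `[y1, y2]) (u x * dphi x) - u z * (phi y2 - phi y1)| <= e.
  move=> zab ay1 y12 y2b H I1.
  have uab x : y1 <= x <= y2 -> {for x, continuous u}.
    by move=> /andP[h1 h2]; apply: cu; rewrite (lt_le_trans ay1)//= (le_lt_trans h2).
  rewrite -(FTC2 y12 (fun x _ => dphiE x) (fun x _ => cdphi x)).
  rewrite -RintegralZl// -RintegralB//; last first.
  - by apply: integrable_continuous_itv => x _; apply: cvgM; [exact: cvg_cst|exact: cdphi].
  - apply: integrable_continuous_itv => x xy; apply: cvgM; [exact: uab|exact: cdphi].
  have Fi : mu.-integrable `[y1, y2] (EFin \o (fun x => u x * dphi x - u z * dphi x)).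
    apply: integrable_continuous_itv => x xy; apply: cvgB; apply: cvgM;
      [exact: uab|exact: cdphi|exact: cvg_cst|exact: cdphi].
  rewrite (le_trans (le_normr_Rintegral _ Fi))//.
  apply: (@le_trans _ _ (\int[mu]_(x in `[y1, y2]) (e * `|dphi x|))).
    apply: le_Rintegral => //; first exact: integrable_norm.
      apply: integrable_continuous_itv => x _; apply: cvgM; first exact: cvg_cst.
      by apply: cvg_norm; exact: cdphi.
    by move=> x; rewrite /= in_itv/= => xy; rewrite -mulrBl normrM; exact: H.
  by rewrite RintegralZl ?I1 ?mulr1//; exact: integrable_norm.
have H1 : `|\int[mu]_(x in `[c, m]) (u x * dphi x) - u c| <= e.
  have := @Hhalf c c m; rewrite phim phic subr0 mulr1.
  apply => //; [by rewrite ac (lt_trans cd)|by rewrite (le_lt_trans md)| |].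
    move=> x /andP[cx xm]; have [->|x0] := eqVneq (dphi x) 0; first by rewrite normr0 !mulr0.
    rewrite ler_wpM2r// Hc// distrC ger0_norm ?subr_ge0//.
    rewrite ltNge; apply/negP => xrc; move/negP: x0; apply; apply/eqP; apply: dphi_mid.
    by move: xm xrc delc delcd; rewrite /m; clear; lra.
  have -> : \int[mu]_(x in `[c, m]) `|dphi x| = \int[mu]_(x in `[c, m]) dphi x.
    by apply: eq_Rintegral => x; rewrite inE/= in_itv/= => xcm; rewrite ger0_norm// dphi_ge.
  rewrite (FTC2 cm (fun x _ => dphiE x) (fun x _ => cdphi x)).
  by rewrite phim phic subr0.
have H2 : `|\int[mu]_(x in `[m, d]) (u x * dphi x) + u d| <= e.
  have := @Hhalf d m d; rewrite phim phid sub0r mulrN1 opprK.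
  apply => //; [by rewrite db (lt_trans ac)|by rewrite (lt_le_trans ac)| |].
    move=> x /andP[cx xm]; have [->|x0] := eqVneq (dphi x) 0; first by rewrite normr0 !mulr0.
    rewrite ler_wpM2r// Hd// ger0_norm ?subr_ge0//.
    rewrite ltNge; apply/negP => xrc; move/negP: x0; apply; apply/eqP; apply: dphi_mid.
    by move: cx xrc deld delcd; rewrite /m; clear; lra.
  have -> : \int[mu]_(x in `[m, d]) `|dphi x| = \int[mu]_(x in `[m, d]) ((-1) * dphi x).
    by apply: eq_Rintegral => x; rewrite inE/= in_itv/= => xcm; rewrite ler0_norm ?dphi_le// mulN1r.
  rewrite RintegralZl// (FTC2 md (fun x _ => dphiE x) (fun x _ => cdphi x)).
  by rewrite phim phid sub0r mulN1r opprK.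
rewrite (@Rintegral_itv_split _ _ c m d)//; last first.
  apply: integrable_continuous_itv => x /andP[h1 h2]; apply: cvgM; last exact: cdphi.
  by apply: cu; rewrite (lt_le_trans ac)//= (le_lt_trans h2).
move=> E; move: Hv H1 H2.
have -> : \int[mu]_(x in `[c, d]) (v x * phi x) =
  - (\int[mu]_(x in `[c, m]) (u x * dphi x) + \int[mu]_(x in `[m, d]) (u x * dphi x)).
  by rewrite E opprK.
set V := \int[mu]_(x in `[c, d]) v x.
set X := \int[mu]_(x in `[c, m]) _; set Y := \int[mu]_(x in `[m, d]) _.
rewrite !ler_norml; move: V X Y (u c) (u d) => V X Y uc ud; clear.
by move=> /andP[? ?] /andP[? ?] /andP[? ?]; apply/andP; split; lra.
Qed.

End WeakDerivative.

(** * Classical and weak derivatives; uniqueness of the weak derivative *)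

Section WeakDerivative2.
Context {R : realType}.
Notation mu := (@lebesgue_measure R).
Implicit Types (f g u v phi : R -> R) (a b c d x y : R).

(** Taking c halfway between a and the least point of the support, and d symmetrically, makes the
    function vanish at c and d themselves, as integration by parts requires. *)
Lemma test_function_support a b phi : a < b -> test_function a b phi ->
  exists c d : R, [/\ a < c, c <= d, d < b & forall x, (x <= c) || (d <= x) -> phi x = 0].
Proof.
move=> ab [_ [K [cK Kab phi0]]].
have [K0|/set0P K0] := eqVneq K set0.
  exists ((a + b) / 2), ((a + b) / 2); split; do ?lra.
  by move=> x _; apply: phi0; rewrite K0.
have cid : {within K, continuous (id : R -> R)}.
  by apply: continuous_subspaceT => x; exact: cvg_id.
have [l /set_mem Kl lK] := compact_EVT_min K0 cK cid.
have [r /set_mem Kr rK] := compact_EVT_max K0 cK cid.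
have /andP[al lb] : a < l < b by have := Kab _ Kl; rewrite /= in_itv.
have /andP[ar rb] : a < r < b by have := Kab _ Kr; rewrite /= in_itv.
have lr : l <= r by apply: (lK r); exact/mem_set.
exists ((a + l) / 2), ((r + b) / 2); split; do ?lra.
move=> x /orP[xl|xr]; apply: phi0 => Kx.
  have : l <= x := lK x (mem_set Kx); lra.
have : x <= r := rK x (mem_set Kx); lra.
Qed.

Lemma locally_integrable_continuous a b u :
  (forall x, a < x < b -> {for x, continuous u}) -> locally_integrable `]a, b[ u.
Proof.
move=> cu; split.
- apply: open_continuous_measurable_fun; first exact: interval_open.
  by move=> x; rewrite inE/= in_itv/=; exact: cu.
- exact: interval_open.
move=> K Kab cK; have : mu.-integrable K (EFin \o u).
  apply: continuous_compact_integrable => //.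
  by apply: continuous_in_subspaceT => x /set_mem /Kab; rewrite /= in_itv/=; exact: cu.
by move=> /integrableP[_].
Qed.

(** Integration by parts on a closed interval carrying the test function; the boundary terms
    vanish. *)
Lemma C1_real_weak_derivative a b u v : a < b ->
  (forall x, a < x < b -> is_derive x (1:R) u (v x)) ->
  (forall x, a < x < b -> {for x, continuous v}) -> real_weak_derivative a b u v.
Proof.
move=> ab du cv.
have cu x : a < x < b -> {for x, continuous u} by move=> /du; exact: is_derive_continuous.
split; [exact: locally_integrable_continuous|exact: locally_integrable_continuous|].
move=> phi tphi; have [c [d [ac cd db phi0]]] := test_function_support ab tphi.
have cdab : `[c, d]%classic `<=` `]a, b[%classic.
  by apply: subset_itv; rewrite bnd_simp.
have [/differentiable_nP dphi _] := tphi.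
have dphiE x : is_derive x (1:R) phi (derive1 phi x) := differentiable_nSP (dphi 1%N) x.
have d2 : differentiable_n 1 (derive1 phi) by case: (dphi 2%N).
have cphi x : {for x, continuous phi} := is_derive_continuous (dphiE x).
have cdphi x : {for x, continuous (derive1 phi)}.
  have dx := differentiable_nSP d2 x; exact: (is_derive_continuous dx).
have dphi0 x : (x < c) || (d < x) -> derive1 phi x = 0.
  move=> H; apply: is_derive_derive1.
  apply: is_derive_near (is_derive_cst (0:R) x (1:R)); case/orP : H => H; near=> y.
    by rewrite phi0// ltW//; near: y; exact: lt_nbhsl.
  by rewrite phi0// [d <= y]ltW ?orbT//; near: y; exact: lt_nbhsr.
rewrite (Rintegral_support cdab); last first.
  move=> x _ /negP; rewrite /= in_itv/= negb_and -!ltNge => /dphi0 ->.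
  by rewrite mulr0.
rewrite (Rintegral_support cdab); last first.
  move=> x _ /negP; rewrite /= in_itv/= negb_and -!ltNge => H; rewrite phi0 ?mulr0//.
  by case/orP : H => /ltW ->; rewrite ?orbT.
have cdin x : c <= x <= d -> a < x < b.
  by move=> /andP[cx xd]; rewrite (lt_le_trans ac)//= (le_lt_trans xd).
have i1 : mu.-integrable `[c, d] (EFin \o (fun x => u x * derive1 phi x)).
  by apply: integrable_continuous_itv => x /cdin xab; apply: cvgM; [exact: cu|exact: cdphi].
have i2 : mu.-integrable `[c, d] (EFin \o (fun x => v x * phi x)).
  by apply: integrable_continuous_itv => x /cdin xab; apply: cvgM; [exact: cv|exact: cphi].
apply/eqP; rewrite -addr_eq0 -RintegralD//; apply/eqP.
have dF x : c <= x <= d ->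
    is_derive x (1:R) (fun x => u x * phi x) (u x * derive1 phi x + v x * phi x).
  move=> /cdin xab; apply: is_derive_cong (is_derive_fM (du _ xab) (dphiE x)) _.
  by rewrite addrC.
rewrite (FTC2 cd dF); last first.
  move=> x /cdin xab; apply: cvgD; apply: cvgM;
    [exact: cu|exact: cdphi|exact: cv|exact: cphi].
by rewrite phi0 ?lexx ?orbT// (phi0 c) ?lexx// !mulr0 subrr.
Unshelve. all: by end_near. Qed.

(* Lebesgue differentiation of the (vanishing) primitive. *)
Lemma integral_itv_eq0_ae a b u : locally_integrable `]a, b[ u ->
  (forall c d, a < c -> c <= d -> d < b -> \int[mu]_(x in `[c, d]) u x = 0) ->
  {ae mu, forall x, a < x < b -> u x = 0}.
Proof.
move=> lu u0; have [ba|ab] := leP b a.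
  by apply: aeW => x /andP[ax xb]; have := lt_trans ax xb; rewrite ltNge ba.
(* Exhaustion of the open interval by the [c n, d n]; denominators from 3 on keep c n < d n. *)
pose c (n : nat) := a + (b - a) / n.+3%:R; pose d (n : nat) := b - (b - a) / n.+3%:R.
have n3 n : (0:R) < (n.+3%:R)^-1 < (1:R) / 2.
  rewrite invr_gt0 ltr0n/= mul1r ltf_pV2 ?posrE ?ltr0n// ltr_nat//.
have cd n : [/\ a < c n, c n < d n & d n < b].
  have := n3 n; rewrite /c /d; set t := (n.+3%:R)^-1 => /andP[h1 h2].
  have ba0 : 0 < b - a by rewrite subr_gt0.
  have q1 := mulr_gt0 ba0 h1.
  have q2 : 0 < (b - a) * (1 / 2 - t) by rewrite mulr_gt0// subr_gt0.
  rewrite mulrBr in q2; split; lra.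
suff : {ae mu, forall x (n : nat), c n < x < d n -> u x = 0}.
  apply: (@filterS _ _ (ae_filter_ringOfSetsType mu)) => x H /andP[ax xb].
  have [n Hn] : exists n : nat, (b - a) / n.+3%:R < Num.min (x - a) (b - x).
    have m0 : 0 < Num.min (x - a) (b - x) by rewrite lt_min !subr_gt0 ax.
    exists (Num.trunc ((b - a) / Num.min (x - a) (b - x))).
    rewrite ltr_pdivrMr// mulrC -ltr_pdivrMr//.
    apply: lt_le_trans (Num.Theory.truncnS_gt _) _; rewrite ler_nat.
    exact: leqW (leqW (leqnn _)).
  by apply: (H n); move: Hn; rewrite lt_min /c /d; set t := (b - a) / _ => /andP[? ?]; apply/andP; split; lra.
apply: ae_foralln => n; have [ac cdn db] := cd n.
have ui := locally_integrable_itv lu ac db.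
pose w := u \_ `[c n, d n].
have wi y : mu.-integrable `[c n, y] (EFin \o w).
  rewrite -restrict_EFin; apply/integrable_restrict => //.
  by apply: (@integrableS _ _ _ mu `[c n, d n]%classic) ui => //; exact: measurableI.
have lw : locally_integrable setT w by apply: integrable_locally.
have := FTC1 wi lw; apply: (@filterS _ _ (ae_filter_ringOfSetsType mu)) => x /= H /andP[cx xd].
have [_ E] := H cx.
have : derive1 (fun y : R => \int[mu]_(t in `[c n, y]) w t) x = 0.
  apply: is_derive_derive1; apply: is_derive_near (is_derive_cst (0:R) x (1:R)).
  near=> y; have cy : c n < y by near: y; exact: lt_nbhsr.
  have yd : y < d n by near: y; exact: lt_nbhsl.
  rewrite -[LHS](u0 (c n) y ac (ltW cy) (lt_trans yd db)).
  apply: eq_Rintegral => t; rewrite inE/= in_itv/= => /andP[ct ty].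
  by rewrite /w patchT// inE/= in_itv/= ct (le_trans ty)// ltW.
rewrite E /w patchT// inE/= in_itv/=; by rewrite !ltW.
Unshelve. all: by end_near. Qed.

Lemma real_weak_derivative_unique a b u v w :
  (forall x, a < x < b -> {for x, continuous u}) ->
  real_weak_derivative a b u v -> real_weak_derivative a b u w ->
  {ae mu, forall x, a < x < b -> v x = w x}.
Proof.
move=> cu uv uw; have [_ lv _] := uv; have [_ lw _] := uw.
have : {ae mu, forall x, a < x < b -> v x - w x = 0}.
  apply: integral_itv_eq0_ae; first exact: locally_integrableB.
  move=> c d ac cd db; rewrite RintegralB//; do ?exact: (locally_integrable_itv _ ac db).
  by rewrite (real_weak_derivative_FTC cu uv)// (real_weak_derivative_FTC cu uw)// subrr.
by apply: (@filterS _ _ (ae_filter_ringOfSetsType mu)) => x H /H /eqP; rewrite subr_eq0 => /eqP.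
Qed.

End WeakDerivative2.

(** * Complex-valued functions and energies *)

Section ComplexFunctions.
Context {R : realType}.
Notation mu := (@lebesgue_measure R).
Notation normc := ComplexField.Normc.normc.
Implicit Types (f g : R -> R[i]) (a b c d x y p : R) (z w : R[i]).

Lemma normc_ge0 z : 0 <= normc z.
Proof. by case: z => x y; rewrite /= sqrtr_ge0. Qed.

Lemma normc_ge_absRe z : `|complex.Re z| <= normc z.
Proof.
case: z => x y /=; rewrite -sqrtr_sqr ler_wsqrtr// lerDl sqr_ge0//.
Qed.

Lemma normc_ge_absIm z : `|complex.Im z| <= normc z.
Proof.
by case: z => x y /=; rewrite -sqrtr_sqr ler_wsqrtr// lerDr sqr_ge0.
Qed.

Lemma normc_real x : normc x%:C = `|x|.
Proof. by rewrite /= expr0n addr0 sqrtr_sqr. Qed.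

Lemma normc_le_abs z : normc z <= `|complex.Re z| + `|complex.Im z|.
Proof.
case: z => x y /=; rewrite -[leRHS]ger0_norm ?addr_ge0// -sqrtr_sqr ler_wsqrtr//.
rewrite sqrrD !real_normK ?num_real// addrAC lerDl.
by rewrite mulrn_wge0// mulr_ge0.
Qed.

Lemma complex_ReB z w : complex.Re (z - w) = complex.Re z - complex.Re w.
Proof. by case: z w => ? ? []. Qed.

Lemma complex_ImB z w : complex.Im (z - w) = complex.Im z - complex.Im w.
Proof. by case: z w => ? ? []. Qed.

Lemma normcB_le z w : normc (z - w) <= normc z + normc w.
Proof. by rewrite (le_trans (le_normcD _ _))// normcN. Qed.

Lemma cabsE z : `|z| = (normc z)%:C.
Proof. by []. Qed.

Lemma cvg_complexP (T : Type) (G : set_system T) (FG : Filter G) (f : T -> R[i]) z :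
  ((f : T -> R[i]^o) @ G --> (z : R[i]^o)) <->
  ((fun t => complex.Re (f t)) @ G --> complex.Re z /\
   (fun t => complex.Im (f t)) @ G --> complex.Im z).
Proof.
split=> [fz|[fr fi]].
  split; apply/cvgrPdist_lt => e e0.
    have e0c : (0 : R[i]) < e%:C by rewrite ltcR.
    move/cvgrPdist_lt : fz => /(_ _ e0c); apply: filterS => t.
    rewrite cabsE ltcR; apply: le_lt_trans.
    by apply: le_trans (normc_ge_absRe _); rewrite complex_ReB.
  have e0c : (0 : R[i]) < e%:C by rewrite ltcR.
  move/cvgrPdist_lt : fz => /(_ _ e0c); apply: filterS => t.
  rewrite cabsE ltcR; apply: le_lt_trans.
  by apply: le_trans (normc_ge_absIm _); rewrite complex_ImB.
(* In the order of [R[i]] a positive number is real, so e is replaced by its real part. *)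
apply/cvgrPdist_lt => e; rewrite ltcE/= => /andP[/eqP ei er].
have -> : e = (complex.Re e)%:C by case: e ei {er} => ? ? /= ->.
have er2 : 0 < complex.Re e / 2 by rewrite divr_gt0.
move/cvgrPdist_lt : fr => /(_ _ er2) Hr; move/cvgrPdist_lt : fi => /(_ _ er2) Hi.
apply: filterS2 Hr Hi => t Hr Hi; rewrite cabsE ltcR.
rewrite (le_lt_trans (normc_le_abs _))// [ltRHS]splitr ltrD//.
  by rewrite complex_ReB.
by rewrite complex_ImB.
Qed.

Lemma ccontinuous_onP (D : set R) f : ccontinuous_on D f <->
  {within D, continuous (fun x => complex.Re (f x))} /\
  {within D, continuous (fun x => complex.Im (f x))}.
Proof.
split=> [cf|[cr ci] x].
  by split=> x; have /cvg_complexP[] := cf x.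
by apply/cvg_complexP; split; [exact: cr|exact: ci].
Qed.

Lemma is_weak_derivativeP a b f g : is_weak_derivative a b f g <->
  real_weak_derivative a b (fun x => complex.Re (f x)) (fun x => complex.Re (g x)) /\
  real_weak_derivative a b (fun x => complex.Im (f x)) (fun x => complex.Im (g x)).
Proof.
have eRe (u : R -> R[i]) (v : R -> R) x : complex.Re (u x * (v x)%:C) = complex.Re (u x) * v x.
  by case: (u x) => r i /=; rewrite mulr0 subr0.
have eIm (u : R -> R[i]) (v : R -> R) x : complex.Im (u x * (v x)%:C) = complex.Im (u x) * v x.
  by case: (u x) => r i /=; rewrite mulr0 add0r.
have E (u : R -> R[i]) (v : R -> R) : cint `]a, b[ (fun x => u x * (v x)%:C) =
    (\int[mu]_(x in `]a, b[) (complex.Re (u x) * v x)) +i*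
    (\int[mu]_(x in `]a, b[) (complex.Im (u x) * v x)).
  by rewrite /cint; congr (_ +i* _); apply: eq_Rintegral => x _; rewrite ?eRe ?eIm.
split=> [[[lr li] [lgr lgi] H]|[[lr lgr Hr] [li lgi Hi]]].
  by split; split => // phi /H; rewrite !E => -[].
split; [by split|by split|] => phi tphi; rewrite !E Hr// Hi//.
Qed.

(** The p-th power of the Lp norm: additive in [D], monotone, and free of roots. *)
Definition energy (D : set R) p f : \bar R :=
  (\int[mu]_(x in D) ((normc (f x)) `^ p)%:E)%E.

Lemma energy_ge0 D p f : (0 <= energy D p f)%E.
Proof. by apply: integral_ge0 => x _; rewrite lee_fin powR_ge0. Qed.

Lemma cLnormE D p f : 0 < p -> cLnorm D p%:E f = (energy D p f `^ p^-1)%E.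
Proof.
move=> p0; rewrite /cLnorm unlock /energy [in RHS]integral_mkcond; congr (_ `^ _)%E.
apply: eq_integral => x _; rewrite /patch; case: ifP => _.
  by rewrite gee0_abs ?lee_fin ?normc_ge0// poweR_EFin.
by rewrite abse0 poweR_EFin powR0// gt_eqF.
Qed.

Lemma measurable_normc (D : set R) f : measurable D ->
  measurable_fun D (fun x => complex.Re (f x)) ->
  measurable_fun D (fun x => complex.Im (f x)) ->
  measurable_fun D (fun x => normc (f x)).
Proof.
move=> mD mr mi.
have -> : (fun x => normc (f x)) =
    (fun x => Num.sqrt (complex.Re (f x) ^+ 2 + complex.Im (f x) ^+ 2)).
  by apply/funext => x; case: (f x).
apply: measurableT_comp; first exact: continuous_measurable_fun (@sqrt_continuous R).
by apply: measurable_funD; apply: measurable_funX.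
Qed.

Lemma measurable_normc_powR (D : set R) p f : measurable D ->
  measurable_fun D (fun x => complex.Re (f x)) ->
  measurable_fun D (fun x => complex.Im (f x)) ->
  measurable_fun D (fun x => (normc (f x)) `^ p).
Proof.
move=> mD mr mi; apply: (measurableT_comp (measurable_powR p)).
exact: measurable_normc.
Qed.

Lemma cLnorm_le D p f (K : R) : 0 < p -> 0 <= K ->
  (energy D p f <= (K `^ p)%:E)%E -> (cLnorm D p%:E f <= K%:E)%E.
Proof.
move=> p0 K0 H; rewrite cLnormE//.
have -> : K%:E = ((K `^ p)%:E `^ p^-1)%E.
  by rewrite poweR_EFin -powRrM mulfV ?gt_eqF// powRr1.
by apply: gt0_ler_poweR => //; rewrite ?invr_ge0 ?ltW// in_itv/= leey ?energy_ge0// lee_fin powR_ge0.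
Qed.

Lemma cLnorm_lt D p f (K : R) : 0 < p -> 0 <= K ->
  (cLnorm D p%:E f < K%:E)%E -> (energy D p f <= (K `^ p)%:E)%E.
Proof.
move=> p0 K0; rewrite cLnormE// => H.
have -> : energy D p f = ((energy D p f `^ p^-1) `^ p)%E.
  by rewrite -poweRrM mulVf ?gt_eqF// poweRe1// energy_ge0.
rewrite -poweR_EFin; apply: gt0_ler_poweR; rewrite ?ltW//.
  by rewrite in_itv/= leey poweR_ge0.
by rewrite in_itv/= leey lee_fin K0.
Qed.

(** For y > e, y = y^(1 - p) y^p <= e^(1 - p) y^p because 1 - p <= 0. Integrated with a well chosen
    e, this does the work of Hoelder's inequality for every p >= 1. *)
Lemma le_powR_linear p (e y : R) : 1 <= p -> 0 < e -> 0 <= y ->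
  y <= e + e `^ (1 - p) * y `^ p.
Proof.
move=> p1 e0 y0; have [ye|ey] := leP y e.
  by rewrite (le_trans ye)// lerDl mulr_ge0 ?powR_ge0.
have y0' := lt_trans e0 ey.
apply: (@le_trans _ _ (e `^ (1 - p) * y `^ p)); last by rewrite lerDr ltW.
rewrite -[leLHS](@powRr1 _ y)// -[X in y `^ X <= _](subrK p 1).
rewrite powRD; last by rewrite (gt_eqF y0') implybT.
rewrite ler_wpM2r ?powR_ge0//.
rewrite -(opprB p 1) !powRN lef_pV2 ?posrE ?powR_gt0//.
by apply: ge0_ler_powR; rewrite ?nnegrE ?subr_ge0// ltW.
Qed.

End ComplexFunctions.

(** * Energy estimates and increments *)

Section SobolevLemmas.
Context {R : realType}.
Notation mu := (@lebesgue_measure R).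
Notation normc := ComplexField.Normc.normc.
Notation cRe := (complex.Re).
Notation cIm := (complex.Im).
Implicit Types (f g : R -> R[i]) (u v w : R -> R) (c d x y : R) (z : R[i]).

Definition cmeasurable (D : set R) f :=
  measurable_fun D (fun x => cRe (f x)) /\ measurable_fun D (fun x => cIm (f x)).

Lemma cmeasurableS (A B : set R) f : measurable B -> A `<=` B ->
  cmeasurable B f -> cmeasurable A f.
Proof. by move=> mB AB [mr mi]; split; [apply: measurable_funS mr|apply: measurable_funS mi]. Qed.

Lemma cmeasurableB (A : set R) f g : measurable A ->
  cmeasurable A f -> cmeasurable A g -> cmeasurable A (fun x => f x - g x).
Proof.
move=> mA [fr fi] [gr gi]; split.
  have -> : (fun x => cRe (f x - g x)) = (fun x => cRe (f x) - cRe (g x)).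
    by apply/funext => x; rewrite complex_ReB.
  exact: measurable_funB.
have -> : (fun x => cIm (f x - g x)) = (fun x => cIm (f x) - cIm (g x)).
  by apply/funext => x; rewrite complex_ImB.
exact: measurable_funB.
Qed.

Lemma measurable_energy (p : R) (D : set R) f : measurable D -> cmeasurable D f ->
  measurable_fun D (fun x => ((normc (f x)) `^ p)%:E).
Proof. by move=> mD [mr mi]; apply/measurable_EFinP; exact: measurable_normc_powR. Qed.

Lemma energyS (p : R) (A B : set R) f : measurable A -> measurable B -> A `<=` B ->
  cmeasurable B f -> (energy A p f <= energy B p f)%E.
Proof.
move=> mA mB AB mf; apply: ge0_subset_integral => //; first exact: measurable_energy.
by move=> x _; rewrite lee_fin powR_ge0.
Qed.

Lemma energy_le_bound (p : R) (D : set R) f (B : R) : measurable D -> 0 <= p ->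
  cmeasurable D f -> 0 <= B -> (forall x, D x -> normc (f x) <= B) ->
  (energy D p f <= (B `^ p)%:E * mu D)%E.
Proof.
move=> mD p0 mf B0 fB; rewrite /energy -integral_cst//.
apply: ge0_le_integral => //.
- by move=> x _; rewrite lee_fin powR_ge0.
- exact: measurable_energy.
- move=> x Dx; rewrite lee_fin; apply: ge0_ler_powR => //; rewrite ?nnegrE ?normc_ge0//.
  exact: fB.
Qed.

(** From |f - g| <= 2 max(|f|, |g|), the p-th power of a maximum being at most the sum of the p-th
    powers. *)
Lemma energyB_le (p : R) (D : set R) f g : 0 <= p -> measurable D ->
  cmeasurable D f -> cmeasurable D g ->
  (energy D p (fun x => (f x - g x)%R) <= (2 `^ p)%:E * (energy D p f + energy D p g))%E.
Proof.
move=> p0 mD mf mg; have mfg := cmeasurableB mD mf mg.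
rewrite /energy -ge0_integralD//; [|by move=> x _; rewrite lee_fin powR_ge0|
  exact: measurable_energy|by move=> x _; rewrite lee_fin powR_ge0|exact: measurable_energy].
rewrite -ge0_integralZl//; last 2 first.
- by apply: emeasurable_funD; exact: measurable_energy.
- by move=> x _; rewrite -EFinD lee_fin addr_ge0 ?powR_ge0.
apply: ge0_le_integral => //.
- by move=> x _; rewrite lee_fin powR_ge0.
- exact: measurable_energy.
- apply: measurable_funeM; apply: emeasurable_funD; exact: measurable_energy.
move=> x _; rewrite -EFinD -EFinM lee_fin.
set y := normc (f x); set z := normc (g x).
have y0 : 0 <= y by exact: normc_ge0.
have z0 : 0 <= z by exact: normc_ge0.
apply: (@le_trans _ _ ((2 * Num.max y z) `^ p)).
  apply: ge0_ler_powR => //; rewrite ?nnegrE ?normc_ge0 ?mulr_ge0 ?le_max ?y0//.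
  rewrite (le_trans (normcB_le _ _))// -/y -/z; case: (leP y z) => H; lra.
rewrite powRM ?le_max ?y0// ler_wpM2l ?powR_ge0//.
by case: (leP y z) => H; rewrite ?lerDl ?lerDr powR_ge0.
Qed.

Lemma cLnorm_lty (p : R) (D : set R) f : 0 < p -> (cLnorm D p%:E f < +oo)%E ->
  (energy D p f < +oo)%E.
Proof.
move=> p0; rewrite cLnormE// => H; rewrite ltey; apply/eqP => E; move: H.
by rewrite E poweRE invr_eq0 gt_eqF//= eqxx ltxx.
Qed.

Lemma cLnorm_fin (p : R) (D : set R) f : 0 < p -> (energy D p f < +oo)%E ->
  (cLnorm D p%:E f < +oo)%E.
Proof.
move=> p0 H; rewrite cLnormE//.
by rewrite -(@fineK _ (energy D p f)) ?ge0_fin_numE ?energy_ge0// poweR_EFin ltry.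
Qed.

Lemma energy_ae_eq (p : R) (D : set R) f g : measurable D ->
  cmeasurable D f -> cmeasurable D g -> {ae mu, forall x, D x -> f x = g x} ->
  energy D p f = energy D p g.
Proof.
move=> mD mf mg fg; apply: ge0_ae_eq_integral => //.
- exact: measurable_energy.
- exact: measurable_energy.
- by move=> x _; rewrite lee_fin powR_ge0.
- by move=> x _; rewrite lee_fin powR_ge0.
by apply: (@filterS _ _ (ae_filter_ringOfSetsType mu)) fg => x H /H ->.
Qed.

Lemma energy_integrable_normc (p : R) (D : set R) f : measurable D -> (mu D < +oo)%E ->
  1 <= p -> cmeasurable D f -> (energy D p f < +oo)%E ->
  mu.-integrable D (EFin \o (fun x => normc (f x))).
Proof.
move=> mD Doo p1 mf fp.
have i1 : mu.-integrable D (EFin \o (fun x => (normc (f x)) `^ p)).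
  apply/integrableP; split; first exact: measurable_energy.
  rewrite [ltLHS](_ : _ = energy D p f)//.
  by apply: eq_integral => x _; rewrite /= ger0_norm ?powR_ge0.
have i2 : mu.-integrable D (EFin \o (fun x => 1 + (normc (f x)) `^ p)).
  by apply: integrable_fD => //; exact: integrable_cst.
apply: integrable_le i2 => //; first by case: mf; exact: measurable_normc.
move=> x _; rewrite ger0_norm ?normc_ge0//.
have := @le_powR_linear _ p 1 (normc (f x)) p1 ltr01 (normc_ge0 _).
by rewrite powR1 mul1r.
Qed.

Lemma normc_integrable (D : set R) f : measurable D -> cmeasurable D f ->
  mu.-integrable D (EFin \o (fun x => normc (f x))) ->
  mu.-integrable D (EFin \o (fun x => cRe (f x))) /\
  mu.-integrable D (EFin \o (fun x => cIm (f x))).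
Proof.
move=> mD [mr mi] H; split; apply: integrable_le H => // x _.
  exact: normc_ge_absRe.
exact: normc_ge_absIm.
Qed.

(* Replaces Hoelder's inequality. *)
Lemma Rintegral_energy_bound (p : R) c d v f (E e : R) : 1 <= p -> c <= d ->
  cmeasurable `[c, d] f -> mu.-integrable `[c, d] (EFin \o v) ->
  (forall x, c <= x <= d -> `|v x| <= normc (f x)) ->
  (energy `[c, d] p f <= E%:E)%E -> 0 < e ->
  `|\int[mu]_(x in `[c, d]) v x| <= e * (d - c) + e `^ (1 - p) * E.
Proof.
move=> p1 cd mf vi vf fE e0.
have fp : (energy `[c, d] p f < +oo)%E by rewrite (le_lt_trans fE)// ltry.
have i1 : mu.-integrable `[c, d] (EFin \o (fun x => (normc (f x)) `^ p)).
  apply/integrableP; split; first exact: measurable_energy.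
  rewrite [ltLHS](_ : _ = energy `[c, d] p f)//.
  by apply: eq_integral => x _; rewrite /= ger0_norm ?powR_ge0.
have ic : mu.-integrable `[c, d] (EFin \o cst e).
  by apply: integrable_cst => //; exact: lebesgue_measure_itv_lty.
have i2 : mu.-integrable `[c, d] (EFin \o (fun x => e `^ (1 - p) * (normc (f x)) `^ p)).
  exact: integrable_fZ.
rewrite (le_trans (le_normr_Rintegral _ vi))//.
apply: (@le_trans _ _ (\int[mu]_(x in `[c, d]) (e + e `^ (1 - p) * (normc (f x)) `^ p))).
  apply: le_Rintegral => //; first exact: integrable_norm.
    exact: integrable_fD.
  move=> x; rewrite /= in_itv/= => xcd; rewrite (le_trans (vf _ xcd))//.
  by apply: le_powR_linear => //; exact: normc_ge0.
rewrite RintegralD// Rintegral_cst// RintegralZl// lerD//.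
  rewrite ler_wpM2l ?(ltW e0)//; apply: (@le_trans _ _ (fine (mu `[c, d]%classic))) => //.
  rewrite lebesgue_measure_itv/= lte_fin -EFinD.
  by case: ltgtP cd => //= ->; rewrite subrr.
rewrite ler_wpM2l ?powR_ge0// /Rintegral.
by rewrite -lee_fin fineK// ge0_fin_numE ?energy_ge0.
Qed.

(** The factor 2 comes from treating real and imaginary parts separately. For e = (E / (d -
    c))^(1/p) both summands equal the Hoelder bound (d - c)^(1 - 1/p) E^(1/p). *)
Lemma weak_derivative_increment (p : R) (a b : R) f g c d (E e : R) : 1 <= p ->
  (forall x, a < x < b -> {for x, continuous (f : R -> R[i]^o)}) ->
  is_weak_derivative a b f g -> a < c -> c <= d -> d < b ->
  cmeasurable `[c, d] g -> (energy `[c, d] p g <= E%:E)%E -> 0 < e ->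
  normc (f d - f c) <= 2 * (e * (d - c) + e `^ (1 - p) * E).
Proof.
move=> p1 cf /is_weak_derivativeP[wr wi] ac cd db mg gE e0.
have gi : mu.-integrable `[c, d] (EFin \o (fun x => normc (g x))).
  apply: energy_integrable_normc p1 mg _ => //.
    exact: lebesgue_measure_itv_lty.
  by rewrite (le_lt_trans gE)// ltry.
have [ri ii] := normc_integrable (measurable_itv _) mg gi.
rewrite (le_trans (normc_le_abs _))// mulr2n mulrDl mul1r complex_ReB complex_ImB.
have cfr x : a < x < b -> {for x, continuous (fun x => cRe (f x))}.
  by move=> /cf /cvg_complexP[].
have cfi x : a < x < b -> {for x, continuous (fun x => cIm (f x))}.
  by move=> /cf /cvg_complexP[].
rewrite -(real_weak_derivative_FTC cfr wr)// -(real_weak_derivative_FTC cfi wi)//.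
by apply: lerD; apply: (@Rintegral_energy_bound _ _ _ _ g) => // x _;
  [exact: normc_ge_absRe|exact: normc_ge_absIm].
Qed.

Lemma continuous_normc_near (f : R -> R[i]) x (e : R) :
  {for x, continuous (f : R -> R[i]^o)} -> 0 < e ->
  exists2 r : R, 0 < r & forall y, `|x - y| < r -> normc (f x - f y) < e.
Proof.
move=> cf e0; have e0c : (0 : R[i]) < e%:C by rewrite ltcR.
move/cvgrPdist_lt : cf => /(_ _ e0c) /nbhs_ballP[r/= r0 H]; exists r => // y xy.
by have := H y xy; rewrite cabsE ltcR.
Qed.

End SobolevLemmas.

(** * The Sobolev space *)

Section SobolevSpace.
Context {R : realType}.
Notation mu := (@lebesgue_measure R).
Notation normc := ComplexField.Normc.normc.
Notation cRe := (complex.Re).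
Notation cIm := (complex.Im).
Implicit Types (f g : R -> R[i]) (u v w : R -> R) (c d x y : R) (z : R[i]).

(** Splitting the integrals requires integrable products. They are obtained on an interval carrying
    the test function, where a locally integrable function meets a bounded factor. *)
Lemma real_weak_derivativeB a b u v u' v' : a < b ->
  real_weak_derivative a b u v -> real_weak_derivative a b u' v' ->
  real_weak_derivative a b (fun x => u x - u' x) (fun x => v x - v' x).
Proof.
move=> ab [lu lv H] [lu' lv' H']; split; [exact: locally_integrableB|exact: locally_integrableB|].
move=> phi tphi; have [c [d [ac cd db phi0]]] := test_function_support ab tphi.
have [/differentiable_nP dphi _] := tphi.
have dphiE x : is_derive x (1:R) phi (derive1 phi x) := differentiable_nSP (dphi 1%N) x.
have d2 : differentiable_n 1 (derive1 phi) by case: (dphi 2%N).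
have cphi x : {for x, continuous phi} := is_derive_continuous (dphiE x).
have cdphi x : {for x, continuous (derive1 phi)}.
  have dx := differentiable_nSP d2 x; exact: (is_derive_continuous dx).
have dphi0 x : (x < c) || (d < x) -> derive1 phi x = 0.
  move=> Hx; apply: is_derive_derive1.
  apply: is_derive_near (is_derive_cst (0:R) x (1:R)); case/orP : Hx => Hx; near=> y.
    by rewrite phi0// ltW//; near: y; exact: lt_nbhsl.
  by rewrite phi0// [d <= y]ltW ?orbT//; near: y; exact: lt_nbhsr.
have cdab : `[c, d]%classic `<=` `]a, b[%classic.
  by apply: subset_itv; rewrite bnd_simp.
have redu (k : R -> R) : (forall x, (x < c) || (d < x) -> k x = 0) ->
    \int[mu]_(x in `]a, b[) k x = \int[mu]_(x in `[c, d]) k x.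
  move=> k0; rewrite (Rintegral_support cdab)// => x _ /negP.
  by rewrite /= in_itv/= negb_and -!ltNge; exact: k0.
have phi0' x : (x < c) || (d < x) -> phi x = 0.
  by move=> Hx; apply: phi0; case/orP : Hx => /ltW ->; rewrite ?orbT.
have bnd (k : R -> R) : continuous k -> exists K, forall x, `[c, d]%classic x -> `|k x| <= K.
  move=> ck; have : {within `[c, d], continuous (fun x => `|k x|)}.
    by apply: within_continuous_itv => x _; apply: cvg_norm; exact: ck.
  move=> /(EVT_max cd)[t _ H0]; exists `|k t| => x xcd; exact: H0.
have ig (k q : R -> R) : locally_integrable `]a, b[ k -> continuous q ->
    mu.-integrable `[c, d] (EFin \o (fun x => k x * q x)).
  move=> lk cq; have [K HK] := bnd _ cq.
  apply: (integrable_fM_bounded _ _ _ HK) => //; first exact: locally_integrable_itv lk ac db.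
  by apply: measurable_funTS; exact: continuous_measurable_fun.
have := H _ tphi; have := H' _ tphi.
rewrite !redu; do ?by move=> x Hx; rewrite ?dphi0 ?phi0' ?mulr0.
move=> E' E; under eq_Rintegral do rewrite mulrBl.
rewrite RintegralB//; [|exact: ig|exact: ig].
rewrite E E'; under [X in _ = - X]eq_Rintegral do rewrite mulrBl.
rewrite RintegralB//; [|exact: ig|exact: ig].
by rewrite opprB addrC opprK.
Unshelve. all: by end_near. Qed.

Lemma is_weak_derivativeB a b f g f' g' : a < b ->
  is_weak_derivative a b f g -> is_weak_derivative a b f' g' ->
  is_weak_derivative a b (fun x => f x - f' x) (fun x => g x - g' x).
Proof.
move=> ab /is_weak_derivativeP[wr wi] /is_weak_derivativeP[wr' wi'].
apply/is_weak_derivativeP; split.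
  have := real_weak_derivativeB ab wr wr'.
  by congr real_weak_derivative; apply/funext => x; rewrite complex_ReB.
have := real_weak_derivativeB ab wi wi'.
by congr real_weak_derivative; apply/funext => x; rewrite complex_ImB.
Qed.

Section Fixed.
Variables (a b p : R).
Hypotheses (ab : a < b) (p1 : 1 <= p).

Let p0 : 0 < p. Proof. exact: lt_le_trans p1. Qed.

Lemma ccontinuous_clamp f : ccontinuous_on `[a, b] f ->
  forall x, {for x, continuous ((f : R -> R[i]^o) \o clamp a b)}.
Proof. by move=> cf x; apply: continuous_clamp => //; exact: ltW. Qed.

Lemma ccontinuous_on_interior f : ccontinuous_on `[a, b] f ->
  forall x, a < x < b -> {for x, continuous (f : R -> R[i]^o)}.
Proof.
move=> cf x xab; have H := @ccontinuous_clamp f cf x.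
have fx : f x = (f \o clamp a b) x.
  by move: xab => /andP[ax xb]; rewrite /= clamp_id// !ltW.
rewrite /prop_for/continuous_at fx; apply: cvg_trans H; apply: near_eq_cvg; near=> y.
rewrite /= clamp_id//; apply/andP; split; apply: ltW.
  by near: y; apply: lt_nbhsr; case/andP : xab.
by near: y; apply: lt_nbhsl; case/andP : xab.
Unshelve. all: by end_near. Qed.

(** The Sobolev embedding: as f vanishes at a, its values are increments, and the increment bound
    with e = K and E = K^p gives 2 (d - c + 1) K. *)
Lemma sobolev_sup_bound f g (K : R) : ccontinuous_on `[a, b] f -> f a = 0 ->
  is_weak_derivative a b f g -> cmeasurable `[a, b] g -> 0 < K ->
  (energy `[a, b] p g <= (K `^ p)%:E)%E ->
  forall x, a <= x <= b -> normc (f x) <= 2 * (b - a + 1) * K.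
Proof.
move=> cf fa fg mg K0 gK.
have KE : K `^ (1 - p) * K `^ p = K.
  by rewrite -powRD ?subrK ?powRr1 ?ltW// (gt_eqF K0) implybT.
have inc c d : a < c -> c <= d -> d < b -> normc (f d - f c) <= 2 * (b - a + 1) * K.
  move=> ac cd db.
  have cdab : `[c, d]%classic `<=` `[a, b]%classic.
    by apply: subset_itv; rewrite bnd_simp ltW.
  have := @weak_derivative_increment R p a b f g c d (K `^ p) K p1
    (ccontinuous_on_interior cf) fg ac cd db (cmeasurableS (measurable_itv _) cdab mg)
    (le_trans (energyS _ _ _ cdab mg) gK) K0.
  rewrite KE => /(_ (measurable_itv _) (measurable_itv _)) /le_trans; apply.
  rewrite -mulrA ler_pM2l// mulrDl mul1r lerD2r mulrC ler_pM2r//; lra.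
move=> x /andP[ax xb]; move: ax; rewrite le_eqVlt => /predU1P[<-|ax].
  rewrite fa ComplexField.Normc.normc0 !mulr_ge0 ?(ltW K0)//.
  by rewrite addr_ge0// subr_ge0 ltW.
apply/ler_addgt0Pl => e e0; have e20 : 0 < e / 2 by rewrite divr_gt0.
have [r r0 Hr] := continuous_normc_near (@ccontinuous_clamp f cf a) e20.
have [s s0 Hs] := continuous_normc_near (@ccontinuous_clamp f cf x) e20.
(* The increment bound concerns interior points, while x may be b: d approaches x from the left and
   c approaches a from the right, at the price of e / 2 each. *)
pose d := x - Num.min s (x - a) / 2.
have sx : 0 < Num.min s (x - a) by rewrite lt_min s0 subr_gt0.
have [sl sr] : Num.min s (x - a) <= s /\ Num.min s (x - a) <= x - a.
  by split; rewrite ge_min lexx ?orbT.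
have [ad dx xds] : [/\ a < d, d < x & x - d < s] by rewrite /d; split; lra.
pose c := a + Num.min r (d - a) / 2.
have rd : 0 < Num.min r (d - a) by rewrite lt_min r0 subr_gt0.
have [rl rr] : Num.min r (d - a) <= r /\ Num.min r (d - a) <= d - a.
  by split; rewrite ge_min lexx ?orbT.
have [ac cd car] : [/\ a < c, c < d & c - a < r] by rewrite /c; split; lra.
have h1 : normc (f x - f d) < e / 2.
  have := Hs d; rewrite /= !clamp_id ?(ltW ax) ?(ltW ad)// ?xb//; last first.
    by rewrite (le_trans (ltW dx)).
  by apply; rewrite ger0_norm; lra.
have h2 : normc (f c) < e / 2.
  have := Hr c; rewrite /= !clamp_id ?lexx ?(ltW ac) ?(ltW ab)//=; last first.
    by rewrite (le_trans (ltW cd))// (le_trans (ltW dx)).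
  rewrite fa sub0r normcN; apply.
  by rewrite ler0_norm; lra.
have h3 := inc c d ac (ltW cd) (lt_le_trans dx xb).
have -> : f x = (f x - f d) + ((f d - f c) + f c).
  by rewrite !subrK.
rewrite (le_trans (le_normcD _ _))//.
rewrite (le_trans (lerD (lexx _) (le_normcD _ _)))//; lra.
Qed.

Lemma weak_derivP f g : is_weak_derivative a b f g ->
  is_weak_derivative a b f (weak_deriv a b f).
Proof.
by move=> fg; have := @xgetPex _ (0 : R -> R[i]) [set g | is_weak_derivative a b f g];
  apply; exists g.
Qed.

Lemma weak_derivative_measurable f g : is_weak_derivative a b f g -> cmeasurable `[a, b] g.
Proof.
move=> /is_weak_derivativeP[[_ [mr _ _] _] [_ [mi _ _] _]].
by split; [exact: measurable_fun_itv_cc mr|exact: measurable_fun_itv_cc mi].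
Qed.

Lemma ae_neq c : {ae mu, forall x, x != c}.
Proof.
exists [set c]; split => //; first exact: lebesgue_measure_set1.
by move=> x /=; move=> /negP; rewrite negbK => /eqP.
Qed.

(** The choice made in [weak_deriv] changes g on a null set only; the two end points, on which
    uniqueness in the open interval is silent, form another null set. *)
Lemma weak_deriv_energy f g : ccontinuous_on `[a, b] f -> is_weak_derivative a b f g ->
  energy `[a, b] p (weak_deriv a b f) = energy `[a, b] p g.
Proof.
move=> cf fg; have fw := weak_derivP fg.
apply: energy_ae_eq => //; [exact: weak_derivative_measurable fw|exact: weak_derivative_measurable fg|].
move: fg fw => /is_weak_derivativeP[gr gi] /is_weak_derivativeP[wr wi].
have cfr x : a < x < b -> {for x, continuous (fun x => cRe (f x))}.
  by move=> /(ccontinuous_on_interior cf) /cvg_complexP[].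
have cfi x : a < x < b -> {for x, continuous (fun x => cIm (f x))}.
  by move=> /(ccontinuous_on_interior cf) /cvg_complexP[].
have Hr := real_weak_derivative_unique cfr wr gr.
have Hi := real_weak_derivative_unique cfi wi gi.
have Ha := ae_neq a; have Hb := ae_neq b.
have := @filterI _ _ (ae_filter_ringOfSetsType mu) _ _
  (@filterI _ _ (ae_filter_ringOfSetsType mu) _ _ Hr Hi)
  (@filterI _ _ (ae_filter_ringOfSetsType mu) _ _ Ha Hb).
apply: (@filterS _ _ (ae_filter_ringOfSetsType mu)) => x [[/= hr hi] [xa xb]].
rewrite /= in_itv/= => /andP[ax xb']; have xab : a < x < b.
  by rewrite lt_neqAle eq_sym xa ax/= lt_neqAle xb.
by apply/eqP; rewrite eq_complex hr// hi// !eqxx.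
Qed.

(** The first summand is the Lp norm over [a, b] of the constant 2 (b - a + 1) of
    [sobolev_sup_bound]; the 1 accounts for the derivative. *)
Definition sobolev_const : R := 2 * (b - a + 1) * (b - a) `^ p^-1 + 1.

Lemma sobolev_const_gt0 : 0 < sobolev_const.
Proof. by rewrite ltr_wpDl// !mulr_ge0 ?powR_ge0// addr_ge0// subr_ge0 ltW. Qed.

Lemma sobolev_norm_le f g (K : R) : ccontinuous_on `[a, b] f -> f a = 0 ->
  is_weak_derivative a b f g -> 0 < K ->
  (energy `[a, b] p g <= (K `^ p)%:E)%E ->
  (sobolev_norm a b p%:E f <= (sobolev_const * K)%:E)%E.
Proof.
move=> cf fa fg K0 gK; have mg := weak_derivative_measurable fg.
have fK := sobolev_sup_bound cf fa fg mg K0 gK.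
rewrite /sobolev_norm /sobolev_const mulrDl mul1r EFinD; apply: leeD; last first.
  have wK : (energy `[a, b] p (weak_deriv a b f) <= (K `^ p)%:E)%E.
    by rewrite (weak_deriv_energy cf fg).
  exact: cLnorm_le p0 (ltW K0) wK.
have ba0 : 0 <= b - a by rewrite subr_ge0 ltW.
have B0 : 0 <= 2 * (b - a + 1) * K by rewrite !mulr_ge0 ?(ltW K0)// addr_ge0.
apply: cLnorm_le => //; first by rewrite !mulr_ge0 ?powR_ge0 ?(ltW K0)// addr_ge0.
have mf : cmeasurable `[a, b] f.
  have /ccontinuous_onP[cr ci] := cf.
  by split; apply: subspace_continuous_measurable_fun.
have fb x : `[a, b]%classic x -> normc (f x) <= 2 * (b - a + 1) * K.
  by rewrite /= in_itv/=; exact: fK.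
apply: le_trans (energy_le_bound (measurable_itv _) (ltW p0) mf B0 fb) _.
rewrite lebesgue_measure_itv/= lte_fin ab -EFinD -EFinM lee_fin.
have -> : 2 * (b - a + 1) * (b - a) `^ p^-1 * K = 2 * (b - a + 1) * K * (b - a) `^ p^-1.
  by rewrite mulrAC.
by rewrite [leRHS]powRM ?powR_ge0// -powRrM mulVf ?gt_eqF// powRr1.
Qed.

Lemma sobolev_norm_energy f g (e : R) : ccontinuous_on `[a, b] f ->
  is_weak_derivative a b f g -> 0 <= e ->
  (sobolev_norm a b p%:E f < e%:E)%E ->
  (energy `[a, b] p g <= (e `^ p)%:E)%E /\ (energy `[a, b] p f <= (e `^ p)%:E)%E.
Proof.
move=> cf fg e0 H; split.
  rewrite -(weak_deriv_energy cf fg); apply: cLnorm_lt => //.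
  by apply: le_lt_trans H; rewrite leeDr// cLnormE// poweR_ge0.
apply: cLnorm_lt => //.
by apply: le_lt_trans H; rewrite leeDl// cLnormE// poweR_ge0.
Qed.

Lemma sobolev_eval f g (e : R) : ccontinuous_on `[a, b] f -> f a = 0 ->
  is_weak_derivative a b f g -> 0 < e ->
  (sobolev_norm a b p%:E f < e%:E)%E ->
  forall x, a <= x <= b -> normc (f x) <= 2 * (b - a + 1) * e.
Proof.
move=> cf fa fg e0 /(sobolev_norm_energy cf fg (ltW e0))[gE _].
exact: sobolev_sup_bound cf fa fg (weak_derivative_measurable fg) e0 gE.
Qed.

Lemma sobolev_star_weak f : sobolev_star a b p%:E f ->
  [/\ ccontinuous_on `[a, b] f, f a = 0, forall x, ~~ (a <= x <= b) -> f x = 0 &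
   exists2 g, is_weak_derivative a b f g & (energy `[a, b] p g < +oo)%E].
Proof.
move=> [[cf _ [g fg [_ _ gp]]] fa f0]; split => //.
  by move=> x xab; apply: f0; rewrite /= in_itv/=; exact/negP.
by exists g => //; exact: cLnorm_lty gp.
Qed.

Lemma C1_sobolev_star f g : ccontinuous_on `[a, b] f -> f a = 0 ->
  (forall x, ~~ (a <= x <= b) -> f x = 0) ->
  (forall x, a < x < b -> is_derive x (1:R) (fun y => cRe (f y)) (cRe (g x)) /\
                          is_derive x (1:R) (fun y => cIm (f y)) (cIm (g x))) ->
  (forall x, a < x < b -> {for x, continuous (g : R -> R[i]^o)}) ->
  (energy `[a, b] p g < +oo)%E ->
  is_weak_derivative a b f g /\ sobolev_star a b p%:E f.
Proof.
move=> cf fa f0 df cg gp.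
have fg : is_weak_derivative a b f g.
  apply/is_weak_derivativeP; split; apply: C1_real_weak_derivative => //.
  - by move=> x /df[].
  - by move=> x /cg /cvg_complexP[].
  - by move=> x /df[].
  - by move=> x /cg /cvg_complexP[].
have [mr mi] := weak_derivative_measurable fg.
have mf : cmeasurable `[a, b] f.
  have /ccontinuous_onP[cr ci] := cf.
  by split; apply: subspace_continuous_measurable_fun.
split => //; split => //; last first.
  by move=> x /=; rewrite in_itv/= => /negP; exact: f0.
split => //; last first.
  by exists g => //; split => //; exact: cLnorm_fin.
split; [by case: mf|by case: mf|].
(* K^p is the energy plus 1, which keeps K positive even if the energy is 0. *)
pose K := (fine (energy `[a, b] p g) + 1) `^ p^-1.
have e0 : 0 <= fine (energy `[a, b] p g) by rewrite fine_ge0// energy_ge0.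
have K0 : 0 < K by rewrite powR_gt0// ltr_wpDl.
have gK : (energy `[a, b] p g <= (K `^ p)%:E)%E.
  rewrite /K -powRrM mulVf ?gt_eqF// powRr1 ?addr_ge0//.
  by rewrite -(@fineK _ (energy _ _ _)) ?ge0_fin_numE ?energy_ge0// lee_fin lerDl.
have := @sobolev_norm_le f g K cf fa fg K0 gK.
move=> H; apply: (@le_lt_trans _ _ (sobolev_const * K)%:E); last by rewrite ltry.
by apply: le_trans H; rewrite leeDl// cLnormE// poweR_ge0.
Qed.

End Fixed.
End SobolevSpace.

(** * The flow and the weight *)

Section Flow.
Context {R : realType}.
Notation mu := (@lebesgue_measure R).
Notation normc := ComplexField.Normc.normc.

(* [S_ t f] is not known to be measurable, which rules out [ge0_le_integral]. *)
Lemma ge0_le_integral_nomeas (D : set R) (f g : R -> \bar R) :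
  (forall x, D x -> (0 <= f x)%E) -> (forall x, D x -> (f x <= g x)%E) ->
  (\int[mu]_(x in D) f x <= \int[mu]_(x in D) g x)%E.
Proof.
move=> f0 fg; rewrite ge0_integralE// ge0_integralE; last first.
  by move=> x Dx; rewrite (le_trans (f0 x Dx))// fg.
apply: le_ereal_sup => _ [k /= kf <-]; exists k => //= x.
apply: le_trans (kf x) _; rewrite /patch; case: ifPn => // /set_mem; exact: fg.
Qed.

Lemma ae_ball (P : R -> Prop) (x r : R) : 0 < r -> {ae mu, forall y, P y} ->
  exists2 y : R, `|x - y| < r & P y.
Proof.
move=> r0 aeP; apply: contrapT => H.
have nx : mu.-negligible (ball x r).
  by apply: negligibleS aeP => y xy /= Py; apply: H; exists y.
have : mu (ball x r) = 0%E by apply: measure_negligible nx; exact: measurable_ball.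
by move/eqP; rewrite lebesgue_measure_ball ?ltW// eqe mulrn_eq0/= gt_eqF.
Qed.

Variables (a b : R) (F : R -> R).
Hypotheses (ab : a < b) (FC1 : C1_on a b F).

Lemma C1_is_derive x : a < x < b -> is_derive x (1:R) F (derive1 F x).
Proof. by move=> xab; have [_ /(_ x xab) /derivableP + _] := FC1; rewrite derive1E. Qed.

Lemma C1_continuous x : a < x < b -> {for x, continuous F}.
Proof. by move=> /C1_is_derive /is_derive_continuous. Qed.

Lemma C1_derive_continuous x : a < x < b -> {for x, continuous (derive1 F)}.
Proof.
move=> xab; have [_ _ [G cG FG]] := FC1.
have H : {for x, continuous (G \o clamp a b)}.
  by apply: continuous_clamp => //; exact: ltW.
have E0 : derive1 F x = (G \o clamp a b) x.
  by rewrite /= clamp_id ?FG//; case/andP : xab => *; rewrite !ltW.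
rewrite /prop_for/continuous_at E0; apply: cvg_trans H; apply: near_eq_cvg; near=> y.
have yab : a < y < b.
  apply/andP; split.
    by near: y; apply: lt_nbhsr; case/andP : xab.
  by near: y; apply: lt_nbhsl; case/andP : xab.
by rewrite /= clamp_id ?FG//; case/andP : yab => *; rewrite !ltW.
Unshelve. all: by end_near. Qed.

Lemma C1_derive_bound : exists2 L : R, 0 < L & forall x, a < x < b -> `|derive1 F x| <= L.
Proof.
have [_ _ [G cG FG]] := FC1.
have : {within `[a, b], continuous (fun x => `|G x|)}.
  move=> x; apply: cvg_norm; exact: cG.
move=> /(EVT_max (ltW ab))[t _ H]; exists (`|G t| + 1); first by rewrite ltr_wpDl.
move=> x /[dup] /FG -> /andP[ax xb]; rewrite (le_trans (H x _)) ?lerDl//.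
by rewrite in_itv/= !ltW.
Qed.

Lemma C1_lipschitz L x y : 0 < L -> (forall x, a < x < b -> `|derive1 F x| <= L) ->
  a <= x <= b -> a <= y <= b -> `|F x - F y| <= L * `|x - y|.
Proof.
move=> L0 HL; wlog xy : x y / x <= y.
  move=> H xab yab; have [xy|/ltW yx] := leP x y; first exact: H.
  by rewrite distrC [`|x - y|]distrC; exact: H.
move=> /andP[ax xb] /andP[ay yb].
have [cF _ _] := FC1.
move: xy; rewrite le_eqVlt => /predU1P[->|xy]; first by rewrite !subrr normr0 mulr0.
have [||c /[!in_itv]/= /andP[xc cy] E] := @MVT R F (derive1 F) x y xy.
- move=> z /[!in_itv]/= /andP[xz zy]; apply: C1_is_derive.
  by rewrite (le_lt_trans ax)//= (lt_le_trans zy).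
- by apply: continuous_subspaceW cF; apply: subset_itv; rewrite bnd_simp.
rewrite distrC E normrM [`|x - y|]distrC ler_wpM2r// HL//.
by rewrite (le_lt_trans ax)//= (lt_le_trans cy).
Qed.

Section Orbit.
Hypothesis Finv : forward_invariant a b F.
Variable x : R.
Hypothesis xab : a < x < b.

Implicit Types (s t z L : R).
Let u (t : R) := flow a b F t x.

(** Forward invariance puts time 0 in [Jmax], which rules out the empty default interval of
    [xget]. *)
Lemma maximal_solution_is_solution :
  is_solution a b F x (Jmax a b F x) (maximal_solution a b F x).2.
Proof.
have J0 : Jmax a b F x 0 by apply: (Finv xab); rewrite /=.
move: J0; rewrite /Jmax /maximal_solution; case: xgetP => [Ju -> [+ _] _ //|_].
by [].
Qed.

Lemma flow0 : u 0 = x.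
Proof. by have [] := maximal_solution_is_solution. Qed.

Lemma flow_itv t : 0 <= t -> a < u t < b.
Proof.
move=> t0; have [_ _ _ _ H] := maximal_solution_is_solution.
by have [] := H t (Finv xab t0).
Qed.

Lemma flow_is_derive t : 0 <= t -> is_derive t (1:R) u (F (u t)).
Proof.
move=> t0; have [_ _ _ _ H] := maximal_solution_is_solution.
by have [] := H t (Finv xab t0).
Qed.

Lemma flow_continuous t : 0 <= t -> {for t, continuous u}.
Proof. by move=> /flow_is_derive; exact: is_derive_continuous. Qed.

Lemma flow_gronwall L z s t : 0 < L -> (forall x, a < x < b -> `|derive1 F x| <= L) ->
  a <= z <= b -> F z = 0 -> 0 <= s -> s <= t ->
  `|u t - z| <= expR (L * (t - s)) * `|u s - z| /\ `|u s - z| <= expR (L * (t - s)) * `|u t - z|.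
Proof.
move=> L0 HL zab Fz s0 st.
have Fu (r : R) : 0 <= r -> `|(u r - z) * F (u r)| <= L * (u r - z) ^+ 2.
  move=> r0; have /andP[h1 h2] := flow_itv r0.
  have uab : a <= u r <= b by rewrite !ltW.
  have := C1_lipschitz L0 HL uab zab; rewrite Fz subr0 => H.
  by rewrite normrM -(real_normK (num_real (_ - _))) expr2 mulrCA ler_wpM2l.
have key (sg : R) : (sg = 1 \/ sg = -1) ->
    0 <= sg * ((u t - z) ^+ 2 * expR (sg * 2 * L * t) - (u s - z) ^+ 2 * expR (sg * 2 * L * s)).
  move=> sg1.
  have sgg : sg * sg = 1 by case: sg1 => ->; rewrite ?mulr1// mulrNN mulr1.
  rewrite mulrBr subr_ge0.
  pose f r := sg * ((u r - z) ^+ 2 * expR (sg * 2 * L * r + 0)).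
  pose df r := sg * ((2%:R * (u r - z) ^+ 1 * (F (u r) - 0)) * expR (sg * 2 * L * r + 0) +
     (u r - z) ^+ 2 * (expR (sg * 2 * L * r + 0) * (sg * 2 * L))).
  have fdf (r : R) : 0 <= r -> is_derive r (1:R) f (df r).
    move=> r0; apply: is_derive_fZ; apply: is_derive_fM.
      exact: is_derive_fX (is_derive_fB (flow_is_derive r0) (is_derive_cst z r _)).
    exact: is_derive_fcomp (is_derive_expR _) (is_derive_affine _ _ _).
  have := @is_derive_ge0_le R f df s t st; rewrite /f !addr0; apply.
    by move=> r /andP[sr _]; apply: fdf; exact: le_trans sr.
  move=> r /andP[sr _]; have r0 := le_trans s0 sr; have := Fu r r0.
  rewrite ler_norml => /andP[H1 H2]; rewrite /df expr1 subr0.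
  have -> : sg * (2 * (u r - z) * F (u r) * expR (sg * 2 * L * r + 0) +
      (u r - z) ^+ 2 * (expR (sg * 2 * L * r + 0) * (sg * 2 * L))) =
      2 * expR (sg * 2 * L * r + 0) * (sg * ((u r - z) * F (u r)) + sg * sg * (L * (u r - z) ^+ 2)).
    ring.
  rewrite sgg mul1r mulr_ge0 ?mulr_ge0 ?expR_ge0//.
  by case: sg1 => ->; rewrite ?mul1r ?mulN1r; lra.
have sq (X Y E : R) : X ^+ 2 <= E ^+ 2 * Y ^+ 2 -> 0 <= E -> `|X| <= E * `|Y|.
  move=> XY E0; rewrite -(@ler_pXn2r _ 2) ?nnegrE ?mulr_ge0// exprMn !real_normK ?num_real//.
split; apply: sq; rewrite ?expR_ge0//.
  have := key (-1) (or_intror erefl); rewrite mulN1r opprB subr_ge0 => H.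
  rewrite -expRM_natl.
  have -> : (2%:R : R) * (L * (t - s)) = - 1 * 2 * L * s - (- 1 * 2 * L * t) by ring.
  by rewrite expRD expRN mulrAC ler_pdivlMr ?expR_gt0// [leRHS]mulrC.
have := key 1 (or_introl erefl); rewrite mul1r subr_ge0 => H.
rewrite -expRM_natl.
have -> : (2%:R : R) * (L * (t - s)) = 1 * 2 * L * t - (1 * 2 * L * s) by ring.
by rewrite expRD expRN mulrAC ler_pdivlMr ?expR_gt0// [leRHS]mulrC.
Qed.

(** A change of sign would make F vanish at some [u s3], an equilibrium. The Gronwall bound, read
    forwards or backwards in time, then forces [u s1] to be that equilibrium, although F is negative
    at [u s1]. *)
Lemma flow_sign t : 0 <= t ->
  (forall s : R, 0 <= s <= t -> 0 <= F (u s)) \/ (forall s : R, 0 <= s <= t -> F (u s) <= 0).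
Proof.
move=> t0; have [L L0 HL] := C1_derive_bound.
have [|/existsNP[s1 /not_implyP[/andP[s10 s1t] /negP]]] :=
  pselect (forall s : R, 0 <= s <= t -> 0 <= F (u s)); first by left.
rewrite -ltNge => F1; right => s2 /andP[s20 s2t]; rewrite leNgt; apply/negP => F2.
have cFu (s : R) : 0 <= s -> {for s, continuous (F \o u)}.
  move=> s0; apply: continuous_comp; first exact: flow_continuous.
  by apply: C1_continuous; exact: flow_itv.
have [s3 s30 Fs3] : exists2 s3 : R, 0 <= s3 & F (u s3) = 0.
  have m0 : 0 <= Num.min s1 s2 by rewrite le_min s10.
  have mm : Num.min s1 s2 <= Num.max s1 s2 by rewrite ge_min !le_max !lexx.
  have [||c] := @IVT R (F \o u) (Num.min s1 s2) (Num.max s1 s2) 0 mm.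
  - by apply: within_continuous_itv => r /andP[mr _]; apply: cFu; exact: le_trans mr.
  - rewrite /=; case: (leP s1 s2) => _; rewrite ge_min le_max.
      by rewrite (ltW F1) (ltW F2) !orbT.
    by rewrite (ltW F1) (ltW F2) !orbT.
  by rewrite in_itv/= => /andP[mc _] E; exists c => //; exact: le_trans mc.
have z3 : a <= u s3 <= b by have /andP[h1 h2] := flow_itv s30; rewrite !ltW.
have : u s1 = u s3.
  apply/eqP; rewrite -subr_eq0 -normr_le0.
  have [s13|/ltW s31] := leP s1 s3.
    have [_] := flow_gronwall L0 HL z3 Fs3 s10 s13.
    by rewrite subrr normr0 mulr0.
  have [+ _] := flow_gronwall L0 HL z3 Fs3 s30 s31.
  by rewrite subrr normr0 mulr0.
by move=> E; move: F1; rewrite E Fs3 ltxx.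
Qed.

End Orbit.
End Flow.

(** * Growth of the weight along orbits *)

Section Weight.
Context {R : realType}.
Notation mu := (@lebesgue_measure R).
Notation normc := ComplexField.Normc.normc.
Notation cRe := (complex.Re).
Notation cIm := (complex.Im).
Implicit Types (x y z s t L M A e : R).

Lemma normc_eq0 (z : R[i]) : normc z = 0 -> z = 0.
Proof. by move=> /ComplexField.Normc.eq0_normc. Qed.

Lemma normc_cexp (z : R[i]) : normc (cexp z) = expR (cRe z).
Proof.
rewrite /cexp ComplexField.Normc.normcM normc_real ger0_norm ?expR_ge0//.
by rewrite /= cos2Dsin2 sqrtr1 mulr1.
Qed.

Lemma ccontinuous_on_eq (D : set R) (f g : R -> R[i]) :
  (forall x, D x -> f x = g x) -> ccontinuous_on D f -> ccontinuous_on D g.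
Proof.
by move=> fg; apply: subspace_eq_continuous => x /set_mem; exact: fg.
Qed.

Variables (a b : R) (F : R -> R) (h : R -> R[i]).
Hypotheses (ab : a < b) (FC1 : C1_on a b F).

(** An explicit element of the space with prescribed slope: the target that orbits, or periodic
    points, are asked to approximate in the necessity proof. *)
Definition linear_function A x : R[i] := if a <= x <= b then (A * (x - a))%:C else 0.

Lemma linear_functionE A x : a <= x <= b -> linear_function A x = (A * (x - a))%:C.
Proof. by rewrite /linear_function => ->. Qed.

Lemma linear_function_sobolev_star p A : 1 <= p ->
  is_weak_derivative a b (linear_function A) (fun=> A%:C) /\
  sobolev_star a b p%:E (linear_function A).
Proof.
move=> p1; apply: C1_sobolev_star => //.
- apply: (@ccontinuous_on_eq _ (fun x => (A * (x - a))%:C)).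
    by move=> x; rewrite /= in_itv/= => /linear_functionE ->.
  apply/ccontinuous_onP; split; apply: continuous_subspaceT => x /=.
    by apply: cvgM; [exact: cvg_cst|apply: cvgB; [exact: cvg_id|exact: cvg_cst]].
  exact: cvg_cst.
- by rewrite linear_functionE ?lexx ?ltW//= subrr mulr0.
- by move=> x /negbTE; rewrite /linear_function => ->.
- move=> x /andP[ax xb].
  have E : \forall y \near x, (A * (y - a))%:C = linear_function A y.
    near=> y; rewrite linear_functionE//; apply/andP; split; apply: ltW.
      by near: y; exact: lt_nbhsr.
    by near: y; exact: lt_nbhsl.
  split=> /=.
    apply: (@is_derive_near _ (fun y => A * y + - (A * a))); last exact: is_derive_affine.
    by apply: filterS E => y <- /=; rewrite mulrBr.
  apply: is_derive_near (is_derive_cst (0:R) x (1:R)).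
  by apply: filterS E => y <- /=.
- by move=> x _; exact: cvg_cst.
- have mc : cmeasurable `[a, b] (fun=> A%:C) by split; exact: measurable_cst.
  have bc x : `[a, b]%classic x -> normc A%:C <= `|A| by rewrite normc_real.
  apply: le_lt_trans (energy_le_bound (measurable_itv _) (le_trans ler01 p1) mc _ bc) _ => //.
  by rewrite lte_mul_pinfty ?lee_fin ?powR_ge0//; exact: lebesgue_measure_itv_lty.
Unshelve. all: by end_near. Qed.

Hypothesis ch : ccontinuous_on `[a, b] h.
Hypothesis h_zeros : forall x, zeros a b F x -> h x = h a.
Hypothesis h_quot : inLp `[a, b] +oo%E
     (fun y => if F y == 0 then 0 else (h y - h a) / (F y)%:C).

Let c := cRe (h a).

(** [Lnorm] with exponent +oo is an essential supremum only when the whole space has positive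
    measure. *)
Lemma lebesgue_measure_setT_gt0 : (0 < mu [set: R])%E.
Proof.
apply: (@lt_le_trans _ _ (mu `[0%R, 1%R]%classic)).
  by rewrite lebesgue_measure_itv/= lte_fin ltr01 oppr0 adde0 lte_fin ltr01.
by apply: le_measure; rewrite ?inE.
Qed.

(** The bound on the quotient holds almost everywhere where F does not vanish. Continuity of h and F
    carries it to every interior point with F x != 0; at a zero of F both sides are 0 by
    [h_zeros]. *)
Lemma weight_bound : exists2 M : R, 0 <= M &
  forall x, a < x < b -> normc (h x - h a) <= M * `|F x|.
Proof.
have [_ _] := h_quot; rewrite /cLnorm unlock lebesgue_measure_setT_gt0.
set q := (X in abse \o X) => Hq.
have aeq := @ess_sup_ge _ _ _ mu (abse \o q).
set s := ess_sup _ _ in Hq aeq.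
pose M := Num.max 0 (fine s).
exists M; first by rewrite /M le_max lexx.
have aeM : {ae mu, forall x, a <= x <= b -> F x != 0 -> normc (h x - h a) <= M * `|F x|}.
  apply: (@filterS _ _ (ae_filter_ringOfSetsType mu)) aeq => x + xab Fx.
  rewrite /q /= patchT ?inE/= ?in_itv//= (negbTE Fx).
  rewrite ger0_norm ?normc_ge0// => Hs.
  have Hs' : normc ((h x - h a) / (F x)%:C) <= M.
    rewrite /M le_max; apply/orP; right.
    rewrite -lee_fin fineK// ge0_fin_numE// (le_trans _ Hs)// lee_fin normc_ge0//.
  move: Hs'; rewrite ComplexField.Normc.normcM ComplexField.Normc.normcV normc_real.
  by rewrite ler_pdivrMr// normr_gt0.
move=> x xab; have [Fx0|Fx] := eqVneq (F x) 0.
  rewrite h_zeros//.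
  by rewrite subrr ComplexField.Normc.normc0 Fx0 normr0 mulr0.
(* A failure at x, with gap g, would persist on a ball around x: h and M |F| move by at most g / 2
   each there. But the ball contains a point at which the bound holds. *)
rewrite leNgt; apply/negP => Hlt.
have chx := @ccontinuous_on_interior _ _ _ ab h ch x xab.
set g := normc (h x - h a) - M * `|F x|.
have g0 : 0 < g by rewrite subr_gt0.
have M0 : 0 <= M by rewrite /M le_max lexx.
have [r1 r10 H1] : exists2 r : R, 0 < r & forall y, `|x - y| < r -> normc (h x - h y) < g / 2.
  by apply: continuous_normc_near => //; rewrite divr_gt0.
have gM : 0 < Num.min (g / 2 / (M + 1)) `|F x|.
  by rewrite lt_min !divr_gt0 ?normr_gt0// ltr_wpDl.
have /cvgrPdist_lt /(_ _ gM) /nbhs_ballP[r2/= r20 H2] := C1_continuous FC1 xab.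
have /andP[ax xb] := xab.
pose r := Num.min (Num.min r1 r2) (Num.min (x - a) (b - x)).
have r0 : 0 < r by rewrite !lt_min r10 r20 !subr_gt0 ax.
have [y xyr Hy] := ae_ball x r0 aeM.
move: xyr; rewrite /r !lt_min => /andP[/andP[xy1 xy2] /andP[xy3 xy4]].
have yab : a <= y <= b.
  by move: xy3 xy4; rewrite !ltr_norml => /andP[? ?] /andP[? ?]; apply/andP; split; lra.
have := H2 y xy2; rewrite lt_min => /andP[h3 h4].
have Fy : F y != 0.
  by apply/eqP => Fy0; move: h4; rewrite Fy0 subr0 ltxx.
have := Hy yab Fy; apply/negP; rewrite -ltNge.
have h1 := H1 _ xy1.
have h5 : normc (h x - h a) <= normc (h x - h y) + normc (h y - h a).
  by rewrite -[h x - h a](subrKA (h y)) le_normcD.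
have h6 : `|F y| <= `|F x| + g / 2 / (M + 1).
  rewrite -lerBlDl (le_trans (lerB_dist _ _))// distrC; exact: ltW.
have h7 : M * `|F y| <= M * `|F x| + g / 2.
  apply: (le_trans (ler_wpM2l M0 h6)); rewrite mulrDr lerD2l.
  rewrite mulrA ler_pdivrMr ?ltr_wpDl// [leLHS]mulrC ler_wpM2l ?lerDl//.
  by rewrite divr_ge0// ltW.
by rewrite /g in h1 h7 *; lra.
Qed.

Lemma cRe_weight_bound M : (forall x, a < x < b -> normc (h x - h a) <= M * `|F x|) ->
  forall x, a < x < b -> `|cRe (h x) - c| <= M * `|F x|.
Proof.
move=> HM x xab; apply: le_trans (HM x xab).
by rewrite -complex_ReB normc_ge_absRe.
Qed.

Hypothesis Finv : forward_invariant a b F.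

Lemma cRe_h_flow_continuous x t : a < x < b -> 0 <= t ->
  {for t, continuous (fun s => cRe (h (flow a b F s x)))} /\
  {for t, continuous (fun s => cIm (h (flow a b F s x)))}.
Proof.
move=> xab t0; have fab := flow_itv Finv xab t0.
have /cvg_complexP[cr ci] := @ccontinuous_on_interior _ _ _ ab h ch _ fab.
have cf := flow_continuous Finv xab t0.
by split; [apply: continuous_comp cf cr|apply: continuous_comp cf ci].
Qed.

Lemma normc_h_ x t : normc (h_ a b F h t x) =
  expR (\int[mu]_(s in `[0, t]) cRe (h (flow a b F s x))).
Proof. by rewrite /h_ normc_cexp. Qed.

(** The integrand Re h - c is at most M |F| in absolute value along the orbit. Since F keeps its
    sign there, |F(u)| is the derivative of u up to one global sign, and its integral is |u(t) -
    x|. *)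
Lemma normc_h_bound M x t : 0 <= M ->
  (forall x, a < x < b -> normc (h x - h a) <= M * `|F x|) -> a < x < b -> 0 <= t ->
  `|\int[mu]_(s in `[0, t]) cRe (h (flow a b F s x)) - c * t| <= M * `|flow a b F t x - x|.
Proof.
move=> M0 HM xab t0; set u := fun s => flow a b F s x.
have cu s : 0 <= s -> {for s, continuous u} := @flow_continuous _ _ _ _ Finv _ xab s.
have cFu s : 0 <= s -> {for s, continuous (fun s => F (u s))}.
  move=> s0; apply: continuous_comp; first exact: cu.
  by apply: (C1_continuous FC1); exact: flow_itv.
have chu s : 0 <= s -> {for s, continuous (fun s => cRe (h (u s)))}.
  by move=> s0; have [] := cRe_h_flow_continuous xab s0.
have hi : mu.-integrable `[0, t] (EFin \o (fun s => cRe (h (u s)))).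
  by apply: integrable_continuous_itv => s /andP[s0 _]; exact: chu.
have ci : mu.-integrable `[0, t] (EFin \o cst c).
  by apply: integrable_cst => //; exact: lebesgue_measure_itv_lty.
have ctE : c * t = \int[mu]_(s in `[0, t]) cst c s.
  have dd s : 0 <= s <= t -> is_derive s (1:R) (fun s => c * s + 0) (cst c s).
    by move=> _; exact: is_derive_affine.
  have cc s : 0 <= s <= t -> {for s, continuous (cst c : R -> R)}.
    by move=> _; exact: cvg_cst.
  by rewrite (FTC2 t0 dd cc) mulr0 !addr0 subr0.
rewrite ctE -RintegralB//.
have di := integrable_fB (measurable_itv _) hi ci.
rewrite (le_trans (le_normr_Rintegral _ di))//.
have aux (sg : R) : sg = 1 \/ sg = -1 -> (forall s, 0 <= s <= t -> `|F (u s)| = sg * F (u s)) ->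
    \int[mu]_(s in `[0, t]) `|cRe (h (u s)) - cst c s| <= M * `|u t - x|.
  move=> sg1 Fsg.
  have Mi : mu.-integrable `[0, t] (EFin \o (fun s => M * sg * F (u s))).
    apply: integrable_fZ => //; apply: integrable_continuous_itv => s /andP[s0 _]; exact: cFu.
  apply: (@le_trans _ _ (\int[mu]_(s in `[0, t]) (M * sg * F (u s)))).
    apply: le_Rintegral => //; first exact: integrable_norm.
    move=> s; rewrite /= in_itv/= => sab; rewrite -mulrA -Fsg//.
    apply: cRe_weight_bound => //; apply: flow_itv => //.
    by case/andP : sab.
  rewrite RintegralZl//; last first.
    by apply: integrable_continuous_itv => s /andP[s0 _]; exact: cFu.
  have dd s : 0 <= s <= t -> is_derive s (1:R) u (F (u s)).
    by move=> /andP[s0 _]; exact: (flow_is_derive Finv xab s0).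
  have cc s : 0 <= s <= t -> {for s, continuous (fun s => F (u s))}.
    by move=> /andP[s0 _]; exact: cFu.
  rewrite (FTC2 t0 dd cc) /u.
  rewrite (flow0 Finv xab) -mulrA ler_wpM2l// (le_trans (ler_norm _))// normrM.
  by case: sg1 => ->; rewrite ?normrN normr1 mul1r.
have [H|H] := flow_sign ab FC1 Finv xab t0.
  by apply: (aux 1); [left|move=> s st; rewrite mul1r ger0_norm// H].
by apply: (aux (-1)); [right|move=> s st; rewrite mulN1r ler0_norm// H].
Qed.

Lemma S_interior (f : R -> R[i]) t x : a < x < b ->
  S_ a b F h t f x = h_ a b F h t x * f (flow a b F t x).
Proof. by move=> xab; rewrite /S_ /cont_rep xab. Qed.

End Weight.

(** * Signs of F and c for a chaotic semigroup *)

Section Necessity.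
Context {R : realType}.
Notation mu := (@lebesgue_measure R).
Notation normc := ComplexField.Normc.normc.
Notation cRe := (complex.Re).
Implicit Types (x y z s t L M A e : R).

Lemma sobolev_star_bounded a b p (f : R -> R[i]) : a < b -> 1 <= p ->
  sobolev_star a b p%:E f ->
  exists2 B : R, 0 <= B & forall x, a <= x <= b -> normc (f x) <= B.
Proof.
move=> ab p1 /(sobolev_star_weak p1)[cf fa _ [g fg gp]].
have p0 : 0 < p := lt_le_trans ltr01 p1.
pose K := (fine (energy `[a, b] p g) + 1) `^ p^-1.
have e0 : 0 <= fine (energy `[a, b] p g) by rewrite fine_ge0// energy_ge0.
have K0 : 0 < K by rewrite powR_gt0// ltr_wpDl.
have gK : (energy `[a, b] p g <= (K `^ p)%:E)%E.
  rewrite /K -powRrM mulVf ?gt_eqF// powRr1 ?addr_ge0//.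
  by rewrite -(@fineK _ (energy _ _ _)) ?ge0_fin_numE ?energy_ge0// lee_fin lerDl.
exists (2 * (b - a + 1) * K).
  by rewrite !mulr_ge0 ?(ltW K0)// addr_ge0// subr_ge0 ltW.
exact: sobolev_sup_bound ab p1 f g K cf fa fg (weak_derivative_measurable fg) K0 gK.
Qed.

Variables (a b p : R) (F : R -> R) (h : R -> R[i]).
Hypotheses (ab : a < b) (p1 : 1 <= p) (FC1 : C1_on a b F).
Hypothesis Finv : forward_invariant a b F.
Hypothesis ch : ccontinuous_on `[a, b] h.
Variable M : R.
Hypothesis M0 : 0 <= M.
Hypothesis HM : forall x, a < x < b -> normc (h x - h a) <= M * `|F x|.

Let c := cRe (h a).
Let X := sobolev_star a b p%:E.
Let p0 : 0 < p. Proof. exact: lt_le_trans p1. Qed.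

Let hbound x t : a < x < b -> 0 <= t ->
  `|\int[mu]_(s in `[0, t]) cRe (h (flow a b F s x)) - c * t| <= M * `|flow a b F t x - x|.
Proof. by move=> xab t0; exact: normc_h_bound. Qed.

(* If [c <= 0] then every orbit is bounded in the supremum norm. *)
Lemma hypercyclic_gt0 : hypercyclic X (sobolev_norm a b p%:E) (S_ a b F h) -> 0 < c.
Proof.
move=> [f Xf densef]; rewrite ltNge; apply/negP => c0.
have [B B0 fB] := sobolev_star_bounded ab p1 Xf.
pose K := expR (M * (b - a)) * B.
have SK t x : 0 <= t -> a < x < b -> normc (S_ a b F h t f x) <= K.
  move=> t0 xab; rewrite S_interior// ComplexField.Normc.normcM normc_h_.
  have /andP[u1 u2] := flow_itv Finv xab t0; have /andP[x1 x2] := xab.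
  apply: ler_pM; rewrite ?expR_ge0 ?normc_ge0//; last by apply: fB; rewrite !ltW.
  rewrite ler_expR; have := hbound xab t0; rewrite ler_norml => /andP[_].
  have ct : c * t <= 0 by rewrite mulr_le0_ge0.
  have Mu : M * `|flow a b F t x - x| <= M * (b - a).
    by rewrite ler_wpM2l// ler_norml; apply/andP; split; lra.
  by move=> Hu; lra.
(* N makes N (b - m) > 1 for the midpoint m, and N^p >= N as N >= 1. The slope A makes the target at
   least K + N on [m, b[, so that a function bounded by K misses it by N on that half. *)
pose N := 2 / (b - a) + 1.
have ba0 : 0 < b - a by rewrite subr_gt0.
have N1 : 1 <= N by rewrite lerDr divr_ge0// ltW.
pose A := 2 * (K + N) / (b - a).
have K0 : 0 <= K by rewrite mulr_ge0 ?expR_ge0.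
have [_ XA] := linear_function_sobolev_star ab A p1.
have [_ [t t0 <-] Ht] := densef _ XA 1 ltr01.
have : (energy `[a, b] p (S_ a b F h t f - linear_function a b A)%R <= (1 `^ p)%:E)%E.
  apply: cLnorm_lt => //; apply: le_lt_trans Ht.
  by rewrite /sobolev_norm leeDl// cLnormE// poweR_ge0.
apply/negP; rewrite -ltNge powR1.
pose m := (a + b) / 2.
apply: (@lt_le_trans _ _ (\int[mu]_(x in `[a, b]) ((fun=> (N `^ p)%:E) \_ `[m, b[) x)%E); last first.
  apply: ge0_le_integral_nomeas => x.
    by rewrite /patch; case: ifP => //; rewrite lee_fin powR_ge0.
  rewrite /patch; case: ifPn => [|_ _]; last by rewrite lee_fin powR_ge0.
  rewrite inE/= in_itv/= => /andP[mx xb] _; rewrite lee_fin.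
  have N0 : 0 <= N := le_trans ler01 N1.
  apply: ge0_ler_powR; rewrite ?nnegrE ?normc_ge0 ?N0 ?(ltW p0)//.
  have ax : a < x by rewrite (lt_le_trans _ mx)// /m; lra.
  have xab : a < x < b by rewrite ax.
  have h1 := SK t x t0 xab.
  have h2 : K + N <= normc (linear_function a b A x).
    have xab' : a <= x <= b by rewrite !ltW.
    rewrite (linear_functionE _ xab') normc_real (le_trans _ (ler_norm _))//.
    have -> : A * (x - a) = (K + N) * (2 * (x - a) / (b - a)).
      by rewrite /A; field; rewrite gt_eqF.
    apply: ler_peMr; first by rewrite addr_ge0.
    rewrite ler_pdivlMr// mul1r.
    by move: mx; rewrite /m; lra.
  have h3 : normc (linear_function a b A x) <=
      normc (linear_function a b A x - S_ a b F h t f x) + normc (S_ a b F h t f x).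
    by rewrite -{1}[linear_function a b A x](subrK (S_ a b F h t f x)) le_normcD.
  have -> : normc ((S_ a b F h t f - linear_function a b A) x) =
      normc (linear_function a b A x - S_ a b F h t f x).
    by rewrite -normcN opprB.
  lra.
rewrite -integral_mkcondr (_ : `[a, b] `&` `[m, b[ = `[m, b[%classic); last first.
  rewrite setIidr//; apply: subset_itv; rewrite bnd_simp//.
  by rewrite /m; lra.
have -> : (\int[mu]_(x in `[m, b[) (N `^ p)%:E = (N `^ p)%:E * mu `[m, b[%classic)%E.
  exact: integral_cst.
rewrite lebesgue_measure_itv/= lte_fin ifT; last by rewrite /m; lra.
rewrite -EFinD -EFinM lte_fin.
apply: (@lt_le_trans _ _ (N * (b - m))).
  rewrite /N /m; have -> : (2 / (b - a) + 1) * (b - (a + b) / 2) = 1 + (b - a) / 2.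
    by field; rewrite gt_eqF.
  by rewrite ltrDl divr_gt0.
rewrite ler_wpM2r//; first by rewrite /m; lra.
rewrite -[leLHS]powRr1 ?(le_trans ler01)//.
by apply: ler_powR.
Qed.

Hypothesis c0 : 0 < c.

(** Compare f(y) = h_t(y) f(w) for w the image of y after one period. If y is near the equilibrium
    z, so is w, and |h_t(y)| >= E = exp (c t / 2) > 1. If f(z) != 0, then f(y) and f(w) have nearly
    the same modulus, which is absurd. The point y < z stands in for z, which may be b, where the
    flow is not defined. *)
Lemma periodic_zero f t z : X f -> 0 < t -> S_ a b F h t f = f ->
  a < z <= b -> F z = 0 -> f z = 0.
Proof.
move=> Xf t0 Sf /andP[az zb] Fz; have [cf _ _ _] := sobolev_star_weak p1 Xf.
have [L L0 HL] := C1_derive_bound ab FC1.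
apply: normc_eq0; apply/eqP; rewrite -[_ == _]negbK; apply/negP => q0'.
set q := normc (f z) in q0'.
have q0 : 0 < q by rewrite lt_neqAle eq_sym q0' normc_ge0.
pose E := expR (c * t / 2).
have E1 : 1 < E by rewrite /E expR_gt1 divr_gt0// mulr_gt0.
(* Half of the value for which 1 + d = (1 - d) E. *)
pose d := (E - 1) / (E + 1) / 2.
have E10 : 0 < E + 1 by rewrite addr_gt0// (lt_trans ltr01).
have d0 : 0 < d by rewrite !divr_gt0// subr_gt0.
have dE : 1 + d < (1 - d) * E.
  rewrite -subr_gt0; have -> : (1 - d) * E - (1 + d) = (E - 1) / 2.
    by rewrite /d; field; rewrite gt_eqF.
  by rewrite divr_gt0// subr_gt0.
have zab : a <= z <= b by rewrite ltW.
have qd0 : 0 < q * d by rewrite mulr_gt0.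
have [r r0 Hr] := continuous_normc_near (@ccontinuous_clamp _ _ _ ab f cf z) qd0.
pose G := expR (L * t).
have G0 : 0 < G by rewrite expR_gt0.
have G1 : 1 <= G by rewrite -expR0 ler_expR mulr_ge0 ?ltW.
(* The three bounds keep y to the right of a, keep y and w within r of z (G is the Gronwall factor),
   and make the deviation M |w - y| at most c t / 2. *)
pose k := Num.min (z - a) (Num.min (r / G) (c * t / 2 / (2 * G * (M + 1)))).
have k0 : 0 < k.
  by rewrite !lt_min subr_gt0 az !divr_gt0 ?mulr_gt0// ltr_wpDl.
pose y := z - k / 2.
have [k1 [k2 k3]] : k <= z - a /\ k <= r / G /\ k <= c * t / 2 / (2 * G * (M + 1)).
  by rewrite /k !ge_min !lexx ?orbT.
have yz : `|y - z| = k / 2 by rewrite /y ler0_norm; lra.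
have yab : a < y < b by rewrite /y; apply/andP; split; lra.
have [Hu _] := flow_gronwall FC1 Finv yab L0 HL zab Fz (lexx 0) (ltW t0).
rewrite subr0 (flow0 Finv yab) yz -/G in Hu.
set w := flow a b F t y in Hu.
have /andP[w1 w2] : a < w < b := flow_itv Finv yab (ltW t0).
have kr : G * (k / 2) < r.
  by move: k2; rewrite ler_pdivlMr// [k * G]mulrC => ?; rewrite mulrA ltr_pdivrMr//; lra.
have fw : q * (1 - d) < normc (f w).
  have : normc (f z - f w) < q * d.
    have := Hr w; rewrite /= !clamp_id ?(ltW w1) ?(ltW w2)//; apply.
    by rewrite distrC (le_lt_trans Hu).
  have : q <= normc (f z - f w) + normc (f w).
    by rewrite /q -{1}[f z](subrK (f w)) le_normcD.
  by rewrite mulrBr mulr1; lra.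
have fy : normc (f y) < q * (1 + d).
  have : normc (f z - f y) < q * d.
    have /andP[/ltW y1 /ltW y2] := yab.
    have := Hr y; rewrite /= !clamp_id ?y1 ?y2//; apply.
    rewrite distrC yz; apply: le_lt_trans kr.
    by rewrite ler_peMl// divr_ge0// ltW.
  have : normc (f y) <= normc (f z - f y) + normc (f z).
    rewrite -[normc (f z - f y)]normcN opprB.
    by rewrite -{1}[f y](subrK (f z)) le_normcD.
  by rewrite -/q mulrDr mulr1; lra.
have : normc (f y) = expR (\int[mu]_(s in `[0, t]) cRe (h (flow a b F s y))) * normc (f w).
  by rewrite -{1}Sf S_interior// ComplexField.Normc.normcM normc_h_.
have hE : E <= expR (\int[mu]_(s in `[0, t]) cRe (h (flow a b F s y))).
  rewrite ler_expR; have := hbound yab (ltW t0); rewrite -/w ler_norml => /andP[+ _].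
  have wy : `|w - y| <= 2 * G * k / 2.
    rewrite -(subrKA z) (le_trans (ler_normD _ _))// [`|z - y|]distrC yz.
    rewrite (le_trans (lerD Hu (lexx _)))//.
    have : k / 2 <= G * (k / 2) by rewrite ler_peMl// divr_ge0// ltW.
    by move=> ?; lra.
  have : M * `|w - y| <= c * t / 2.
    apply: le_trans (ler_wpM2l M0 wy) _.
    move: k3; rewrite ler_pdivlMr; last by rewrite !mulr_gt0// ltr_wpDl.
    move=> k3; apply: le_trans k3.
    have Gk : 0 <= G * k by rewrite mulr_ge0 ?ltW.
    have MGk : 0 <= M * (G * k) by rewrite mulr_ge0.
    by nra.
  by lra.
move=> Efy; move: fy; rewrite Efy; apply/negP; rewrite -leNgt.
apply: (@le_trans _ _ (E * (q * (1 - d)))).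
  rewrite mulrCA [E * _]mulrC; apply: ler_wpM2l; exact: ltW.
apply: ler_pM => //; [by rewrite ltW// (lt_trans ltr01)| |exact: ltW].
rewrite mulr_ge0 ?(ltW q0)// subr_ge0.
by rewrite -(ler_pM2r (lt_trans ltr01 E1)); nra.
Qed.

Lemma periodic_dense_near (A e : R) : 0 < e ->
  dense_in X (sobolev_norm a b p%:E) (periodic_points X (S_ a b F h)) ->
  exists f t, [/\ X f, 0 < t, S_ a b F h t f = f &
   forall x, a <= x <= b -> normc (f x - (A * (x - a))%:C) <= 2 * (b - a + 1) * e].
Proof.
move=> e0 dense; have [wA XA] := linear_function_sobolev_star ab A p1.
have [f [Xf [t t0 Sf]] Hf] := dense _ XA _ e0.
exists f, t; split => // x xab.
have [cf fa _ [g fg _]] := sobolev_star_weak p1 Xf.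
have [cl la _ _] := sobolev_star_weak p1 XA.
rewrite -(linear_functionE A xab).
have wd := is_weak_derivativeB ab fg wA.
apply: (sobolev_eval ab p1 (f := fun x => f x - linear_function a b A x) _ _ wd e0 Hf xab).
  move: cf cl => /ccontinuous_onP[fr fi] /ccontinuous_onP[lr li].
  apply/ccontinuous_onP; split => y.
    under [X in continuous_at _ X]eq_fun do rewrite complex_ReB.
    by apply: cvgB; [exact: fr|exact: lr].
  under [X in continuous_at _ X]eq_fun do rewrite complex_ImB.
  by apply: cvgB; [exact: fi|exact: li].
by rewrite fa la subrr.
Qed.

(** At a zero z of F all periodic points vanish, whereas x - a does not. Evaluation at z being
    continuous, with the constant of [sobolev_eval], x - a cannot be approximated; e makes the error
    at most half of z - a. *)
Lemma periodic_nonzero_field :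
  dense_in X (sobolev_norm a b p%:E) (periodic_points X (S_ a b F h)) ->
  forall z, a < z <= b -> F z != 0.
Proof.
move=> dense z zab; apply/eqP => Fz; have /andP[az zb] := zab.
have C0 : 0 < 2 * (b - a + 1) by rewrite mulr_gt0// addr_gt0// subr_gt0.
pose e := (z - a) / (2 * (2 * (b - a + 1))).
have e0 : 0 < e by rewrite divr_gt0 ?subr_gt0// mulr_gt0.
have [f [t [Xf t0 Sf Hf]]] := periodic_dense_near 1 e0 dense.
have := Hf z; rewrite (ltW az) zb (periodic_zero Xf t0 Sf zab Fz) => /(_ isT).
have za0 : 0 < z - a by rewrite subr_gt0.
rewrite sub0r normcN normc_real mul1r (gtr0_norm za0).
apply/negP; rewrite -ltNge.
have -> : 2 * (b - a + 1) * e = (z - a) / 2.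
  by rewrite /e; field; lra.
lra.
Qed.

(** Were F positive at one point of ]a, b], it would be positive throughout, and at least F w > 0 on
    [x0, b] for the midpoint x0. The orbit of x0 would then be at or beyond b at time T = (b - x0) /
    F w, against forward invariance. *)
Lemma nonzero_field_lt0 : (forall z, a < z <= b -> F z != 0) ->
  forall z, a < z <= b -> F z < 0.
Proof.
move=> Fn0 z zab; rewrite ltNge le_eqVlt negb_or eq_sym Fn0//=; apply/negP => Fz.
have [cF _ _] := FC1.
have Fpos x : a < x <= b -> 0 < F x.
  move=> xab; rewrite ltNge le_eqVlt negb_or Fn0//=; apply/negP => Fx.
  have /andP[ax xb] := xab; have /andP[az zb] := zab.
  have mm : Num.min x z <= Num.max x z by rewrite ge_min !le_max !lexx.
  have [||w] := @IVT R F (Num.min x z) (Num.max x z) 0 mm.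
  - apply: continuous_subspaceW cF; apply: subset_itv; rewrite bnd_simp.
      by rewrite le_min !ltW.
    by rewrite ge_max xb.
  - by case: (leP x z) => _; rewrite ge_min le_max (ltW Fx) (ltW Fz) ?orbT.
  rewrite in_itv/= => /andP[w1 w2] Fw.
  have := Fn0 w; rewrite Fw eqxx => /(_ _)/negP; apply => //.
  by rewrite (lt_le_trans _ w1) ?lt_min ?ax//= (le_trans w2)// ge_max xb.
pose x0 := (a + b) / 2.
have [ax0 x0b] : a < x0 /\ x0 < b by rewrite /x0; split; lra.
have x0ab : a < x0 < b by rewrite ax0.
have cF' : {within `[x0, b], continuous F}.
  by apply: continuous_subspaceW cF; apply: subset_itv; rewrite bnd_simp// ltW.
have [w /[!in_itv]/= /andP[w1 w2] Hw] := EVT_min (ltW x0b) cF'.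
have Fw0 : 0 < F w by apply: Fpos; rewrite (lt_le_trans ax0).
have Fu t : 0 <= t -> 0 < F (flow a b F t x0).
  by move=> t0; apply: Fpos; have /andP[-> /ltW ->] := flow_itv Finv x0ab t0.
have ux0 t : 0 <= t -> x0 <= flow a b F t x0.
  move=> t0; rewrite -[leLHS](flow0 Finv x0ab).
  apply: (@is_derive_ge0_le _ _ (fun s => F (flow a b F s x0)) 0 t t0).
    by move=> s /andP[s0 _]; exact: (flow_is_derive Finv x0ab s0).
  by move=> s /andP[s0 _]; exact: ltW (Fu _ s0).
pose T := (b - x0) / F w.
have T0 : 0 <= T by rewrite divr_ge0 ?subr_ge0 ?ltW.
have dd s : 0 <= s <= T -> is_derive s (1:R)
    (fun s => flow a b F s x0 - (F w * s + 0)) (F (flow a b F s x0) - F w).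
  move=> /andP[s0 _].
  exact: is_derive_fB (flow_is_derive Finv x0ab s0) (is_derive_affine _ _ _).
have := is_derive_ge0_le T0 dd; rewrite (flow0 Finv x0ab) mulr0 !addr0 subr0.
have -> : F w * T = b - x0 by rewrite /T mulrC divfK// gt_eqF.
have /andP[_ ub] := flow_itv Finv x0ab T0.
suff H : forall s, 0 <= s <= T -> 0 <= F (flow a b F s x0) - F w.
  by move=> /(_ H); lra.
move=> s /andP[s0 _]; rewrite subr_ge0; apply: Hw.
by rewrite in_itv/= ux0//=; have /andP[_ /ltW] := flow_itv Finv x0ab s0.
Qed.

End Necessity.

(** * Signs of F and c under condition (ii) *)

Section LogPrimitive.
Context {R : realType}.
Notation mu := (@lebesgue_measure R).
Notation cRe := (complex.Re).
Implicit Types (x y z s t L M A e c w : R) (f g : R -> R).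

Lemma is_derive_ln_norm f x (d : R) : f x != 0 -> is_derive x (1:R) f d ->
  is_derive x (1:R) (fun y => ln `|f y|) (d / f x).
Proof.
move=> fx0 df; set s := Num.sg (f x).
have s0 : s != 0 by rewrite sgr_eq0.
have sfx : 0 < s * f x by rewrite /s -normrEsg normr_gt0.
have E : \forall y \near x, ln (s * f y) = ln `|f y|.
  have cf : {for x, continuous (fun y => s * f y)}.
    by apply: cvgM; [exact: cvg_cst|exact: is_derive_continuous df].
  have : \forall y \near x, 0 < s * f y.
    by have /cf := lt_nbhsr sfx.
  apply: filterS => y sy; congr ln.
  by rewrite -(gtr0_norm sy) normrM /s normr_sg fx0 mul1r.
apply: is_derive_near E _.
have dl := @is_derive_fcomp R (@ln R) (fun y => s * f y) x _ _ (is_derive1_ln sfx) (is_derive_fZ s df).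
apply: (is_derive_cong dl).
by field; rewrite ?s0 ?fx0.
Qed.

(** A connected set through x is an interval; if it left ]c0, d0[ it would contain c0 or d0, neither
    of which belongs to the set. *)
Lemma connected_component_oo (a b c0 d0 : R) (Z : set R) x : a <= c0 -> d0 <= b ->
  c0 < x < d0 -> (forall y, c0 < y < d0 -> ~ Z y) ->
  (c0 = a \/ Z c0) -> (d0 = b \/ Z d0) ->
  connected_component (`]a, b[ `\` Z) x = `]c0, d0[%classic.
Proof.
move=> ac db /andP[cx xd] nZ Zc Zd; rewrite eqEsubset; split.
  move=> y; case=> C [Cx CA cC] Cy.
  have iC : is_interval C by apply/connected_intervalP.
  rewrite /= in_itv/=; apply/andP; split; rewrite ltNge; apply/negP => H.
    have Cc : C c0 by apply: (iC y x) => //; rewrite H ltW.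
    have [+ nZc] := CA _ Cc; rewrite /= in_itv/= => /andP[ac0 _].
    by case: Zc => [ca|//]; move: ac0; rewrite ca ltxx.
  have Cd : C d0 by apply: (iC x y) => //; rewrite H ltW.
  have [+ nZd] := CA _ Cd; rewrite /= in_itv/= => /andP[_ d0b].
  by case: Zd => [ca|//]; move: d0b; rewrite ca ltxx.
apply: connected_component_max.
- by rewrite /= in_itv/= cx.
- move=> y; rewrite /= in_itv/= => /andP[cy yd]; split.
    by rewrite /= in_itv/= (le_lt_trans ac)//= (lt_le_trans yd).
  by apply: nZ; rewrite cy.
- by apply/connected_intervalP; exact: interval_is_interval.
Qed.

Lemma ge0_integral_itv_exhaust (a b B : R) f : a < b ->
  measurable_fun `]a, b] f -> (forall x, a < x <= b -> 0 <= f x) ->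
  (forall y, a < y < b -> (\int[mu]_(x in `[y, b]) (f x)%:E <= B%:E)%E) ->
  (\int[mu]_(x in `]a, b]) (f x)%:E <= B%:E)%E.
Proof.
(* Denominators from 2 on keep e n strictly below b. *)
move=> ab mf f0 H; pose e (n : nat) := a + (b - a) / n.+2%:R.
have ba0 : 0 < b - a by rewrite subr_gt0.
have eab n : a < e n < b.
  have n0 : (0 : R) < n.+2%:R by rewrite ltr0n.
  rewrite /e ltrDl divr_gt0//= -ltrBrDl ltr_pdivrMr// ltr_pMr// ltr1n//.
have ee n m : (n <= m)%N -> e m <= e n.
  by move=> nm; rewrite /e lerD2l ler_pM2l// lef_pV2 ?posrE ?ltr0n// ler_nat.
have E : `]a, b]%classic = \bigcup_n `[e n, b]%classic.
  rewrite eqEsubset; split => x.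
    rewrite /= in_itv/= => /andP[ax xb].
    exists (Num.trunc ((b - a) / (x - a))) => //=; rewrite in_itv/= xb andbT /e.
    rewrite -lerBrDl ler_pdivrMr ?ltr0n// -ler_pdivrMl ?subr_gt0// mulrC ltW//.
    apply: lt_le_trans (Num.Theory.truncnS_gt _) _; rewrite ler_nat.
    exact: leqW (leqnn _).
  case=> n _; rewrite /= !in_itv/= => /andP[nx ->]; rewrite andbT.
  by have /andP[an _] := eab n; exact: lt_le_trans nx.
have sub n : `[e n, b]%classic `<=` `]a, b]%classic.
  by move=> x Hx; rewrite E; exists n.
have cvgI : (\int[mu]_(x in `[e n, b]) (f x)%:E @[n --> \oo] -->
    \int[mu]_(x in \bigcup_i `[e i, b]%classic) (f x)%:E)%E.
  apply: ge0_nondecreasing_set_cvg_integral => //.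
  - by move=> n m nm; apply/subsetPset; apply: subset_itvr; rewrite bnd_simp; exact: ee.
  - by move=> n; apply/measurable_EFinP; apply: measurable_funS mf.
  - by move=> n x /= /(sub n); rewrite /= in_itv/= => xab; rewrite lee_fin f0.
rewrite E -(cvg_lim _ cvgI)//; apply: lime_le; first by apply/cvg_ex; exists (\int[mu]_(x in \bigcup_i `[e i, b]%classic) (f x)%:E)%E.
by apply: nearW => n; exact: H.
Qed.

Variables (a b : R) (F : R -> R) (h : R -> R[i]).
Hypotheses (ab : a < b) (FC1 : C1_on a b F).
Let c := cRe (h a).

Variable L : R.
Hypothesis L0 : 0 < L.
Hypothesis HL : forall x, a < x < b -> `|derive1 F x| <= L.

Lemma C1_inv_continuous y : a < y < b -> F y != 0 -> {for y, continuous (fun y => (F y)^-1)}.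
Proof. by move=> yab Fy; apply: cvgV => //; exact: (C1_continuous FC1 yab). Qed.

(** The integrand F'/F + c/F is the derivative of ln |F| + c K. Thus the exponential in (ii) is (|F
    x| / |F w|)^p exp (- p c (K w - K x)). *)
Lemma oint_logE (K : R -> R) x w :
  (forall y, Num.min x w <= y <= Num.max x w ->
     [/\ a < y < b, F y != 0 & is_derive y (1:R) K (F y)^-1]) ->
  oint x w (fun y => (derive1 F y + c) / F y) =
  (ln `|F w| - ln `|F x|) + c * (K w - K x).
Proof.
move=> H.
have dd y : Num.min x w <= y <= Num.max x w ->
    is_derive y (1:R) (fun y => ln `|F y| + c * K y) ((derive1 F y + c) / F y).
  move=> /H[yab Fy dK].
  have dl := is_derive_fD (is_derive_ln_norm Fy (C1_is_derive FC1 yab)) (is_derive_fZ c dK).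
  by apply: (is_derive_cong dl); rewrite mulrDl.
have cc y : Num.min x w <= y <= Num.max x w ->
    {for y, continuous (fun y => (derive1 F y + c) / F y)}.
  move=> /H[yab Fy _]; apply: cvgM; last exact: C1_inv_continuous.
  by apply: cvgD; [exact: (C1_derive_continuous ab FC1 yab)|exact: cvg_cst].
by rewrite (oint_FTC dd cc) mulrBr; ring.
Qed.

(** Because |F'/F| <= L / |F| and K' = 1 / |F|: ln |F| varies at most linearly in the time that K
    measures. *)
Lemma ln_norm_lipschitz (K : R -> R) x w : x <= w ->
  (forall y, x <= y <= w ->
     [/\ a < y < b, F y != 0 & is_derive y (1:R) K `|F y|^-1]) ->
  `|ln `|F w| - ln `|F x| | <= L * (K w - K x).
Proof.
move=> xw H.
have dln y : x <= y <= w -> is_derive y (1:R) (fun y => ln `|F y|) (derive1 F y / F y).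
  by move=> /H[yab Fy _]; exact: is_derive_ln_norm Fy (C1_is_derive FC1 yab).
have dK y : x <= y <= w -> is_derive y (1:R) (fun y => L * K y) (L * `|F y|^-1).
  by move=> /H[yab Fy dK]; exact: is_derive_fZ.
have bd y : x <= y <= w -> `|derive1 F y / F y| <= L * `|F y|^-1.
  by move=> /H[yab Fy _]; rewrite normrM normfV ler_wpM2r ?HL// invr_ge0.
rewrite ler_norml; apply/andP; split.
  have dd y : x <= y <= w -> is_derive y (1:R) (fun y => ln `|F y| + L * K y)
     (derive1 F y / F y + L * `|F y|^-1).
    by move=> xyw; exact: is_derive_fD (dln _ xyw) (dK _ xyw).
  have := is_derive_ge0_le xw dd.
  suff H0 y : x <= y <= w -> 0 <= derive1 F y / F y + L * `|F y|^-1.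
    by move=> /(_ H0); lra.
  by move=> /bd; rewrite ler_norml => /andP[? _]; lra.
have dd y : x <= y <= w -> is_derive y (1:R) (fun y => L * K y - ln `|F y|)
    (L * `|F y|^-1 - derive1 F y / F y).
  by move=> xyw; exact: is_derive_fB (dK _ xyw) (dln _ xyw).
have := is_derive_ge0_le xw dd.
suff H0 y : x <= y <= w -> 0 <= L * `|F y|^-1 - derive1 F y / F y.
  by move=> /(_ H0); lra.
by move=> /bd; rewrite ler_norml => /andP[_ ?]; lra.
Qed.

(* [1 / F] is not integrable near a zero of [F], in a quantitative form. *)
Lemma ln_norm_integral_bound (D : set R) (J : R -> R) (k B : R) x w : x <= w -> 0 < k ->
  (forall y, x <= y <= w -> [/\ a < y < b, F y != 0 & k / `|F y| <= J y]) ->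
  (forall y, D y -> 0 <= J y) ->
  `[x, w]%classic `<=` D -> (\int[mu]_(y in D) (J y)%:E <= B%:E)%E ->
  `|ln `|F w| - ln `|F x| | <= L * (B / k).
Proof.
move=> xw k0 H J0 xwD JB.
have cN y : x <= y <= w -> {for y, continuous (fun y => `|F y|^-1)}.
  move=> /H[yab Fy _]; apply: cvgV; first by rewrite normr_eq0.
  by apply: cvg_norm; exact: (C1_continuous FC1 yab).
have [K HK] : exists K : R -> R, forall y, x <= y <= w -> is_derive y (1:R) K `|F y|^-1.
  have cF : {within `[x, w], continuous F}.
    by apply: within_continuous_itv => y /H[yab _ _]; exact: (C1_continuous FC1 yab).
  have cV y : [set: R] y -> {for y, continuous (fun y => `|F (clamp x w y)|^-1)}.
    move=> _; have [_ Fy _] := H _ (clamp_itv y xw).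
    apply: cvgV; first by rewrite normr_eq0.
    by apply: cvg_norm; exact: (continuous_clamp xw cF).
  have [|K HK] := primitive_exists openT _ cV; first by [].
  by exists K => y xyw; have := HK y Logic.I; rewrite clamp_id.
have lip := @ln_norm_lipschitz K x w xw (fun y xyw => let: And3 p q _ := H y xyw in And3 p q (HK y xyw)).
apply: le_trans lip _; rewrite ler_pM2l// ler_pdivlMr//.
have : (\int[mu]_(y in `[x, w]) (k * `|F y|^-1)%:E <= B%:E)%E.
  apply: le_trans JB; rewrite integral_mkcond [leRHS]integral_mkcond.
  apply: ge0_le_integral_nomeas => y _.
    by rewrite /patch; case: ifP => // _; rewrite lee_fin mulr_ge0// ltW.
  rewrite /patch; case: ifPn => [/set_mem yxw|_].
    rewrite ifT ?inE; last exact: xwD.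
    by move: yxw; rewrite /= in_itv/= lee_fin => /H[].
  by case: ifPn => // /set_mem /J0; rewrite lee_fin.
have dd y : x <= y <= w -> is_derive y (1:R) (fun y => k * K y) (k * `|F y|^-1).
  by move=> xyw; exact: is_derive_fZ (HK _ xyw).
have cc y : x <= y <= w -> {for y, continuous (fun y => k * `|F y|^-1)}.
  by move=> xyw; apply: cvgM; [exact: cvg_cst|exact: cN].
by rewrite (FTC2e xw dd cc) lee_fin -mulrBr mulrC.
Qed.

End LogPrimitive.

(** * Zeros of F at the ends of a component *)

Section ComponentCondition.
Context {R : realType}.
Notation mu := (@lebesgue_measure R).
Notation cRe := (complex.Re).
Implicit Types (x y z s t M A e w : R).

Lemma expR_ln_powR (x p : R) : 0 < x -> expR (p * ln x) = x `^ p.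
Proof. by move=> x0; rewrite /powR gt_eqF. Qed.

Variables (a b p : R) (F : R -> R) (h : R -> R[i]).
Hypotheses (ab : a < b) (p1 : 1 <= p) (FC1 : C1_on a b F).
Hypothesis Fa : F a = 0.
Let c := cRe (h a).

Lemma C1_constant_sign x y : a <= x <= b -> a <= y <= b ->
  (forall z, Num.min x y <= z <= Num.max x y -> F z != 0) -> 0 < F x * F y.
Proof.
move=> xab yab H; rewrite ltNge; apply/negP => Fxy.
have [cF _ _] := FC1.
have mm : Num.min x y <= Num.max x y by rewrite ge_min !le_max !lexx.
have [||w] := @IVT R F (Num.min x y) (Num.max x y) 0 mm.
- apply: continuous_subspaceW cF; apply: subset_itv; rewrite bnd_simp.
    by rewrite le_min; case/andP : xab => ->; case/andP : yab => ->.
  by rewrite ge_max; case/andP : xab => _ ->; case/andP : yab => _ ->.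
- by case: (leP x y) => _; rewrite ge_min le_max;
    case: (lerP (F x) 0) => ?; case: (lerP (F y) 0) => ? //=; nra.
by rewrite in_itv/= => wxy /eqP; apply/negP; exact: H.
Qed.

(** Since F e = 0, |F w| <= L |w - e| is small for w in [S] close to e, whereas the bound B would
    force |F w| >= r. *)
Lemma ln_norm_unbounded x e (B : R) (S : set R) : a <= e <= b -> F e = 0 ->
  (forall d : R, 0 < d -> exists2 w, S w & `|w - e| < d) ->
  (forall w, S w -> a <= w <= b /\ F w != 0) ->
  ~ (forall w, S w -> `|ln `|F x| - ln `|F w| | <= B).
Proof.
move=> eab Fe Se SF HB; have [L L0 HL] := C1_derive_bound ab FC1.
pose r := expR (ln `|F x| - B).
have r0 : 0 < r by rewrite expR_gt0.
have [w Sw we] := Se (r / L) (divr_gt0 r0 L0).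
have [wab Fw] := SF w Sw.
have := C1_lipschitz FC1 L0 HL wab eab; rewrite Fe subr0 => Fwe.
have : `|F w| < r.
  by rewrite (le_lt_trans Fwe)// mulrC -ltr_pdivlMr.
apply/negP; rewrite -leNgt /r.
have := HB w Sw; rewrite ler_norml => /andP[_ H1].
rewrite -[leRHS]lnK ?posrE ?normr_gt0// ler_expR; lra.
Qed.

Lemma C1_norm_bound : exists2 K : R, 0 < K & forall x, a <= x <= b -> `|F x| <= K.
Proof.
have [L L0 HL] := C1_derive_bound ab FC1.
exists (L * (b - a)); first by rewrite mulr_gt0// subr_gt0.
move=> x /[dup] xab /andP[ax xb].
have aab : a <= a <= b by rewrite lexx ltW.
have := C1_lipschitz FC1 L0 HL xab aab; rewrite Fa subr0 => /le_trans; apply.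
by rewrite ler_pM2l// ger0_norm ?subr_ge0// lerD2r.
Qed.

(** On the side of x where c (tau - tau x) <= 0 the exponential factor of the integrand is at least
    1, so that the integrand dominates k / |F|. Finiteness then bounds ln |F| on that side, and F
    cannot vanish at its end. As c tau has derivative c / F, the sign of c F x tells which side this
    is: the left one if it is nonnegative, the right one if it is nonpositive. *)
Lemma component_endpoints (c0 d0 x : R) : a <= c0 -> d0 <= b -> c0 < x < d0 ->
  (forall y, c0 < y < d0 -> F y != 0) ->
  (component_integral a F h p `]c0, d0[ x < +oo)%E ->
  (0 <= c * F x -> F c0 != 0) /\ (c * F x <= 0 -> F d0 != 0).
Proof.
move=> ac db /andP[cx xd] Fn0 Hfin.
have [L L0 HL] := C1_derive_bound ab FC1.
have [K K0 HK] := C1_norm_bound.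
have sub y : c0 < y < d0 -> a < y < b.
  by move=> /andP[cy yd]; rewrite (le_lt_trans ac)//= (lt_le_trans yd).
have iF y : `]c0, d0[%classic y -> {for y, continuous (fun y => (F y)^-1)}.
  rewrite /= in_itv/= => ycd.
  by apply: (C1_inv_continuous FC1); [exact: sub|exact: Fn0].
have oC : open (`]c0, d0[%classic : set R) by exact: interval_open.
have iC : is_interval (`]c0, d0[%classic : set R) by exact: interval_is_interval.
have [tau Htau] := primitive_exists oC iC iF.
have dtau y : c0 < y < d0 -> is_derive y (1:R) tau (F y)^-1.
  by move=> ycd; apply: Htau; rewrite /= in_itv.
have xcd : c0 < x < d0 by rewrite cx.
have between w : c0 < w < d0 -> forall y, Num.min x w <= y <= Num.max x w -> c0 < y < d0.
  move=> /andP[cw wd] y /andP[]; rewrite ge_min le_max => h1 h2; apply/andP; split.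
    by case/orP : h1; [exact: lt_le_trans|exact: lt_le_trans].
  by case/orP : h2 => ?; [exact: le_lt_trans xd|exact: le_lt_trans wd].
pose J w := expR (- p * oint x w (fun y => (derive1 F y + c) / F y)).
have JE w : c0 < w < d0 -> J w =
    expR (- p * ((ln `|F w| - ln `|F x|) + c * (tau w - tau x))).
  move=> wcd; rewrite /J (@oint_logE _ a b F h ab FC1 tau x w)// => y /(between w wcd) ycd.
  by split; [exact: sub|exact: Fn0|exact: dtau].
(* From |F w|^-p = |F w|^(1 - p) / |F w| and |F w|^(1 - p) >= K^(1 - p), the exponent 1 - p being at
   most 0. *)
pose k := `|F x| `^ p * K `^ (1 - p).
have Fx0 : 0 < `|F x| by rewrite normr_gt0 Fn0.
have k0 : 0 < k by rewrite mulr_gt0 ?powR_gt0.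
have JF w : c0 < w < d0 -> c * (tau w - tau x) <= 0 -> k / `|F w| <= J w.
  move=> wcd cw; rewrite JE//.
  have Fw0 : 0 < `|F w| by rewrite normr_gt0 Fn0.
  apply: (@le_trans _ _ (expR (- p * (ln `|F w| - ln `|F x|)))); last first.
    rewrite ler_expR [leRHS]mulrDr lerDl mulNr oppr_ge0 mulr_ge0_le0//.
    by rewrite (le_trans _ p1).
  have -> : - p * (ln `|F w| - ln `|F x|) = p * ln `|F x| + - p * ln `|F w| by ring.
  rewrite expRD !expR_ln_powR//.
  rewrite /k -mulrA ler_wpM2l ?powR_ge0//.
  rewrite [X in _ <= _ `^ X](_ : - p = (1 - p) - 1); last by ring.
  have -> : `|F w| `^ (1 - p - 1) = `|F w| `^ (1 - p) * `|F w|^-1.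
    by rewrite (@powRD _ `|F w| (1 - p) (- 1)) ?(gt_eqF Fw0) ?implybT// powRN powRr1 ?ltW.
  rewrite ler_wpM2r ?invr_ge0//.
  rewrite -(opprB p 1) !powRN lef_pV2 ?posrE ?powR_gt0//.
  apply: ge0_ler_powR; rewrite ?nnegrE ?subr_ge0// ?(ltW K0)//.
  by apply: HK; have /andP[? ?] := sub _ wcd; rewrite !ltW.
pose B := fine (component_integral a F h p `]c0, d0[ x).
have JB : (\int[mu]_(w in `]c0, d0[) (J w)%:E <= B%:E)%E.
  rewrite /B fineK// ge0_fin_numE//.
  by apply: integral_ge0 => w _; rewrite lee_fin expR_ge0.
have Jge0 y : `]c0, d0[%classic y -> 0 <= J y by move=> _; exact: expR_ge0.
have bound y w : y <= w -> c0 < y -> w < d0 ->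
    (forall v, y <= v <= w -> c * (tau v - tau x) <= 0) ->
    `|ln `|F w| - ln `|F y| | <= L * (B / k).
  move=> yw cy wd Hc; apply: (@ln_norm_integral_bound R a b F FC1 L L0 HL `]c0, d0[%classic J k B y w yw k0) => //.
    move=> v /[dup] yvw /andP[yv vw]; have vcd : c0 < v < d0.
      by rewrite (lt_le_trans cy)//= (le_lt_trans vw).
    by split; [exact: sub|exact: Fn0|apply: JF => //; exact: Hc].
  by apply: subset_itv; rewrite bnd_simp.
have sgn y : c0 < y < d0 -> 0 < F x * F y.
  move=> ycd; apply: C1_constant_sign.
  - by have /andP[? ?] := sub _ xcd; rewrite !ltW.
  - by have /andP[? ?] := sub _ ycd; rewrite !ltW.
  by move=> z /(between _ ycd); exact: Fn0.
have dctau y : c0 < y < d0 -> is_derive y (1:R) (fun y => c * tau y) (c * (F y)^-1).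
  by move=> /dtau; exact: is_derive_fZ.
(* F does not change sign on the component, so that c / F has the sign of c F x throughout. *)
have csgn y : c0 < y < d0 -> exists2 q : R, 0 < q & c * (F y)^-1 = q * (c * F x).
  move=> ycd; have := sgn y ycd; have Fy := Fn0 _ ycd => Fxy.
  exists ((F x * F y)^-1 ); first by rewrite invr_gt0.
  by field; rewrite Fy Fn0.
split=> Hc.
  apply/negP => /eqP Fc0.
  have cab : a <= c0 <= b by rewrite ac (le_trans _ db)// ltW// (lt_trans cx).
  apply: (@ln_norm_unbounded x c0 (L * (B / k)) `]c0, x[%classic cab Fc0).
  - move=> d d_gt0; exists (c0 + Num.min d (x - c0) / 2).
      have m0 : 0 < Num.min d (x - c0) by rewrite lt_min d_gt0 subr_gt0.
      have m1 : Num.min d (x - c0) <= x - c0 by rewrite ge_min lexx orbT.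
      by rewrite /= in_itv/=; apply/andP; split; lra.
    have m0 : 0 < Num.min d (x - c0) by rewrite lt_min d_gt0 subr_gt0.
    have m1 : Num.min d (x - c0) <= d by rewrite ge_min lexx.
    by rewrite addrAC subrr add0r gtr0_norm; lra.
  - move=> w; rewrite /= in_itv/= => /andP[cw wx]; have wcd : c0 < w < d0 by rewrite cw (lt_trans wx).
    by split; [have /andP[? ?] := sub _ wcd; rewrite !ltW|exact: Fn0].
  - move=> w; rewrite /= in_itv/= => /andP[cw wx]; apply: bound => //; first exact: ltW.
    move=> v /andP[wv vx]; rewrite mulrBr subr_le0.
    have vv y : v <= y <= x -> c0 < y < d0.
      by move=> /andP[vy yx]; rewrite (lt_le_trans _ vy) ?(lt_le_trans cw)//= (le_lt_trans yx).
    apply: (is_derive_ge0_le vx (fun y vyx => dctau y (vv y vyx))) => y /vv /csgn[q q0 ->].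
    by rewrite mulr_ge0// ltW.
apply/negP => /eqP Fd0.
have dab : a <= d0 <= b by rewrite db andbT (le_trans ac)// ltW// (lt_trans cx).
apply: (@ln_norm_unbounded x d0 (L * (B / k)) `]x, d0[%classic dab Fd0).
- move=> d d_gt0; exists (d0 - Num.min d (d0 - x) / 2).
    have m0 : 0 < Num.min d (d0 - x) by rewrite lt_min d_gt0 subr_gt0.
    have m1 : Num.min d (d0 - x) <= d0 - x by rewrite ge_min lexx orbT.
    by rewrite /= in_itv/=; apply/andP; split; lra.
  have m0 : 0 < Num.min d (d0 - x) by rewrite lt_min d_gt0 subr_gt0.
  have m1 : Num.min d (d0 - x) <= d by rewrite ge_min lexx.
  by rewrite addrAC subrr add0r normrN gtr0_norm; lra.
- move=> w; rewrite /= in_itv/= => /andP[xw wd]; have wcd : c0 < w < d0 by rewrite wd (lt_trans cx).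
  by split; [have /andP[? ?] := sub _ wcd; rewrite !ltW|exact: Fn0].
move=> w; rewrite /= in_itv/= => /andP[xw wd]; rewrite distrC; apply: bound => //; first exact: ltW.
move=> v /andP[xv vw]; rewrite mulrBr subr_le0.
have vv y : x <= y <= v -> c0 < y < d0.
  by move=> /andP[xy yv]; rewrite (lt_le_trans cx)//= (le_lt_trans yv)// (le_lt_trans vw).
have dn y : x <= y <= v -> is_derive y (1:R) (fun y => - (c * tau y)) (- (c * (F y)^-1)).
  by move=> /vv /dctau; exact: is_derive_fN.
rewrite -lerN2; apply: (is_derive_ge0_le xv dn) => y /vv /csgn[q q0 ->].
by rewrite oppr_ge0 mulr_ge0_le0// ltW.
Qed.

Lemma measurable_zeros : measurable (zeros a b F).
Proof.
have mF : measurable_fun `]a, b[ F.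
  apply: open_continuous_measurable_fun; first exact: interval_open.
  by move=> x; rewrite inE/= in_itv/=; exact: (C1_continuous FC1).
have := mF (measurable_itv _) [set 0] (measurable_set1 _).
by congr measurable; rewrite eqEsubset; split=> x; rewrite /zeros/= in_itv/=.
Qed.

Hypothesis Finv : forward_invariant a b F.

(** A zero z in ]a, b] would produce a component enclosed by two zeros of F, of which
    [component_endpoints] forbids one whatever the sign of c F x. So F has no zero in ]a, b] and is
    negative by forward invariance. The whole interval is then the only component, and c <= 0 would
    give c F >= 0, incompatible with F a = 0. *)
Lemma cond_some_sign : cond_some a b F h p ->
  (forall z, a < z <= b -> F z < 0) /\ 0 < c.
Proof.
move=> [Z0 HC].
have Fn0 z : a < z <= b -> F z != 0.
  move=> /andP[az zb]; apply/eqP => Fz.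
  (* The zeros form a null set, hence do not fill ]a, z[. *)
  have [x0 /andP[ax0 x0z] Fx0] : exists2 x0 : R, a < x0 < z & F x0 != 0.
    apply: contrapT => H.
    have : (mu `]a, z[%classic <= mu (zeros a b F))%E.
      apply: le_measure; rewrite ?inE//; first exact: measurable_zeros.
      move=> x; rewrite /= in_itv/= => /andP[ax xz]; split.
        by rewrite ax (lt_le_trans xz).
      by apply: contrapT => /eqP Fx; apply: H; exists x => //; rewrite ax.
    by rewrite Z0 lebesgue_measure_itv/= lte_fin az -EFinD lee_fin leNgt subr_gt0 az.
  have [cF _ _] := FC1.
  have cFt : continuous (F \o clamp a b) by apply: continuous_clamp => //; exact: ltW.
  have FtE x : a <= x <= b -> (F \o clamp a b) x = F x by move=> xab; rewrite /= clamp_id.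
  have clZ : closed [set x | (F \o clamp a b) x = 0].
    rewrite (_ : [set x | _] = (F \o clamp a b) @^-1` [set 0]); last by [].
    by apply: closed_comp; [move=> x _; exact: cFt|exact: closed_eq].
  have cid (S : set R) : {within S, continuous (id : R -> R)}.
    by apply: continuous_subspaceT => x; exact: cvg_id.
  (* The zero nearest to [x0] on the left; the set of candidates contains a. *)
  have [c0 [ac0 c0x Fc0 Hc0]] : exists c0 : R, [/\ a <= c0, c0 < x0, F c0 = 0 &
      forall y, c0 < y <= x0 -> F y != 0].
    pose S : set R := `[a, x0]%classic `&` [set x | (F \o clamp a b) x = 0].
    have cS : compact S by apply: compact_closedI => //; exact: segment_compact.
    have S0 : S !=set0.
      by exists a; split; rewrite /= ?in_itv/= ?lexx ?(ltW ax0)// clamp_id ?lexx ?ltW.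
    have [m /set_mem [m1 m2] Hm] := compact_EVT_max S0 cS (@cid S).
    move: m1; rewrite /= in_itv/= => /andP[am mx].
    have mab : a <= m <= b by rewrite am (le_trans mx)// (le_trans _ zb)// ltW.
    have Fm : F m = 0 by rewrite -(FtE _ mab).
    exists m; split => //.
      by rewrite lt_neqAle mx andbT; apply/eqP => mE; move: Fx0; rewrite -mE Fm eqxx.
    move=> y /andP[my yx]; apply/eqP => Fy.
    have yab : a <= y <= b by rewrite (le_trans am (ltW my))/= (le_trans yx)// (le_trans _ zb)// ltW.
    have : y <= m.
      apply: Hm; apply/mem_set; split; first by rewrite /= in_itv/= yx andbT; case/andP : yab.
      by rewrite /mkset FtE.
    by rewrite leNgt my.
  (* The zero nearest to [x0] on the right; the set of candidates contains z. *)
  have [d0 [d0b x0d Fd0 Hd0]] : exists d0 : R, [/\ d0 <= b, x0 < d0, F d0 = 0 &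
      forall y, x0 <= y < d0 -> F y != 0].
    pose S : set R := `[x0, z]%classic `&` [set x | (F \o clamp a b) x = 0].
    have cS : compact S by apply: compact_closedI => //; exact: segment_compact.
    have S0 : S !=set0.
      by exists z; split; rewrite /= ?in_itv/= ?lexx ?(ltW x0z)// clamp_id ?zb ?ltW.
    have [m /set_mem [m1 m2] Hm] := compact_EVT_min S0 cS (@cid S).
    move: m1; rewrite /= in_itv/= => /andP[xm mz].
    have mab : a <= m <= b by rewrite (le_trans (ltW ax0))//= (le_trans mz).
    have Fm : F m = 0 by rewrite -(FtE _ mab).
    exists m; split => //; first by rewrite (le_trans mz).
      by rewrite lt_neqAle xm andbT; apply/eqP => mE; move: Fx0; rewrite mE Fm eqxx.
    move=> y /andP[xy ym]; apply/eqP => Fy.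
    have yab : a <= y <= b by rewrite (le_trans (ltW ax0))//= (le_trans (ltW ym))// (le_trans mz).
    have : m <= y.
      apply: Hm; apply/mem_set; split; first by rewrite /= in_itv/= xy/= (le_trans (ltW ym)).
      by rewrite /mkset FtE.
    by rewrite leNgt ym.
  have Fn y : c0 < y < d0 -> F y != 0.
    move=> /andP[cy yd]; have [yx|/ltW xy] := leP y x0.
      by apply: Hc0; rewrite cy.
    by apply: Hd0; rewrite xy.
  have x0cd : c0 < x0 < d0 by rewrite c0x.
  have CE : connected_component (`]a, b[ `\` zeros a b F) x0 = `]c0, d0[%classic.
    apply: connected_component_oo => //.
    - by move=> y /Fn /eqP Fy [_].
    - have [<-|ac0'] := eqVneq a c0; [by left|right; split => //].
      by rewrite lt_neqAle ac0' ac0 (lt_trans c0x)// (lt_le_trans x0d).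
    - have [->|db'] := eqVneq d0 b; [by left|right; split => //].
      by rewrite (lt_trans ax0)//= lt_neqAle db'.
  have iC : is_component (`]a, b[ `\` zeros a b F)
      (connected_component (`]a, b[ `\` zeros a b F) x0).
    exists x0 => //; split; first by rewrite /= in_itv/= ax0 (lt_le_trans x0z).
    by move=> [_ /eqP]; apply/negP.
  have [x Cx Hx] := HC _ iC.
  move: Cx Hx; rewrite CE /= in_itv/= => xcd /(component_endpoints ac0 d0b xcd Fn)[H1 H2].
  have [/H1|/ltW/H2] := leP 0 (c * F x); rewrite ?Fc0 ?Fd0 eqxx//.
have Fneg := nonzero_field_lt0 FC1 Finv Fn0.
split => //; have m1 : a < (a + b) / 2 < b by rewrite !midf_lt.
have Fn y : a < y < b -> F y != 0 by move=> /andP[ay yb]; rewrite lt_eqF// Fneg// ay ltW.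
have CE : connected_component (`]a, b[ `\` zeros a b F) ((a + b) / 2) = `]a, b[%classic.
  apply: connected_component_oo => //; [by move=> y /Fn /eqP Fy [_]|by left|by left].
have iC : is_component (`]a, b[ `\` zeros a b F)
    (connected_component (`]a, b[ `\` zeros a b F) ((a + b) / 2)).
  exists ((a + b) / 2) => //; split; first by rewrite /= in_itv.
  by move=> [_ /eqP]; apply/negP; exact: Fn.
have [x Cx Hx] := HC _ iC.
move: Cx Hx; rewrite CE /= in_itv/= => xab.
move=> /(component_endpoints (lexx a) (lexx b) xab Fn)[H1 _].
rewrite ltNge; apply/negP => cle0.
have : 0 <= c * F x.
  by rewrite mulr_le0// ltW// Fneg//; have /andP[-> /ltW ->] := xab.
by move=> /H1; rewrite Fa eqxx.
Qed.

End ComponentCondition.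

(** * The time coordinate *)

Section TimeCoordinate.
Context {R : realType}.
Notation mu := (@lebesgue_measure R).
Notation normc := ComplexField.Normc.normc.
Notation cRe := (complex.Re).
Implicit Types (x y z s t L M A e w : R).

Variables (a b p : R) (F : R -> R).
Hypotheses (ab : a < b) (FC1 : C1_on a b F).
Hypothesis Fneg : forall z, a < z <= b -> F z < 0.

(* [F] is extended past [b] by the constant [F b], so that the time coordinate maps ]a, +oo[ onto R. *)
Definition extended_field x := F (clamp a b x).
Notation Ft := extended_field.

Lemma extended_fieldE x : a <= x <= b -> Ft x = F x.
Proof. by move=> xab; rewrite /Ft clamp_id. Qed.

Lemma extended_field_continuous x : {for x, continuous Ft}.
Proof.
have [cF _ _] := FC1.
by apply: (@continuous_clamp _ _ _ _ F) => //; exact: ltW.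
Qed.

Lemma extended_field_lt0 x : a < x -> Ft x < 0.
Proof.
move=> ax; apply: Fneg; have /andP[_ ->] := clamp_itv x (ltW ab).
by rewrite andbT /clamp lt_max lt_min ax ab orbT.
Qed.

Lemma extended_field_neq0 x : a < x -> Ft x != 0.
Proof. by move=> /extended_field_lt0 /lt_eqF ->. Qed.

Lemma extended_field_inv_continuous x : a < x -> {for x, continuous (fun y => (Ft y)^-1)}.
Proof.
by move=> ax; apply: cvgV; [exact: extended_field_neq0|exact: extended_field_continuous].
Qed.

Lemma primitive_ray (k : R -> R) : (forall x, a < x -> {for x, continuous k}) ->
  exists K : R -> R, K b = 0 /\ forall x, a < x -> is_derive x (1:R) K (k x).
Proof.
move=> ck; have oD : open (`]a, +oo[%classic : set R) by exact: interval_open.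
have iD : is_interval (`]a, +oo[%classic : set R) by exact: interval_is_interval.
have cD x : `]a, +oo[%classic x -> {for x, continuous k}.
  by rewrite /= in_itv/= andbT; exact: ck.
have [K HK] := primitive_exists oD iD cD.
exists (fun x => K x - K b); split; first by rewrite subrr.
move=> x ax; have dK : is_derive x (1:R) K (k x) by apply: HK; rewrite /= in_itv/= ax.
by apply: (is_derive_cong (is_derive_fB dK (is_derive_cst (K b) x _))); rewrite subr0.
Qed.

Variable tau : R -> R.
Hypothesis taub : tau b = 0.
Hypothesis dtau : forall x, a < x -> is_derive x (1:R) tau (Ft x)^-1.

Lemma tau_MVT x y : a < x -> x <= y ->
  exists2 z : R, x <= z <= y & tau y - tau x = (Ft z)^-1 * (y - x).
Proof.
move=> ax xy; apply: (MVT_is_derive xy) => z /andP[xz _].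
by apply: dtau; exact: lt_le_trans xz.
Qed.

Lemma tau_decreasing x y : a < x -> x < y -> tau y < tau x.
Proof.
move=> ax xy; have [z /andP[xz _] E] := tau_MVT ax (ltW xy).
rewrite -subr_lt0 E nmulr_rlt0 ?subr_gt0// invr_lt0.
by apply: extended_field_lt0; exact: lt_le_trans xz.
Qed.

Lemma tau_nonincreasing x y : a < x -> x <= y -> tau y <= tau x.
Proof.
by move=> ax; rewrite le_eqVlt => /predU1P[->//|/(tau_decreasing ax)/ltW].
Qed.

Lemma tau_ge0 x : a < x <= b -> 0 <= tau x.
Proof. by move=> /andP[ax xb]; rewrite -taub; exact: tau_nonincreasing. Qed.

Lemma tau_inj x y : a < x -> a < y -> tau x = tau y -> x = y.
Proof.
move=> ax ay E; apply/eqP; rewrite eq_le !leNgt; apply/andP; split; apply/negP => H.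
  by have := tau_decreasing ay H; rewrite E ltxx.
by have := tau_decreasing ax H; rewrite E ltxx.
Qed.

Section Orbit.
Hypothesis Finv : forward_invariant a b F.

(** Along an orbit tau has derivative F(u) / F(u) = 1. *)
Lemma tau_flow x t : a < x < b -> 0 <= t -> tau (flow a b F t x) = tau x + t.
Proof.
move=> xab t0; pose u s := flow a b F s x.
have dd s : 0 <= s <= t -> is_derive s (1:R) (fun s => tau (u s) - (1 * s + 0)) ((fun=> 0) s).
  move=> /andP[s0 _]; have /andP[au ub] := flow_itv Finv xab s0.
  have du := @is_derive_fcomp R tau u s _ _ (dtau au) (flow_is_derive Finv xab s0).
  apply: (is_derive_cong (is_derive_fB du (is_derive_affine 1 0 s))).
  by rewrite extended_fieldE ?(ltW au) ?(ltW ub)// mulVf ?subrr// lt_eqF// Fneg// au ltW.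
have [z _ E] := MVT_is_derive t0 dd.
move: E; rewrite mul0r mulr0 !addr0 subr0 mul1r /u (flow0 Finv xab) => /eqP.
by rewrite subr_eq0 subr_eq => /eqP.
Qed.

(** Large values are reached along an orbit, which exists for all positive times. Very negative ones
    are reached beyond b, where the extended field is the constant F b and tau is affine. *)
Lemma tau_surjective s : exists2 x, a < x & tau x = s.
Proof.
have m1 : a < (a + b) / 2 < b by rewrite !midf_lt.
have [x0 ax0 x0s] : exists2 x0, a < x0 & s <= tau x0.
  pose t := Num.max 0 (s - tau ((a + b) / 2)).
  have t0 : 0 <= t by rewrite le_max lexx.
  exists (flow a b F t ((a + b) / 2)); first by have /andP[] := flow_itv Finv m1 t0.
  by rewrite tau_flow// -lerBlDl /t le_max lexx orbT.
have Fb : F b < 0 by apply: Fneg; rewrite ab lexx.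
have [x1 [ax1 x01 x1s]] : exists x1, [/\ a < x1, x0 <= x1 & tau x1 <= s].
  pose y := Num.max x0 (b + `|s * F b|).
  have by' : b <= y by rewrite /y le_max lerDl normr_ge0 orbT.
  exists y; split; [exact: lt_le_trans by'|by rewrite le_max lexx|].
  have [z /andP[bz zy] E] := tau_MVT ab by'.
  move: E; rewrite taub subr0 => ->.
  have -> : Ft z = F b by rewrite /Ft /clamp (min_idPr bz) (max_idPr (ltW ab)).
  rewrite mulrC ler_ndivrMr//.
  rewrite (le_trans (ler_norm _))// lerBrDl /y le_max lexx orbT//.
have [||x] := @IVT R tau x0 x1 s x01.
- apply: within_continuous_itv => z /andP[x0z _]; apply: is_derive_continuous (dtau _).
  exact: lt_le_trans x0z.
- by rewrite ge_min x1s orbT/= le_max x0s.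
by rewrite in_itv/= => /andP[x0x _] E; exists x => //; exact: lt_le_trans x0x.
Qed.

End Orbit.

Variable c : R.

(* In the time coordinate the integrand of condition (ii) is, up to a constant factor,
[|F|^-p exp (- p c tau)]. *)
Definition time_weight x := `|Ft x| `^ (- p) * expR (- p * c * tau x).
Notation w0 := time_weight.

Lemma time_weight_gt0 x : a < x -> 0 < w0 x.
Proof.
move=> ax; rewrite mulr_gt0 ?expR_gt0// powR_gt0// normr_gt0.
exact: extended_field_neq0.
Qed.

Lemma tau_continuous x : a < x -> {for x, continuous tau}.
Proof. by move=> ax; exact: is_derive_continuous (dtau ax). Qed.

Lemma time_weight_continuous x : a < x -> {for x, continuous w0}.
Proof.
move=> ax; apply: cvgM.
  have E y : a < y -> `|Ft y| `^ (- p) = expR (- p * ln `|Ft y|).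
    by move=> ay; rewrite expR_ln_powR// normr_gt0 extended_field_neq0.
  rewrite E//; apply: cvg_trans; first apply: near_eq_cvg.
    near=> y; rewrite [RHS]E//; near: y; exact: lt_nbhsr.
  apply: (continuous_comp (f := fun y => - p * ln `|Ft y|)); last exact: continuous_expR.
  apply: cvgM; first exact: cvg_cst.
  apply: (continuous_comp (f := fun y => `|Ft y|)).
    by apply: cvg_norm; exact: extended_field_continuous.
  by apply: continuous_ln; rewrite normr_gt0 extended_field_neq0.
apply: (continuous_comp (f := fun y => - p * c * tau y)); last exact: continuous_expR.
by apply: cvgM; [exact: cvg_cst|exact: tau_continuous].
Unshelve. all: by end_near. Qed.

Lemma time_weight_measurable : measurable_fun `]a, b] w0.
Proof.
apply: (@measurable_funS _ _ _ _ `]a, +oo[%classic) => //.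
  by apply: subset_itv; rewrite bnd_simp.
apply: open_continuous_measurable_fun; first exact: interval_open.
by move=> x; rewrite inE/= in_itv/= andbT; exact: time_weight_continuous.
Qed.

Lemma component_integrandE (h : R -> R[i]) x w : cRe (h a) = c -> a < x < b -> a < w < b ->
  expR (- p * oint x w (fun y => (derive1 F y + cRe (h a)) / F y)) = w0 w / w0 x.
Proof.
move=> hc xab wab.
have bet y : Num.min x w <= y <= Num.max x w -> a < y < b.
  move: xab wab => /andP[ax xb] /andP[aw wb]; rewrite ge_min le_max => /andP[h1 h2].
  by apply/andP; split; [case/orP : h1; exact: lt_le_trans|case/orP : h2 => ?; [exact: le_lt_trans xb|exact: le_lt_trans wb]].
rewrite (@oint_logE _ a b F h ab FC1 tau x w); last first.
  move=> y /bet yab; have /andP[ay yb] := yab; have aby : a <= y <= b by rewrite !ltW.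
  have Fy : F y != 0 by rewrite -extended_fieldE// extended_field_neq0.
  by split => //; have := dtau ay; rewrite extended_fieldE.
rewrite hc /w0; have [ax aw] : a < x /\ a < w by move: xab wab => /andP[-> _] /andP[-> _].
have [xcc wcc] : a <= x <= b /\ a <= w <= b.
  by move: xab wab => /andP[h1 h2] /andP[h3 h4]; rewrite !ltW.
have Fx : 0 < `|F x| by rewrite normr_gt0 -extended_fieldE// extended_field_neq0.
have Fw : 0 < `|F w| by rewrite normr_gt0 -extended_fieldE// extended_field_neq0.
rewrite !extended_fieldE// -!expR_ln_powR// -!expRD -expRN -expRD; congr expR; ring.
Qed.

Lemma component_integral_fin (h : R -> R[i]) x : cRe (h a) = c -> a < x < b ->
  (component_integral a F h p `]a, b[ x < +oo)%E <->
  (\int[mu]_(w in `]a, b[) (w0 w)%:E < +oo)%E.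
Proof.
move=> hc xab; have ax : a < x by case/andP : xab.
have w0x := time_weight_gt0 ax.
have mw : measurable_fun `]a, b[ (EFin \o w0).
  apply/measurable_EFinP; apply: measurable_funS time_weight_measurable => //.
  by apply: subset_itv; rewrite bnd_simp.
have -> : component_integral a F h p `]a, b[ x =
    ((w0 x)^-1%:E * \int[mu]_(w in `]a, b[) (w0 w)%:E)%E.
  rewrite -ge0_integralZl//; last 2 first.
  - move=> w; rewrite /= in_itv/= => /andP[aw _]; rewrite lee_fin ltW//; exact: time_weight_gt0.
  - by rewrite lee_fin invr_ge0 ltW.
  apply: eq_integral => w; rewrite inE/= in_itv/= => wab.
  by rewrite component_integrandE// mulrC.
split=> H; last by rewrite lte_mul_pinfty// lee_fin invr_ge0 ltW.
rewrite ltey; apply/eqP => E; move: H; rewrite E gt0_muley ?ltxx//.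
by rewrite lte_fin invr_gt0.
Qed.

Lemma component_full : (forall C, is_component (`]a, b[ `\` zeros a b F) C -> C = `]a, b[%classic).
Proof.
have Fn y : a < y < b -> F y != 0 by move=> /andP[ay yb]; rewrite lt_eqF// Fneg// ay ltW.
move=> C [z [+ _] ->]; rewrite /= in_itv/= => zab.
apply: connected_component_oo => //; [by move=> y /Fn /eqP Fy [_]|by left|by left].
Qed.

Lemma zeros_empty : zeros a b F = set0.
Proof.
rewrite -subset0 => x [/andP[ax xb] Fx].
by have := Fneg (z := x); rewrite ax ltW// Fx ltxx => /(_ isT).
Qed.

End TimeCoordinate.

(** * Necessity *)

Section PeriodicIntegrable.
Context {R : realType}.
Notation mu := (@lebesgue_measure R).
Notation normc := ComplexField.Normc.normc.
Notation cRe := (complex.Re).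
Implicit Types (x y z s t L M A e w : R).

Lemma ge0_integral_itv_split (f : R -> R) x y z : x <= y -> y <= z ->
  measurable_fun `[x, z] f -> (forall u, x <= u <= z -> 0 <= f u) ->
  (\int[mu]_(u in `[x, z]) (f u)%:E =
   \int[mu]_(u in `[x, y]) (f u)%:E + \int[mu]_(u in `[y, z]) (f u)%:E)%E.
Proof.
move=> xy yz mf f0.
have E : `[x, z]%classic = `[x, y]%classic `|` `]y, z]%classic.
  rewrite eqEsubset; split => u; rewrite /= !in_itv/=.
    by move=> /andP[xu uz]; have [uy|yu] := leP u y; [left; rewrite xu|right].
  by case=> /andP[h1 h2]; apply/andP; split=> //; [exact: le_trans yz|rewrite (le_trans xy)// ltW].
have mf' : measurable_fun `]y, z] f.
  by apply: measurable_funS mf => //; apply: subset_itv; rewrite bnd_simp.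
rewrite E ge0_integral_setU//.
- by rewrite (@integral_itv_obnd_cbnd _ y (BRight z) (EFin \o f))//; exact/measurable_EFinP.
- by rewrite -E; exact/measurable_EFinP.
- by rewrite -E => u; rewrite /= in_itv/= lee_fin; exact: f0.
apply/disj_setPS => u [] /=; rewrite !in_itv/= => /andP[_ uy] /andP[yu _].
by move: yu; rewrite ltNge uy.
Qed.

Lemma energy_itv_split p (f : R -> R[i]) x y z : x <= y -> y <= z ->
  cmeasurable `[x, z] f ->
  (energy `[x, z] p f = energy `[x, y] p f + energy `[y, z] p f)%E.
Proof.
move=> xy yz mf; apply: ge0_integral_itv_split => //.
  by case: mf; exact: measurable_normc_powR.
by move=> u _; exact: powR_ge0.
Qed.

Variables (a b p : R) (F : R -> R) (h : R -> R[i]).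
Hypotheses (ab : a < b) (p1 : 1 <= p) (FC1 : C1_on a b F).
Hypothesis Finv : forward_invariant a b F.
Hypothesis Fneg : forall z, a < z <= b -> F z < 0.
Hypothesis ch : ccontinuous_on `[a, b] h.
Variable M : R.
Hypothesis M0 : 0 <= M.
Hypothesis HM : forall x, a < x < b -> normc (h x - h a) <= M * `|F x|.
Let c := cRe (h a).
Hypothesis c0 : 0 < c.
Variable tau : R -> R.
Hypothesis taub : tau b = 0.
Hypothesis dtau : forall x, a < x -> is_derive x (1:R) tau (extended_field a b F x)^-1.
Notation Ft := (extended_field a b F).
Notation w0 := (time_weight a b p F tau c).
Let X := sobolev_star a b p%:E.
Let p0 : 0 < p. Proof. exact: lt_le_trans p1. Qed.

(** By the mean value theorem x - y = (tau y - tau x) |F z| for some z between. As ln |F| is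
    Lipschitz in tau, z can be exchanged for any v at the price of an exponential factor. For an
    orbit piece of one period, |F| is thus at least a fixed multiple of its length. *)
Lemma field_comparison L x y : 0 < L -> (forall x, a < x < b -> `|derive1 F x| <= L) ->
  a < y -> y <= x -> x < b -> forall v, y <= v <= x ->
  x - y <= (tau y - tau x) * expR (L * (tau y - tau x)) * `|F v|.
Proof.
move=> L0 HL ay yx xb v yvx.
have in_ab z : y <= z <= x -> a < z < b.
  by move=> /andP[yz zx]; rewrite (lt_le_trans ay)//= (le_lt_trans zx).
have FtE z : y <= z <= x -> Ft z = F z.
  by move=> /in_ab /andP[az zb]; rewrite extended_fieldE// !ltW.
have [z yzx E] := tau_MVT dtau ay yx.
have Fz : F z < 0 by apply: Fneg; have /andP[-> /ltW] := in_ab z yzx.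
have E' : x - y = (tau y - tau x) * `|F z|.
  move: E; rewrite FtE// => E; rewrite ltr0_norm//.
  have -> : tau y - tau x = - ((F z)^-1 * (x - y)) by rewrite -E opprB.
  by field; rewrite lt_eqF.
have lnF u v' : y <= u -> u <= v' -> v' <= x -> `|ln `|F v'| - ln `|F u| | <= L * (tau u - tau v').
  move=> yu uv vx; have := @ln_norm_lipschitz R a b F FC1 L HL (fun z => - tau z) u v' uv.
  have -> : - tau v' - - tau u = tau u - tau v' by ring.
  apply => q /andP[uq qv].
  have qyx : y <= q <= x by rewrite (le_trans yu)//= (le_trans qv).
  have Fq : F q < 0 by apply: Fneg; have /andP[-> /ltW] := in_ab q qyx.
  split; [exact: in_ab|by rewrite lt_eqF|].
  have aq : a < q by have /andP[] := in_ab q qyx.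
  have := is_derive_fN (dtau aq); rewrite FtE// => dN.
  by apply: (is_derive_cong dN); rewrite ltr0_norm// invrN.
have tnn u v' : y <= u -> u <= v' -> tau v' <= tau u.
  by move=> yu; apply: (tau_nonincreasing ab Fneg dtau); exact: lt_le_trans yu.
have zv : ln `|F z| - ln `|F v| <= L * (tau y - tau x).
  have /andP[yz zx] := yzx; have /andP[yv vx] := yvx.
  have [zv|/ltW vz] := leP z v.
    have := lnF z v yz zv vx; rewrite distrC => /(le_trans (ler_norm _)) /le_trans; apply.
    by rewrite ler_pM2l// lerB// tnn.
  have := lnF v z yv vz zx => /(le_trans (ler_norm _)) /le_trans; apply.
  by rewrite ler_pM2l// lerB// tnn.
rewrite E' -mulrA ler_wpM2l//.
  by rewrite subr_ge0 tnn.
have Fv : F v < 0 by apply: Fneg; have /andP[-> /ltW] := in_ab v yvx.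
have [nz nv] : 0 < `|F z| /\ 0 < `|F v| by rewrite !normr_gt0 !lt_eqF.
rewrite -[leLHS]lnK ?posrE// -[X in _ <= _ * X]lnK ?posrE// -expRD ler_expR.
by rewrite -lerBlDr.
Qed.

(** The Hoelder lower bound for the energy of a function with a given increment, with the constant 4
    in place of the sharp one. *)
Lemma energy_lower_bound (g : R -> R[i]) (f : R -> R[i]) y x (D E : R) :
  (forall x, a < x < b -> {for x, continuous (f : R -> R[i]^o)}) ->
  is_weak_derivative a b f g -> a < y -> y < x -> x < b -> 0 < D ->
  D <= normc (f x - f y) -> cmeasurable `[y, x] g ->
  (energy `[y, x] p g <= E%:E)%E -> (D / 4) `^ p * (x - y) `^ (1 - p) <= E.
Proof.
move=> cf fg ay yx xb D0 Df mg gE.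
have xy0 : 0 < x - y by rewrite subr_gt0.
have : 0 < D / 4 by rewrite divr_gt0.
have : D / 4 + D / 4 + (D / 4 + D / 4) = D by lra.
(* With this e the first summand 2 e (x - y) of the increment bound uses up half of D, and the other
   half remains for the energy. *)
move: (D / 4) => d hd d0; pose e := d / (x - y).
have e0 : 0 < e by rewrite divr_gt0.
have := weak_derivative_increment p1 cf fg ay (ltW yx) xb mg gE e0.
have -> : e * (x - y) = d by rewrite /e divfK// gt_eqF.
move=> H; have {}H : d <= e `^ (1 - p) * E by have := le_trans Df H; lra.
have ep : 0 < e `^ (1 - p) by rewrite powR_gt0.
move: H; rewrite [X in _ <= X]mulrC -ler_pdivrMr//; apply: le_trans.
rewrite -powRN opprB /e powRM ?invr_ge0 ?(ltW xy0) ?(ltW d0)//.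
have -> : d `^ p = d * d `^ (p - 1).
  by rewrite -{2}[d]powRr1 ?(ltW d0)// -powRD ?(gt_eqF d0) ?implybT// addrC subrK.
rewrite mulrA ler_wpM2l ?mulr_ge0 ?powR_ge0 ?(ltW d0)//.
by rewrite -powR_inv1 ?(ltW xy0)// -powRrM mulN1r opprB.
Qed.

(** On the piece [y (n + 1), y n], of length l, the weight is at most (l / T)^-p exp (- p c tau(y
    n)), so that its integral is at most a multiple of l^(1 - p) exp (- p c t n). The energy of the
    weak derivative is at least a multiple of the same quantity: the increment of f is at least a
    multiple of exp (- c t n), and its distribution over a length l costs l^(1 - p). The ratio C
    does not depend on n, so the pieces can be summed. *)
Lemma periodic_integrable (f : R -> R[i]) t y0 : X f -> 0 < t -> S_ a b F h t f = f ->
  a < y0 < b -> f y0 != 0 -> (\int[mu]_(w in `]a, b[) (w0 w)%:E < +oo)%E.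
Proof.
move=> Xf t0 Sf y0ab fy0; have [cf _ _ [g fg gp]] := sobolev_star_weak p1 Xf.
have cfi := ccontinuous_on_interior ab cf.
have [L L0 HL] := C1_derive_bound ab FC1.
have mg := weak_derivative_measurable fg.
pose y n := iter n (fun x => flow a b F t x) y0.
have yab n : a < y n < b.
  by elim: n => [//|n IH]; rewrite /y iterS; exact: (flow_itv Finv IH (ltW t0)).
have tauy n : tau (y n) = tau y0 + t *+ n.
  elim: n => [|n IH]; first by rewrite mulr0n addr0.
  by rewrite mulrSr addrA -IH; exact: (tau_flow Fneg dtau Finv (yab n) (ltW t0)).
have ydec n : y n.+1 < y n.
  rewrite ltNge; apply/negP => H; have /andP[an _] := yab n.
  have := tau_nonincreasing ab Fneg dtau an H.
  by rewrite !tauy mulrSr addrA gerDl leNgt t0.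
pose q n := normc (f (y n)).
pose I n := \int[mu]_(s in `[0, t]) cRe (h (flow a b F s (y n))).
have qE n : q n = expR (I n) * q n.+1.
  by rewrite /q -{1}Sf (S_interior _ _ _ _ (yab n)) ComplexField.Normc.normcM normc_h_.
have hb n : `|I n - c * t| <= M * (y n - y n.+1).
  have := normc_h_bound ab FC1 ch Finv M0 HM (yab n) (ltW t0).
  by rewrite -/(y n.+1) [`|y n.+1 - y n|]distrC [`|y n - _|]gtr0_norm// subr_gt0.
have qgt0 n : 0 < q n.
  elim: n => [|n IH].
    rewrite lt_neqAle normc_ge0 andbT eq_sym; apply/eqP => /normc_eq0 E.
    by move: fy0; rewrite -[y0]/(y 0%N) E eqxx.
  by rewrite -(pmulr_rgt0 _ (expR_gt0 (I n))) -qE.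
(* The deviations M (y n - y (n + 1)) of the exponents from c t telescope, to at most M (b - a) in
   all. *)
pose k0 := q 0%N * expR (- (M * (b - a))).
have k00 : 0 < k0 by rewrite mulr_gt0// expR_gt0.
have qlow n : k0 * expR (- (c * t) *+ n) <= q n.
  have H : q 0%N * expR (- (M * (y 0%N - y n))) * expR (- (c * t) *+ n) <= q n.
    elim: n => [|n IH]; first by rewrite mulr0n expR0 subrr mulr0 oppr0 expR0 !mulr1.
    rewrite -(ler_pM2l (expR_gt0 (I n))) -qE; apply: le_trans IH.
    rewrite -!mulrA mulrCA ler_pM2l// -!expRD ler_expR mulrSr.
    have := hb n; rewrite ler_norml => /andP[_ H].
    have -> : M * (y 0%N - y n.+1) = M * (y 0%N - y n) + M * (y n - y n.+1) by ring.
    by lra.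
  apply: le_trans H; rewrite ler_pM2r ?expR_gt0// ler_pM2l// ler_expR lerN2.
  rewrite ler_wpM2l//; have /andP[h1 _] := yab n; have /andP[_ h2] := yab 0%N.
  by rewrite lerB// ltW.
pose th := expR (- (c * t / 2)).
have th1 : th < 1 by rewrite /th expR_lt1 oppr_lt0 divr_gt0// mulr_gt0.
have ath0 : 0 < 1 - th by rewrite subr_gt0.
have yclose x : a < x -> exists n0, forall n, (n0 <= n)%N -> y n < x.
  move=> ax; exists (Num.truncn ((tau x - tau y0) / t)).+1 => n n0n.
  rewrite ltNge; apply/negP => H.
  have := tau_nonincreasing ab Fneg dtau ax H; rewrite tauy -lerBrDl leNgt => /negP; apply.
  rewrite -mulr_natr mulrC -ltr_pdivrMr//; apply: lt_le_trans (Num.Theory.truncnS_gt _) _.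
  by rewrite ler_nat.
(* From [n0] on the pieces are so short that each exponent [I n] is at least c t / 2. Then |f|
   shrinks by the factor [th] < 1 per step, and f(y n) - f(y (n + 1)) keeps the fraction 1 - [th] of
   |f(y n)|. *)
have [n0 Hn0] : exists n0, forall n, (n0 <= n)%N -> M * (y n - y n.+1) <= c * t / 2.
  pose d := c * t / 2 / (M + 1).
  have M10 : 0 < M + 1 by rewrite ltr_wpDl.
  have d0 : 0 < d by rewrite !divr_gt0// mulr_gt0.
  have [n0 H] := yclose (a + d) ltac:(by rewrite ltrDl).
  exists n0 => n /H yn; have /andP[h1 _] := yab n.+1.
  have yd : y n - y n.+1 <= d by lra.
  rewrite (le_trans (ler_wpM2l M0 yd))// /d mulrC mulrAC ler_pdivrMr//.
  by rewrite ler_wpM2l ?lerDl// ltW// divr_gt0// mulr_gt0.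
pose D n := (1 - th) * q n.
have D0 n : 0 < D n by rewrite mulr_gt0.
have Df n : (n0 <= n)%N -> D n <= normc (f (y n) - f (y n.+1)).
  move=> n0n; have qn : q n.+1 <= th * q n.
    have H1 : 0 <= - (c * t / 2) + I n.
      have := hb n; rewrite ler_norml => /andP[H _]; have := Hn0 n n0n.
      by move: H; set u := c * t; lra.
    have H2 : 1 <= th * expR (I n) by rewrite /th -expRD -[leLHS]expR0 ler_expR.
    by rewrite [X in _ * X]qE mulrA ler_peMl// ltW// qgt0.
  have H : q n <= normc (f (y n) - f (y n.+1)) + q n.+1.
    by rewrite /q -{1}[f (y n)](subrK (f (y n.+1))) le_normcD.
  by rewrite /D mulrBl mul1r; lra.
have tauy0 : 0 <= tau y0.
  by apply: (tau_ge0 ab Fneg taub dtau); have /andP[-> /ltW ->] := y0ab.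
pose T := t * expR (L * t).
have T0 : 0 < T by rewrite mulr_gt0// expR_gt0.
have tau_diff n : tau (y n.+1) - tau (y n) = t by rewrite !tauy mulrSr; ring.
(* T^p stems from |F| >= l / T, the exponential from tau(y n) = tau(y0) + t n, and the last factor
   from q n >= k0 exp (- c t n) in the lower bound for the increment, divided by 4. *)
pose C := T `^ p * expR (- p * c * tau y0) * (4 / ((1 - th) * k0)) `^ p.
have C0 : 0 <= C by rewrite !mulr_ge0 ?powR_ge0 ?expR_ge0.
have sub n : `[y n.+1, y n]%classic `<=` `[a, b]%classic.
  apply: subset_itv; rewrite bnd_simp.
    by have /andP[/ltW] := yab n.+1.
  by have /andP[_ /ltW] := yab n.
have mgn n : cmeasurable `[y n.+1, y n] g by exact: cmeasurableS (measurable_itv _) (sub n) mg.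
have enfin n : energy `[y n.+1, y n] p g \is a fin_num.
  rewrite ge0_fin_numE ?energy_ge0//; apply: le_lt_trans gp.
  exact: energyS (measurable_itv _) (measurable_itv _) (sub n) mg.
have step n : (n0 <= n)%N ->
    (\int[mu]_(w in `[y n.+1, y n]) (w0 w)%:E <= C%:E * energy `[y n.+1, y n] p g)%E.
  move=> n0n; set l := y n - y n.+1.
  have l0 : 0 < l by rewrite subr_gt0.
  have /andP[an _] := yab n.+1; have /andP[_ nb] := yab n.
  have E1 : (D n / 4) `^ p * l `^ (1 - p) <= fine (energy `[y n.+1, y n] p g).
    apply: (energy_lower_bound cfi fg an (ydec n) nb (D0 n) (Df n n0n) (mgn n)).
    by rewrite fineK.
  pose B := (l / T) `^ (- p) * expR (- p * c * tau (y n)).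
  have wB w : y n.+1 <= w <= y n -> w0 w <= B.
    move=> /[dup] wy /andP[wy1 wy2].
    have aw : a < w by exact: lt_le_trans wy1.
    have Fc := field_comparison L0 HL an (ltW (ydec n)) nb wy.
    rewrite tau_diff -/T -/l in Fc.
    have wab : a <= w <= b by rewrite (ltW aw)/= (le_trans wy2)// ltW.
    rewrite /time_weight extended_fieldE// /B; apply: ler_pM; rewrite ?powR_ge0 ?expR_ge0//.
      rewrite !powRN lef_pV2 ?posrE ?powR_gt0 ?divr_gt0//; last first.
        by rewrite normr_gt0 lt_eqF// Fneg// aw/=; case/andP : wab.
      apply: ge0_ler_powR; rewrite ?nnegrE ?(ltW p0) ?divr_ge0 ?(ltW l0) ?(ltW T0)//.
      by rewrite ler_pdivrMr// mulrC.
    rewrite ler_expR -!mulrA !mulNr lerN2 !mulrA ler_pM2l ?mulr_gt0//.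
    exact: (tau_nonincreasing ab Fneg dtau).
  have BE : B * l <= C * fine (energy `[y n.+1, y n] p g).
    apply: (@le_trans _ _ (C * ((D n / 4) `^ p * l `^ (1 - p)))); last by rewrite ler_wpM2l.
    have e1 : expR (- p * c * tau (y n)) = expR (- p * c * tau y0) * (expR (- (c * t) *+ n)) `^ p.
      rewrite tauy -expRM -expRD; congr expR.
      by rewrite -[t *+ n]mulr_natr -[_ *+ n]mulr_natr; ring.
    have e2 : (l / T) `^ (- p) * l = T `^ p * l `^ (1 - p).
      rewrite powRM ?invr_ge0 ?(ltW l0) ?(ltW T0)// -powR_inv1 ?(ltW T0)// -powRrM mulrNN mul1r.
      rewrite mulrAC mulrC -{2}[l]powRr1 ?(ltW l0)// -powRD; last by rewrite (gt_eqF l0) implybT.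
      by rewrite [- p + 1]addrC.
    have e3 : (expR (- (c * t) *+ n)) `^ p <= (4 / ((1 - th) * k0)) `^ p * (D n / 4) `^ p.
      rewrite -powRM; last 2 first.
      - by rewrite divr_ge0 ?ler0n// mulr_ge0 ?(ltW ath0) ?(ltW k00).
      - by rewrite divr_ge0 ?ler0n// (ltW (D0 n)).
      apply: ge0_ler_powR; rewrite ?nnegrE ?(ltW p0) ?expR_ge0//.
        by rewrite mulr_ge0 ?divr_ge0 ?(ltW (D0 n)) ?ler0n// mulr_ge0 ?(ltW ath0) ?(ltW k00).
      have -> : 4 / ((1 - th) * k0) * (D n / 4) = q n / k0.
        by rewrite /D; field; rewrite !gt_eqF.
      by rewrite ler_pdivlMr// mulrC.
    rewrite /B mulrAC e2 e1 /C.
    rewrite [leLHS](_ : _ = T `^ p * expR (- p * c * tau y0) * l `^ (1 - p) * (expR (- (c * t) *+ n)) `^ p); last by ring.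
    rewrite [leRHS](_ : _ = T `^ p * expR (- p * c * tau y0) * l `^ (1 - p) * ((4 / ((1 - th) * k0)) `^ p * (D n / 4) `^ p)); last by ring.
    by rewrite ler_wpM2l// !mulr_ge0 ?powR_ge0 ?expR_ge0.
  apply: (@le_trans _ _ (B%:E * mu `[y n.+1, y n]%classic)%E).
    have -> : (B%:E * mu `[y n.+1, y n]%classic = \int[mu]_(w in `[y n.+1, y n]) (cst B%:E w))%E.
      by rewrite integral_cst.
    apply: ge0_le_integral_nomeas => w; rewrite /= in_itv/= => wy; rewrite lee_fin; last exact: wB.
    by rewrite mulr_ge0 ?powR_ge0 ?expR_ge0.
  rewrite lebesgue_measure_itv/= lte_fin ydec -EFinD -EFinM -(fineK (enfin n)) -EFinM lee_fin.
  exact: BE.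
have mw (u v : R) : a < u -> measurable_fun `[u, v] w0.
  move=> au; apply: subspace_continuous_measurable_fun => //.
  apply: within_continuous_itv => z /andP[uz _].
  by have := time_weight_continuous ab FC1 Fneg dtau (lt_le_trans au uz).
have w0ge0 u : a < u -> 0 <= w0 u by move=> au; rewrite ltW// (time_weight_gt0 p ab Fneg).
have ymono n m : (n <= m)%N -> y m <= y n.
  elim: m => [|m IH]; first by rewrite leqn0 => /eqP ->.
  rewrite leq_eqVlt => /predU1P[->//|]; rewrite ltnS => /IH; apply: le_trans.
  exact: ltW.
have sum N : (\int[mu]_(w in `[y (n0 + N)%N, y n0]) (w0 w)%:E <=
    C%:E * energy `[y (n0 + N)%N, y n0] p g)%E.
  elim: N => [|N IH].
    by rewrite addn0 set_itv1 integral_set1 mule_ge0// ?lee_fin// energy_ge0.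
  have yN : y (n0 + N.+1)%N <= y (n0 + N)%N by rewrite addnS ltW.
  have yN0 : y (n0 + N)%N <= y n0 by apply: ymono; exact: leq_addr.
  have /andP[aN _] := yab (n0 + N.+1)%N; have /andP[_ nb] := yab n0.
  rewrite (ge0_integral_itv_split yN yN0); last 2 first.
  - exact: mw.
  - by move=> u /andP[yu _]; apply: w0ge0; exact: lt_le_trans yu.
  rewrite (energy_itv_split p yN yN0); last first.
    apply: cmeasurableS mg => //; apply: subset_itv; rewrite bnd_simp; exact: ltW.
  rewrite ge0_muleDr ?energy_ge0//; apply: leeD => //.
  by rewrite addnS; apply: step; exact: leq_addr.
have /andP[an0 nb0] := yab n0.
have Bfin : energy `[a, b] p g \is a fin_num by rewrite ge0_fin_numE ?energy_ge0.
have left : (\int[mu]_(w in `]a, y n0]) (w0 w)%:E <= (C * fine (energy `[a, b] p g))%:E)%E.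
  apply: ge0_integral_itv_exhaust => //.
  - apply: measurable_funS (time_weight_measurable p ab FC1 Fneg dtau c) => //.
    by apply: subset_itv; rewrite bnd_simp// ltW.
  - by move=> x /andP[ax _]; exact: w0ge0.
  move=> x /andP[ax xn]; have [N HN] := yclose x ax.
  have HNx : y (n0 + N)%N <= x by apply: ltW; apply: HN; exact: leq_addl.
  have /andP[aN _] := yab (n0 + N)%N.
  apply: (@le_trans _ _ (\int[mu]_(w in `[y (n0 + N)%N, y n0]) (w0 w)%:E)%E).
    rewrite (ge0_integral_itv_split HNx (ltW xn)); last 2 first.
    - exact: mw.
    - by move=> u /andP[yu _]; apply: w0ge0; exact: lt_le_trans yu.
    rewrite leeDr//; apply: integral_ge0 => u; rewrite /= in_itv/= => /andP[yu _].
    by rewrite lee_fin w0ge0//; exact: lt_le_trans yu.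
  apply: (le_trans (sum N)); rewrite [leRHS]EFinM fineK; last exact: Bfin.
  apply: lee_wpmul2l; rewrite ?lee_fin//.
  apply: energyS => //; apply: subset_itv; rewrite bnd_simp; exact: ltW.
(* This piece stays away from a, where the weight is continuous. *)
have right : (\int[mu]_(w in `[y n0, b]) (w0 w)%:E < +oo)%E.
  have : mu.-integrable `[y n0, b] (EFin \o w0).
    apply: integrable_continuous_itv => z /andP[uz _].
    by have := time_weight_continuous ab FC1 Fneg dtau (lt_le_trans an0 uz).
  move=> /integrableP[_]; apply: le_lt_trans; apply: ge0_le_integral_nomeas => u;
    rewrite /= in_itv/= => /andP[yu _]; rewrite lee_fin ?ler_norm// w0ge0//; exact: lt_le_trans yu.
apply: (@le_lt_trans _ _ (\int[mu]_(w in `]a, y n0]) (w0 w)%:E + \int[mu]_(w in `[y n0, b]) (w0 w)%:E)%E); last first.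
  by apply: lte_add_pinfty => //; apply: le_lt_trans left _; rewrite ltry.
rewrite integral_mkcond [X in (_ <= X + _)%E]integral_mkcond [X in (_ <= _ + X)%E]integral_mkcond.
rewrite -ge0_integralD//; last 4 first.
- by move=> u _; rewrite /patch; case: ifP => // /set_mem; rewrite /= in_itv/= => /andP[au _]; rewrite lee_fin w0ge0.
- apply/(measurable_restrictT _ _).1 => //; apply/measurable_EFinP.
  apply: measurable_funS (time_weight_measurable p ab FC1 Fneg dtau c) => //.
  by apply: subset_itv; rewrite bnd_simp// ltW.
- by move=> u _; rewrite /patch; case: ifP => // /set_mem; rewrite /= in_itv/= => /andP[au _]; rewrite lee_fin w0ge0//; exact: lt_le_trans au.
- by apply/(measurable_restrictT _ _).1 => //; apply/measurable_EFinP; exact: mw.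
apply: ge0_le_integral_nomeas => u _; rewrite /patch.
  by case: ifP => // /set_mem; rewrite /= in_itv/= => /andP[au _]; rewrite lee_fin w0ge0.
case: ifPn => [/set_mem|_].
  rewrite /= in_itv/= => /andP[au ub]; have w0u := w0ge0 u au.
  have [uy|/ltW yu] := leP u (y n0).
    rewrite ifT; last by rewrite inE/= in_itv/= au.
    by rewrite leeDl//; case: ifP; rewrite ?lee_fin.
  rewrite [X in (_ <= _ + X)%E]ifT; last by rewrite inE/= in_itv/= yu ltW.
  by rewrite leeDr//; case: ifP; rewrite ?lee_fin.
by apply: adde_ge0; case: ifP => // /set_mem; rewrite /= in_itv/= => /andP[au _]; rewrite lee_fin w0ge0//; exact: lt_le_trans au.
Qed.

End PeriodicIntegrable.

(** * From chaos to condition (ii) *)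

Section Necessity.
Context {R : realType}.
Notation normc := ComplexField.Normc.normc.
Variables (a b p : R) (F : R -> R) (h : R -> R[i]).
Hypotheses (ab : a < b) (p1 : 1 <= p) (FC1 : C1_on a b F).
Hypothesis Finv : forward_invariant a b F.
Hypothesis ch : ccontinuous_on `[a, b] h.
Variable M : R.
Hypothesis M0 : 0 <= M.
Hypothesis HM : forall x, a < x < b -> normc (h x - h a) <= M * `|F x|.

Lemma chaotic_cond_all :
  chaotic (sobolev_star a b p%:E) (sobolev_norm a b p%:E) (S_ a b F h) ->
  cond_all a b F h p.
Proof.
move=> [hyp dense].
have c0 := hypercyclic_gt0 ab p1 FC1 Finv ch M0 HM hyp.
have Fneg := nonzero_field_lt0 FC1 Finv (periodic_nonzero_field ab p1 FC1 Finv ch M0 HM c0 dense).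
have [tau [taub dtau]] := primitive_ray b (extended_field_inv_continuous ab FC1 Fneg).
pose y0 := (a + b) / 2.
have y0ab : a < y0 < b by rewrite !midf_lt.
pose C := 2 * (b - a + 1).
have C0 : 0 < C by rewrite mulr_gt0// addr_gt0// subr_gt0.
(* The supremum error is then at most half of y0 - a, so that the periodic function found near x - a
   does not vanish at [y0]. *)
pose e := (y0 - a) / (2 * C).
have ya0 : 0 < y0 - a by case/andP : y0ab => ? _; rewrite subr_gt0.
have e0 : 0 < e by rewrite divr_gt0// mulr_gt0.
have [f [t [Xf t0 Sf Hf]]] := periodic_dense_near ab p1 1 e0 dense.
have fy0 : f y0 != 0.
  apply/eqP => E; have /andP[/ltW ay /ltW yb] := y0ab.
  have := Hf y0; rewrite ay yb E sub0r normcN normc_real mul1r gtr0_norm//.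
  rewrite -/C /e => /(_ isT); rewrite leNgt => /negP; apply.
  have -> : C * ((y0 - a) / (2 * C)) = (y0 - a) / 2 by field; rewrite gt_eqF.
  by lra.
have int := periodic_integrable ab p1 FC1 Finv Fneg ch M0 HM c0 taub dtau Xf t0 Sf y0ab fy0.
split; first by rewrite (zeros_empty Fneg) measure0.
move=> D /(component_full Fneg) -> x; rewrite /= in_itv/= => xab.
exact/(component_integral_fin p ab FC1 Fneg dtau (erefl _) xab).
Qed.

Lemma cond_all_some : cond_all a b F h p -> cond_some a b F h p.
Proof.
move=> [z0 H]; split => // D /[dup] CD [z Az E]; exists z; last apply: H => //.
  by rewrite E; exact: connected_component_refl.
by rewrite E; exact: connected_component_refl.
Qed.

End Necessity.

(** * Differentiation of complex-valued functions *)

Section ComplexDerivative.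
Context {R : realType}.
Notation normc := ComplexField.Normc.normc.
Notation cRe := (complex.Re).
Notation cIm := (complex.Im).
Implicit Types (f g : R -> R[i]) (x : R) (z w : R[i]).

Lemma complex_ReD z w : cRe (z + w) = cRe z + cRe w.
Proof. by case: z w => [? ?] [? ?]. Qed.

Lemma complex_ImD z w : cIm (z + w) = cIm z + cIm w.
Proof. by case: z w => [? ?] [? ?]. Qed.

Lemma complex_ReM z w : cRe (z * w) = cRe z * cRe w - cIm z * cIm w.
Proof. by case: z w => [? ?] [? ?]. Qed.

Lemma complex_ImM z w : cIm (z * w) = cRe z * cIm w + cIm z * cRe w.
Proof. by case: z w => [? ?] [? ?]. Qed.

Lemma continuous_at_ext (T : topologicalType) (u v : R -> T) x : u =1 v ->
  {for x, continuous u} -> {for x, continuous v}.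
Proof. by move=> /funext ->. Qed.

Definition ccontinuous_at f x := {for x, continuous (f : R -> R[i]^o)}.

Lemma ccontinuous_atP f x : ccontinuous_at f x <->
  {for x, continuous (fun y => cRe (f y))} /\ {for x, continuous (fun y => cIm (f y))}.
Proof. exact: cvg_complexP. Qed.

Lemma ccontinuous_atD f g x : ccontinuous_at f x -> ccontinuous_at g x ->
  ccontinuous_at (fun y => f y + g y) x.
Proof.
move=> /ccontinuous_atP[fr fi] /ccontinuous_atP[gr gi]; apply/ccontinuous_atP; split.
  by apply: (continuous_at_ext (u := fun y => cRe (f y) + cRe (g y))) => [y|]; [rewrite complex_ReD|exact: cvgD].
by apply: (continuous_at_ext (u := fun y => cIm (f y) + cIm (g y))) => [y|]; [rewrite complex_ImD|exact: cvgD].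
Qed.

Lemma ccontinuous_atM f g x : ccontinuous_at f x -> ccontinuous_at g x ->
  ccontinuous_at (fun y => f y * g y) x.
Proof.
move=> /ccontinuous_atP[fr fi] /ccontinuous_atP[gr gi]; apply/ccontinuous_atP; split.
  apply: (continuous_at_ext (u := fun y => cRe (f y) * cRe (g y) - cIm (f y) * cIm (g y))) => [y|].
    by rewrite complex_ReM.
  by apply: cvgB; exact: cvgM.
apply: (continuous_at_ext (u := fun y => cRe (f y) * cIm (g y) + cIm (f y) * cRe (g y))) => [y|].
  by rewrite complex_ImM.
by apply: cvgD; exact: cvgM.
Qed.

Lemma ccontinuous_at_real (u : R -> R) x : {for x, continuous u} ->
  ccontinuous_at (fun y => (u y)%:C) x.
Proof. by move=> cu; apply/ccontinuous_atP; split => //; exact: cvg_cst. Qed.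

Lemma ccontinuous_atB f g x : ccontinuous_at f x -> ccontinuous_at g x ->
  ccontinuous_at (fun y => f y - g y) x.
Proof.
move=> /ccontinuous_atP[fr fi] /ccontinuous_atP[gr gi]; apply/ccontinuous_atP; split.
  by apply: (continuous_at_ext (u := fun y => cRe (f y) - cRe (g y))) => [y|]; [rewrite complex_ReB|exact: cvgB].
by apply: (continuous_at_ext (u := fun y => cIm (f y) - cIm (g y))) => [y|]; [rewrite complex_ImB|exact: cvgB].
Qed.

Lemma ccontinuous_at_comp f (u : R -> R) x : ccontinuous_at f (u x) -> {for x, continuous u} ->
  ccontinuous_at (fun y => f (u y)) x.
Proof. by move=> cf cu; exact: (@continuous_comp _ _ _ u (f : R -> R[i]^o)). Qed.

Lemma ccontinuous_at_near f g x : (\near x, f x = g x) -> ccontinuous_at f x -> ccontinuous_at g x.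
Proof.
move=> fg cf; rewrite /ccontinuous_at /prop_for /continuous_at -(nbhs_singleton fg).
by apply: cvg_trans cf; exact: near_eq_cvg.
Qed.

Definition is_cderive f x (d : R[i]) :=
  is_derive x (1:R) (fun y => cRe (f y)) (cRe d) /\
  is_derive x (1:R) (fun y => cIm (f y)) (cIm d).

Lemma is_cderive_continuous f x d : is_cderive f x d -> ccontinuous_at f x.
Proof.
by move=> [dr di]; apply/ccontinuous_atP; split; [exact: is_derive_continuous dr|exact: is_derive_continuous di].
Qed.

Lemma is_cderive_cong f x d e : is_cderive f x d -> d = e -> is_cderive f x e.
Proof. by move=> ? <-. Qed.

Lemma is_cderive_near f g x d : (\near x, f x = g x) -> is_cderive f x d -> is_cderive g x d.
Proof.
move=> fg [dr di]; split.
  by apply: is_derive_near dr; apply: filterS fg => y ->.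
by apply: is_derive_near di; apply: filterS fg => y ->.
Qed.

Lemma is_cderive_cst z x : is_cderive (fun=> z) x 0.
Proof. by split; exact: is_derive_cst. Qed.

Lemma is_cderiveD f g x d e : is_cderive f x d -> is_cderive g x e ->
  is_cderive (fun y => f y + g y) x (d + e).
Proof.
move=> [fr fi] [gr gi]; split.
  apply: (is_derive_ext (f := fun y => cRe (f y) + cRe (g y))) => [y|]; first by rewrite complex_ReD.
  by rewrite complex_ReD; exact: is_derive_fD fr gr.
apply: (is_derive_ext (f := fun y => cIm (f y) + cIm (g y))) => [y|]; first by rewrite complex_ImD.
by rewrite complex_ImD; exact: is_derive_fD fi gi.
Qed.

Lemma is_cderive_sum (n : nat) (f f' : nat -> R -> R[i]) x :
  (forall j, is_cderive (f j) x (f' j x)) ->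
  is_cderive (fun y => \sum_(j < n) f j y) x (\sum_(j < n) f' j x).
Proof.
move=> df; elim: n => [|n IH].
  rewrite big_ord0; under eq_fun do rewrite big_ord0.
  exact: is_cderive_cst.
rewrite big_ord_recr/=; under eq_fun do rewrite big_ord_recr/=.
exact: is_cderiveD.
Qed.

Lemma ccontinuous_at_sum (n : nat) (f : nat -> R -> R[i]) x :
  (forall j, ccontinuous_at (f j) x) -> ccontinuous_at (fun y => \sum_(j < n) f j y) x.
Proof.
move=> df; elim: n => [|n IH].
  have -> : (fun y => \sum_(j < 0) f j y) = (fun=> 0) by apply/funext => y; rewrite big_ord0.
  exact: cvg_cst.
have -> : (fun y => \sum_(j < n.+1) f j y) = (fun y => \sum_(j < n) f j y + f n y).
  by apply/funext => y; rewrite big_ord_recr.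
exact: ccontinuous_atD IH (df n).
Qed.

Lemma is_cderiveM f g x d e : is_cderive f x d -> is_cderive g x e ->
  is_cderive (fun y => f y * g y) x (d * g x + f x * e).
Proof.
move=> [fr fi] [gr gi]; split.
  apply: (is_derive_ext (f := fun y => cRe (f y) * cRe (g y) - cIm (f y) * cIm (g y))) => [y|].
    by rewrite complex_ReM.
  apply: (is_derive_cong (is_derive_fB (is_derive_fM fr gr) (is_derive_fM fi gi))).
  by rewrite complex_ReD !complex_ReM; ring.
apply: (is_derive_ext (f := fun y => cRe (f y) * cIm (g y) + cIm (f y) * cRe (g y))) => [y|].
  by rewrite complex_ImM.
apply: (is_derive_cong (is_derive_fD (is_derive_fM fr gi) (is_derive_fM fi gr))).
by rewrite complex_ImD !complex_ImM; ring.
Qed.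

Lemma is_cderive_real (u : R -> R) x d : is_derive x (1:R) u d ->
  is_cderive (fun y => (u y)%:C) x d%:C.
Proof. by move=> du; split => //; exact: is_derive_cst. Qed.

Lemma is_cderive_comp f (u : R -> R) x d e : is_cderive f (u x) d -> is_derive x (1:R) u e ->
  is_cderive (fun y => f (u y)) x (d * e%:C).
Proof.
move=> [fr fi] du; split.
  apply: (is_derive_cong (@is_derive_fcomp R (fun y => cRe (f y)) u x _ _ fr du)).
  by rewrite complex_ReM/= mulr0 subr0.
apply: (is_derive_cong (@is_derive_fcomp R (fun y => cIm (f y)) u x _ _ fi du)).
by rewrite complex_ImM/= mulr0 add0r.
Qed.

Lemma cexpD z w : cexp (z + w) = cexp z * cexp w.
Proof.
rewrite /cexp complex_ReD complex_ImD expRD cosD sinD.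
by apply/eqP; rewrite eq_complex; apply/andP; split; apply/eqP;
  rewrite !(complex_ReM, complex_ImM)/=; ring.
Qed.

Lemma cexp0 : cexp (0 : R[i]) = 1.
Proof. by rewrite /cexp/= expR0 cos0 sin0 mul1r. Qed.

Lemma is_cderive_cexp f x d : is_cderive f x d ->
  is_cderive (fun y => cexp (f y)) x (d * cexp (f x)).
Proof.
move=> [fr fi].
have de := @is_derive_fcomp R expR _ x _ _ (is_derive_expR (cRe (f x))) fr.
have dc := @is_derive_fcomp R cos _ x _ _ (is_derive_cos (cIm (f x))) fi.
have ds := @is_derive_fcomp R sin _ x _ _ (is_derive_sin (cIm (f x))) fi.
split.
  apply: (is_derive_ext (f := fun y => expR (cRe (f y)) * cos (cIm (f y)))) => [y|].
    by rewrite /cexp complex_ReM/= mul0r subr0.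
  apply: (is_derive_cong (is_derive_fM de dc)).
  by rewrite /cexp !(complex_ReM, complex_ImM)/=; ring.
apply: (is_derive_ext (f := fun y => expR (cRe (f y)) * sin (cIm (f y)))) => [y|].
  by rewrite /cexp complex_ImM/= mul0r addr0.
apply: (is_derive_cong (is_derive_fM de ds)).
by rewrite /cexp !(complex_ReM, complex_ImM)/=; ring.
Qed.

Lemma normc_continuous f x : ccontinuous_at f x -> {for x, continuous (fun y => normc (f y))}.
Proof.
move=> cf; apply/cvgrPdist_lt => e e0; have [r r0 H] := continuous_normc_near cf e0.
apply/nbhs_ballP; exists r => // y /H; apply: le_lt_trans.
have T u v : normc u <= normc (u - v) + normc v :> R.
  by rewrite -{1}[u](subrK v) le_normcD.
have := T (f x) (f y); have := T (f y) (f x).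
rewrite -[normc (f y - f x)]normcN opprB ler_norml; lra.
Qed.

Lemma ccontinuous_bounded f (x y : R) : (forall s : R, x <= s <= y -> ccontinuous_at f s) ->
  exists2 B : R, 0 <= B & forall s : R, x <= s <= y -> normc (f s) <= B.
Proof.
move=> cf; have [xy|yx] := leP x y; last first.
  by exists 0 => // s /andP[xs sy]; have := le_trans xs sy; rewrite leNgt yx.
have [] := @EVT_max R (fun s => normc (f s)) x y xy.
  by apply: within_continuous_itv => s sxy; exact: normc_continuous (cf s sxy).
move=> c _ H; exists (normc (f c)); first exact: normc_ge0.
by move=> s sxy; apply: H; rewrite in_itv.
Qed.

End ComplexDerivative.

(** * Functions of the time coordinate *)

Section OrbitFunctions.
Context {R : realType}.
Notation normc := ComplexField.Normc.normc.
Notation cRe := (complex.Re).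
Notation cIm := (complex.Im).
Implicit Types (x y s t B : R) (v : R -> R[i]).

Lemma cvg_right_ccontinuous (a b : R) (f : R -> R[i]) : a < b -> ccontinuous_on `[a, b] f <->
  [/\ forall x, a < x < b -> ccontinuous_at f x, (f : R -> R[i]^o) @ a^'+ --> (f a : R[i]^o) &
      (f : R -> R[i]^o) @ b^'- --> (f b : R[i]^o)].
Proof.
move=> ab; split.
  move=> /[dup] cf /ccontinuous_onP[].
  move=> /(continuous_within_itvP _ ab)[_ r1 r2] /(continuous_within_itvP _ ab)[_ i1 i2].
  split; [exact: ccontinuous_on_interior|exact/cvg_complexP|exact/cvg_complexP].
move=> [cf /cvg_complexP[r1 i1] /cvg_complexP[r2 i2]]; apply/ccontinuous_onP.
split; apply/(continuous_within_itvP _ ab); split => // x; rewrite in_itv/= => /cf;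
  by move=> /ccontinuous_atP[].
Qed.

(** The limits that define [cont_rep] at the ends see only interior values, so they are the end
    values of any continuous f agreeing with g inside. *)
Lemma cont_rep_eq (a b : R) (f g : R -> R[i]) : a < b -> ccontinuous_on `[a, b] f ->
  (forall x, ~~ (a <= x <= b) -> f x = 0) -> (forall x, a < x < b -> g x = f x) ->
  cont_rep a b g = f.
Proof.
move=> ab /(cvg_right_ccontinuous _ ab)[_ fa fb] f0 gf; apply/funext => x; rewrite /cont_rep.
case: ifPn => [/gf//|xab]; case: eqVneq => [->|xa].
  suff H : (g : R -> R[i]^o) @ a^'+ --> (f a : R[i]^o) by exact: (cvg_lim (@norm_hausdorff _ R[i]^o) H).
  apply: cvg_trans fa; apply: near_eq_cvg; near=> y.
  have ay : a < y by near: y; exact: nbhs_right_gt.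
  have yb : y < b by near: y; exact: nbhs_right_lt.
  by apply/esym/gf; rewrite ay.
case: eqVneq => [->|xb].
  suff H : (g : R -> R[i]^o) @ b^'- --> (f b : R[i]^o) by exact: (cvg_lim (@norm_hausdorff _ R[i]^o) H).
  apply: cvg_trans fb; apply: near_eq_cvg; near=> y.
  have ay : a < y by near: y; exact: nbhs_left_gt.
  have yb : y < b by near: y; exact: nbhs_left_lt.
  by apply/esym/gf; rewrite ay.
by rewrite f0//; apply: contra xab; rewrite !le_eqVlt (negbTE xb) [a == x]eq_sym (negbTE xa).
Unshelve. all: by end_near. Qed.

Variables (a b : R) (F : R -> R) (h : R -> R[i]).
Hypotheses (ab : a < b) (FC1 : C1_on a b F).
Hypothesis Finv : forward_invariant a b F.
Hypothesis Fneg : forall z, a < z <= b -> F z < 0.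
Hypothesis ch : ccontinuous_on `[a, b] h.
Variable M : R.
Hypothesis M0 : 0 <= M.
Hypothesis HM : forall x, a < x < b -> normc (h x - h a) <= M * `|F x|.
Let c := cRe (h a).
Hypothesis c0 : 0 < c.
Variable tau : R -> R.
Hypothesis taub : tau b = 0.
Hypothesis dtau : forall x, a < x -> is_derive x (1:R) tau (extended_field a b F x)^-1.
Notation Ft := (extended_field a b F).
Let ht x := h (clamp a b x).

Let cht x : ccontinuous_at ht x.
Proof. exact: (@ccontinuous_clamp _ _ _ ab h ch x). Qed.

Lemma weight_primitive : exists A : R -> R[i], A b = 0 /\
  forall x, a < x -> is_cderive A x (h (clamp a b x) * ((Ft x)^-1)%:C).
Proof.
have cF x : a < x -> ccontinuous_at (fun y => ht y * ((Ft y)^-1)%:C) x.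
  move=> ax; apply: ccontinuous_atM => //; apply: ccontinuous_at_real.
  exact: (extended_field_inv_continuous ab FC1 Fneg ax).
have [A1 [A1b dA1]] := primitive_ray b (fun x ax => (iffLR (ccontinuous_atP _ _) (cF x ax)).1).
have [A2 [A2b dA2]] := primitive_ray b (fun x ax => (iffLR (ccontinuous_atP _ _) (cF x ax)).2).
exists (fun x => A1 x +i* A2 x); split; first by rewrite A1b A2b.
by move=> x ax; split; [exact: dA1|exact: dA2].
Qed.

Variable A : R -> R[i].
Hypothesis Ab : A b = 0.
Hypothesis dA : forall x, a < x -> is_cderive A x (h (clamp a b x) * ((Ft x)^-1)%:C).

Definition orbit_factor x := cexp (- A x).
Notation Ei := orbit_factor.

(** A along the orbit has derivative (h / F) F = h, so the exponent defining h_t(x) is the increment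
    of A from x to the flowed point. *)
Lemma orbit_factor_flow x t : a < x < b -> 0 <= t ->
  h_ a b F h t x * Ei (flow a b F t x) = Ei x.
Proof.
move=> xab t0; rewrite /h_ /Ei -cexpD; congr cexp.
suff -> : cint `[0, t] (fun s => h (flow a b F s x)) = A (flow a b F t x) - A x by ring.
pose u s := flow a b F s x.
have dAu s : 0 <= s <= t -> is_cderive (fun r => A (u r)) s (h (u s)).
  move=> /andP[s0 _]; have /andP[au ub] := flow_itv Finv xab s0.
  apply: is_cderive_cong (@is_cderive_comp R A u s _ _ (dA au) (flow_is_derive Finv xab s0)) _.
  rewrite clamp_id ?(ltW au) ?(ltW ub)// extended_fieldE ?(ltW au) ?(ltW ub)//.
  by rewrite -mulrA -rmorphM/= mulVf ?rmorph1 ?mulr1// lt_eqF// Fneg// au ltW.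
have cr s : 0 <= s <= t -> {for s, continuous (fun s => cRe (h (u s)))}.
  by move=> /andP[s0 _]; have [] := cRe_h_flow_continuous ab ch Finv xab s0.
have ci s : 0 <= s <= t -> {for s, continuous (fun s => cIm (h (u s)))}.
  by move=> /andP[s0 _]; have [] := cRe_h_flow_continuous ab ch Finv xab s0.
have dr s (st : 0 <= s <= t) := (dAu s st).1.
have di s (st : 0 <= s <= t) := (dAu s st).2.
apply/eqP; rewrite eq_complex /cint complex_ReB complex_ImB; apply/andP; split; apply/eqP.
  by rewrite [LHS](FTC2 t0 dr cr) /u (flow0 Finv xab).
by rewrite [LHS](FTC2 t0 di ci) /u (flow0 Finv xab).
Qed.

(** Re A - c tau vanishes at b, and its derivative (Re h - c) / F is bounded by M. *)
Lemma normc_orbit_factor x : a < x <= b ->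
  normc (Ei x) <= expR (M * (b - a)) * expR (- (c * tau x)).
Proof.
move=> /andP[ax xb]; rewrite /Ei normc_cexp -expRD ler_expR.
have -> : cRe (- A x) = - cRe (A x) by case: (A x).
have [->|xNb] := eqVneq x b.
  have -> : cRe (A b) = 0 by rewrite Ab.
  by rewrite taub mulr0 !oppr0 addr0 mulr_ge0// subr_ge0 ltW.
have {}xb : x < b by rewrite lt_neqAle xNb.
pose D y := cRe (A y) - c * tau y.
have dD y : a < y -> is_derive y (1:R) D ((cRe (ht y) - c) * (Ft y)^-1).
  move=> ay; apply: (is_derive_cong (is_derive_fB (dA ay).1 (is_derive_fZ c (dtau ay)))).
  by rewrite complex_ReM/= mulr0 subr0 -/(ht y) mulrBl.
have [|| y] := @MVT R D (fun y => (cRe (ht y) - c) * (Ft y)^-1) x b xb.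
- by move=> y; rewrite in_itv/= => /andP[xy _]; apply: dD; exact: lt_trans xy.
- apply: within_continuous_itv => y /andP[xy _]; apply: is_derive_continuous (dD y _).
  exact: lt_le_trans xy.
rewrite in_itv/= => /andP[xy yb]; have ay := lt_trans ax xy.
have yab : a < y < b by rewrite ay.
have A0 : cRe (A b) = 0 by rewrite Ab.
rewrite /D taub A0 mulr0 subr0 sub0r opprB => E.
suff : `|c * tau x - cRe (A x)| <= M * (b - a) by rewrite ler_norml => /andP[_]; lra.
rewrite E normrM ler_pM//; last by rewrite ger0_norm ?subr_ge0 ?(ltW xb)// lerD2l lerN2 ltW.
rewrite normrM normfV ler_pdivrMr ?normr_gt0 ?extended_field_neq0//.
rewrite /ht clamp_id ?extended_fieldE ?(ltW ay) ?(ltW yb)//.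
exact: cRe_weight_bound HM y yab.
Qed.

(* The semigroup acts on these functions by translation of [v], see [S_orbit_fun]. *)
Definition orbit_fun v x := if a < x <= b then v (tau x) * Ei x else 0.
(** The derivative of [orbit_fun v] on the open interval when v' is that of v: tau' = 1 / F and the
    factor exp (- A) has logarithmic derivative - h / F. *)
Definition orbit_deriv v v' x := (v' (tau x) - h (clamp a b x) * v (tau x)) * Ei x * ((Ft x)^-1)%:C.

Lemma orbit_factor_cderive x : a < x ->
  is_cderive Ei x (- (h (clamp a b x) * ((Ft x)^-1)%:C) * Ei x).
Proof.
move=> ax; apply: is_cderive_cexp; have [dr di] := dA ax; split.
  apply: (is_derive_ext (f := fun y => - cRe (A y))) => [y|]; first by case: (A y).
  by apply: (is_derive_cong (is_derive_fN dr)); case: (_ * _).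
apply: (is_derive_ext (f := fun y => - cIm (A y))) => [y|]; first by case: (A y).
by apply: (is_derive_cong (is_derive_fN di)); case: (_ * _).
Qed.

Lemma orbit_product_cderive v v' x : a < x -> is_cderive v (tau x) (v' (tau x)) ->
  is_cderive (fun y => v (tau y) * Ei y) x (orbit_deriv v v' x).
Proof.
move=> ax dv; apply: is_cderive_cong (is_cderiveM (@is_cderive_comp R v tau x _ _ dv (dtau ax)) (orbit_factor_cderive ax)) _.
by rewrite /orbit_deriv; ring.
Qed.

Lemma orbit_fun_near v x : a < x < b -> \near x, v (tau x) * Ei x = orbit_fun v x.
Proof.
move=> /andP[ax xb]; near=> y; rewrite /orbit_fun ifT//; apply/andP; split.
  by near: y; exact: lt_nbhsr.
by apply/ltW; near: y; exact: lt_nbhsl.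
Unshelve. all: by end_near. Qed.

Lemma orbit_fun_cderive v v' x : a < x < b -> is_cderive v (tau x) (v' (tau x)) ->
  is_cderive (orbit_fun v) x (orbit_deriv v v' x).
Proof.
move=> /[dup] xab /andP[ax _] dv.
exact: is_cderive_near (orbit_fun_near v xab) (orbit_product_cderive ax dv).
Qed.

Lemma orbit_factor_continuous x : a < x -> ccontinuous_at Ei x.
Proof. by move=> ax; exact: is_cderive_continuous (orbit_factor_cderive ax). Qed.

Lemma orbit_deriv_continuous v v' x : a < x -> ccontinuous_at v (tau x) ->
  ccontinuous_at v' (tau x) -> ccontinuous_at (orbit_deriv v v') x.
Proof.
move=> ax cv cv'; have ct := tau_continuous dtau ax.
apply: ccontinuous_atM; last first.
  by apply: ccontinuous_at_real; exact: (extended_field_inv_continuous ab FC1 Fneg ax).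
apply: ccontinuous_atM; last exact: orbit_factor_continuous.
apply: ccontinuous_atB; first exact: (ccontinuous_at_comp cv' ct).
by apply: ccontinuous_atM; [exact: cht|exact: (ccontinuous_at_comp cv ct)].
Qed.

(** A profile growing like exp (c s / 2) uses up half of the decay of the orbit factor; the other
    half still forces the limit 0 at a. *)
Lemma orbit_fun_bound v B x : 0 <= B ->
  (forall s, 0 <= s -> normc (v s) <= B * expR (c * s / 2)) -> a < x <= b ->
  normc (orbit_fun v x) <= B * expR (M * (b - a)) * expR (- (c * tau x / 2)).
Proof.
move=> B0 Hv xab; rewrite /orbit_fun xab ComplexField.Normc.normcM.
have t0 := tau_ge0 ab Fneg taub dtau xab.
apply: le_trans (ler_pM (normc_ge0 _) (normc_ge0 _) (Hv _ t0) (normc_orbit_factor xab)) _.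
rewrite -!mulrA ler_wpM2l// mulrCA ler_pM2l ?expR_gt0// -expRD ler_expR.
by lra.
Qed.

Lemma orbit_fun_continuous v B : (forall s, ccontinuous_at v s) -> 0 <= B ->
  (forall s, 0 <= s -> normc (v s) <= B * expR (c * s / 2)) -> ccontinuous_on `[a, b] (orbit_fun v).
Proof.
move=> cv B0 Hv; apply/(cvg_right_ccontinuous _ ab); split.
- move=> x /[dup] xab /andP[ax _]; apply: ccontinuous_at_near (orbit_fun_near v xab) _.
  apply: ccontinuous_atM; last exact: orbit_factor_continuous.
  exact: ccontinuous_at_comp (cv _) (tau_continuous dtau ax).
- have -> : orbit_fun v a = 0 by rewrite /orbit_fun ltxx.
  apply/cvgrPdist_lt => e e0; pose K := B * expR (M * (b - a)) + 1.
  have K0 : 0 < K by rewrite ltr_wpDl// mulr_ge0// expR_ge0.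
  have [e1 e10 ee] : exists2 e1 : R, 0 < e1 & e = e1%:C.
    by case: e e0 => er ei; rewrite ltcE/= => /andP[/eqP -> er0]; exists er.
  (* The point at which exp (- c tau / 2) equals [e1 / K]; it is smaller to the left of it. *)
  have [y ay ty] := tau_surjective ab Fneg taub dtau Finv (- (2 * ln (e1 / K) / c)).
  near=> x; rewrite sub0r normrN cabsE ee ltcR.
  have ax : a < x by near: x; exact: nbhs_right_gt.
  have xb : x <= b by near: x; exact: nbhs_right_le.
  have xab : a < x <= b by rewrite ax.
  apply: le_lt_trans (orbit_fun_bound B0 Hv xab) _.
  have xy : x <= y by near: x; exact: nbhs_right_le.
  have := tau_nonincreasing ab Fneg dtau ax xy; rewrite ty => tx.
  have H : expR (- (c * tau x / 2)) <= e1 / K.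
    rewrite -[leRHS]lnK ?posrE ?divr_gt0// ler_expR lerNl.
    move: tx; rewrite -mulNr ler_pdivrMr//; lra.
  apply: le_lt_trans (ler_wpM2l _ H) _; first by rewrite mulr_ge0 ?expR_ge0.
  by rewrite mulrA ltr_pdivrMr// mulrC ltr_pM2l// /K ltrDl.
- have -> : orbit_fun v b = v (tau b) * Ei b by rewrite /orbit_fun ab lexx.
  have cb : ccontinuous_at (fun x => v (tau x) * Ei x) b.
    apply: ccontinuous_atM; last exact: orbit_factor_continuous.
    exact: ccontinuous_at_comp (cv _) (tau_continuous dtau ab).
  apply: cvg_trans (cvg_at_left_filter cb); apply: near_eq_cvg; near=> x.
  rewrite /orbit_fun ifT//; apply/andP; split; near: x; [exact: nbhs_left_gt|exact: nbhs_left_le].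
Unshelve. all: by end_near. Qed.

(** Inside the interval tau grows by t along the flow and h_t compensates the change of the orbit
    factor. The growth bound serves at the ends, where it makes the translated function continuous
    and so identifies the continuous representative. *)
Lemma S_orbit_fun v B t : 0 <= t -> (forall s, ccontinuous_at v s) -> 0 <= B ->
  (forall s, 0 <= s -> normc (v (s + t)) <= B * expR (c * s / 2)) ->
  S_ a b F h t (orbit_fun v) = orbit_fun (fun s => v (s + t)).
Proof.
move=> t0 cv B0 Hv; apply: (cont_rep_eq ab).
- apply: orbit_fun_continuous B0 Hv => s; apply: (@ccontinuous_at_comp _ v (fun s => s + t)); first exact: cv.
  by apply: cvgD; [exact: cvg_id|exact: cvg_cst].
- move=> x xab; rewrite /orbit_fun ifF//; apply: contraNF xab => /andP[ax ->].
  by rewrite ltW.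
move=> x /[dup] xab /andP[ax xb]; rewrite /orbit_fun ax (ltW xb)/=.
have /andP[au ub] := flow_itv Finv xab t0; rewrite au (ltW ub)/=.
by rewrite mulrCA orbit_factor_flow// (tau_flow Fneg dtau Finv xab t0).
Qed.

End OrbitFunctions.

(** * A growth function adapted to the weight *)

Section GrowthFunction.
Context {R : realType}.
Notation mu := (@lebesgue_measure R).
Implicit Types (x y s t B e : R).

Variables (a b p : R) (F : R -> R).
Hypotheses (ab : a < b) (p1 : 1 <= p) (FC1 : C1_on a b F).
Hypothesis Finv : forward_invariant a b F.
Hypothesis Fneg : forall z, a < z <= b -> F z < 0.
Variable c : R.
Hypothesis c0 : 0 < c.
Variable tau : R -> R.
Hypothesis taub : tau b = 0.
Hypothesis dtau : forall x, a < x -> is_derive x (1:R) tau (extended_field a b F x)^-1.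
Notation w0 := (time_weight a b p F tau c).
Let p0 : 0 < p. Proof. exact: lt_le_trans p1. Qed.

Lemma tau_inverse : exists xi : R -> R,
  [/\ forall s, a < xi s, forall s, tau (xi s) = s,
      forall x, a < x -> xi (tau x) = x & forall s t, s <= t -> xi t <= xi s].
Proof.
have [|xi Hxi] := @choice R R (fun s x => a < x /\ tau x = s).
  by move=> s; have [x ax tx] := tau_surjective ab Fneg taub dtau Finv s; exists x.
exists xi; split; [by move=> s; have [] := Hxi s|by move=> s; have [] := Hxi s| |].
  move=> x ax; have [h1 h2] := Hxi (tau x); exact: (tau_inj ab Fneg dtau).
move=> s t st; have [h1 h2] := Hxi s; have [h3 h4] := Hxi t.
rewrite leNgt; apply/negP => /(tau_decreasing ab Fneg dtau h1); rewrite h2 h4.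
by rewrite ltNge st.
Qed.

Hypothesis w0fin : (\int[mu]_(w in `]a, b[) (w0 w)%:E < +oo)%E.

Let w0c x : a < x -> {for x, continuous w0}.
Proof. by move=> ax; have := time_weight_continuous ab FC1 Fneg dtau ax. Qed.

(** W is the integral of [w0] from a, written as K + J with K the primitive vanishing at b and J the
    total mass, so that it stays differentiable at and beyond b. It takes arbitrarily small values,
    since otherwise all integrals over [y, b] would stay below J - e. *)
Lemma tail_function : exists W : R -> R,
  [/\ forall x, a < x -> 0 < W x,
      forall x, a < x -> is_derive x (1:R) W (w0 x),
      forall x y, a < x -> x <= y -> W x <= W y &
      forall e, 0 < e -> exists2 x, a < x & W x <= e].
Proof.
have [K [Kb dK]] := primitive_ray b w0c.
have mw := time_weight_measurable p ab FC1 Fneg dtau c.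
have w00 x : a < x -> 0 < w0 x := @time_weight_gt0 _ _ _ p _ ab Fneg tau c x.
pose J := (\int[mu]_(w in `]a, b]) (w0 w)%:E)%E.
have JE : J = (\int[mu]_(w in `]a, b[) (w0 w)%:E)%E.
  rewrite /J -(@integral_itv_bndo_bndc _ _ _ (EFin \o w0))//; apply/measurable_EFinP.
  by apply: measurable_funS mw => //; apply: subset_itv; rewrite bnd_simp.
have J0 : (0 <= J)%E.
  by apply: integral_ge0 => x; rewrite /= in_itv/= => /andP[ax _]; rewrite lee_fin ltW// w00.
have Jfin : J \is a fin_num by rewrite ge0_fin_numE// JE.
have KI y : a < y -> y <= b -> (\int[mu]_(w in `[y, b]) (w0 w)%:E = (- K y)%:E)%E.
  move=> ay yb; have dd z : y <= z <= b -> is_derive z (1:R) K (w0 z).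
    by move=> /andP[yz _]; apply: dK; exact: lt_le_trans yz.
  have cc z : y <= z <= b -> {for z, continuous w0}.
    by move=> /andP[yz _]; apply: w0c; exact: lt_le_trans yz.
  by rewrite (FTC2e yb dd cc) Kb sub0r.
have Kmono x y : a < x -> x < y -> K x < K y.
  move=> ax xy; have dd z : x <= z <= y -> is_derive z (1:R) K (w0 z).
    by move=> /andP[xz _]; apply: dK; exact: lt_le_trans xz.
  have [z /andP[xz _] E] := MVT_is_derive (ltW xy) dd.
  rewrite -subr_gt0 E mulr_gt0 ?subr_gt0// w00//; exact: lt_le_trans xz.
have K_ge y : a < y -> y <= b -> - K y <= fine J.
  move=> ay yb; rewrite -lee_fin fineK// -KI//; apply: ge0_subset_integral => //.
  - by apply/measurable_EFinP.
  - by move=> x; rewrite /= in_itv/= => /andP[ax _]; rewrite lee_fin ltW// w00.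
  - by apply: subset_itv; rewrite bnd_simp.
exists (fun x => K x + fine J); split.
- move=> x ax; pose y := (a + Num.min x b) / 2.
  have am : a < Num.min x b by rewrite lt_min ax.
  have [ay ym] : a < y /\ y < Num.min x b by rewrite !midf_lt.
  have yx : y < x by move: ym; rewrite lt_min => /andP[].
  have yb : y <= b by move: ym; rewrite lt_min => /andP[_ /ltW].
  by have := Kmono y x ay yx; have := K_ge y ay yb; lra.
- move=> x ax; apply: (is_derive_cong (is_derive_fD (dK x ax) (is_derive_cst (fine J) x _))).
  by rewrite addr0.
- by move=> x y ax; rewrite le_eqVlt => /predU1P[->//|/(Kmono x y ax) /ltW]; rewrite lerD2r.
move=> e e0; apply: contrapT => H.
have HW x : a < x -> - K x <= fine J - e.
  move=> ax; have : ~~ (K x + fine J <= e) by apply/negP => W; apply: H; exists x.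
  by rewrite -ltNge; lra.
have : (J <= (fine J - e)%:E)%E.
  apply: ge0_integral_itv_exhaust => //.
    by move=> x /andP[ax _]; rewrite ltW// w00.
  by move=> y /andP[ay yb]; rewrite KI ?(ltW yb)// lee_fin HW.
by rewrite -[in leLHS](fineK Jfin) lee_fin lerBrDr gerDl leNgt e0.
Qed.

(* With [W] the tail integral of [w0], take the minimum of [W^(-1/2p)] and [exp (c tau / 2)]:
then [Phi^p w0 <= W^(-1/2) W'] is integrable. *)
Lemma growth_function : exists (Phi : R -> R) (J : R),
  [/\ forall s, 0 < Phi s, forall s t, s <= t -> Phi s <= Phi t,
      forall B, exists s, B <= Phi s, forall s, Phi s <= expR (c * s / 2) &
      (\int[mu]_(x in `]a, b]) (Phi (tau x) `^ p * w0 x)%:E <= J%:E)%E].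
Proof.
have [xi [axi tauxi xitau ximono]] := tau_inverse.
have [W [W0 dW Wmono Wsmall]] := tail_function.
(* With this exponent V^p = W^(-1/2) in the time coordinate. *)
pose q := (2 * p)^-1; have q0 : 0 < q by rewrite invr_gt0 mulr_gt0.
pose V s := W (xi s) `^ (- q).
have V0 s : 0 < V s by rewrite powR_gt0// W0.
have Vmono s t : s <= t -> V s <= V t.
  move=> st; rewrite /V !powRN lef_pV2 ?posrE ?powR_gt0 ?W0//.
  by apply: ge0_ler_powR; rewrite ?nnegrE ?(ltW q0) ?(ltW (W0 _ _))// Wmono// ximono.
pose Phi s := Num.min (V s) (expR (c * s / 2)).
have PhiV s : Phi s <= V s by rewrite /Phi ge_min lexx.
have Phi0 s : 0 < Phi s by rewrite /Phi lt_min V0 expR_gt0.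
(* W^(-1/2) W' has the primitive 2 W^(1/2), whose increments up to b are at most its value at b. *)
exists Phi, (2 * W b `^ 2^-1); split => //.
- move=> s t st; rewrite /Phi le_min !ge_min Vmono//=; apply/orP; right.
  by rewrite ler_expR ler_pM2r// ler_pM2l.
- move=> B; pose B' := Num.max 1 B.
  have B'0 : 0 < B' by rewrite lt_max ltr01.
  (* W <= B'^(-2p) amounts to V >= B'. The other entry of the minimum defining [Phi] exceeds B' from
     the time 2 ln B' / c on. *)
  have [x ax Wx] := Wsmall (B' `^ (- (2 * p))) ltac:(by rewrite powR_gt0).
  exists (Num.max (tau x) (2 * ln B' / c)).
  apply: (@le_trans _ _ B'); first by rewrite le_max lexx orbT.
  rewrite /Phi le_min; apply/andP; split.
    apply: (@le_trans _ _ (V (tau x))); last by apply: Vmono; rewrite le_max lexx.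
    rewrite /V xitau// powRN.
    have E : B' = ((B' `^ (- (2 * p))) `^ q)^-1.
      rewrite -powRrM mulNr mulfV ?powRr1 ?(ltW B'0)//; last first.
        by rewrite mulf_neq0// gt_eqF.
      by rewrite powR_inv1 ?(ltW B'0)// invrK.
    rewrite {1}E lef_pV2 ?posrE ?powR_gt0 ?W0//.
    by apply: ge0_ler_powR; rewrite ?nnegrE ?(ltW q0) ?(ltW (W0 _ _))// ltW// powR_gt0.
  rewrite -{1}[B']lnK ?posrE// ler_expR.
  have : 2 * ln B' / c <= Num.max (tau x) (2 * ln B' / c) by rewrite le_max lexx orbT.
  rewrite ler_pdivrMr//; lra.
- by move=> s; rewrite /Phi ge_min lexx orbT.
have w00 x : a < x -> 0 < w0 x := @time_weight_gt0 _ _ _ p _ ab Fneg tau c x.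
pose G x := W x `^ (- 2^-1) * w0 x.
have G0 x : a < x -> 0 <= G x.
  by move=> ax; rewrite mulr_ge0 ?powR_ge0// ltW// w00.
have dG x : a < x -> is_derive x (1:R) (fun x => 2 * W x `^ 2^-1) (G x).
  move=> ax; have dP := @is_derive_fcomp R (fun y => y `^ 2^-1) W x _ _ (is_derive1_powR _ (W0 x ax)) (dW x ax).
  apply: (is_derive_cong (is_derive_fZ 2 dP)).
  have -> : 2^-1 - 1 = - 2^-1 :> R by lra.
  rewrite /G !mulrA mulfV ?mul1r//.
have cG x : a < x -> {for x, continuous G}.
  move=> ax; have dP := @is_derive_fcomp R (fun y => y `^ (- 2^-1)) W x _ _ (is_derive1_powR _ (W0 x ax)) (dW x ax).
  by apply: cvgM; [exact: is_derive_continuous dP|exact: w0c].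
apply: (@le_trans _ _ (\int[mu]_(x in `]a, b]) (G x)%:E)%E).
  apply: ge0_le_integral_nomeas => x; rewrite /= in_itv/= => /andP[ax xb]; rewrite lee_fin.
    by rewrite mulr_ge0 ?powR_ge0// ltW// w00.
  rewrite ler_pM2r ?w00//.
  have -> : W x `^ (- 2^-1) = V (tau x) `^ p.
    rewrite /V xitau// -powRrM; congr (_ `^ _).
    by rewrite /q; field; rewrite gt_eqF.
  by apply: ge0_ler_powR; rewrite ?nnegrE ?(ltW p0) ?(ltW (Phi0 _)) ?(ltW (V0 _)).
apply: ge0_integral_itv_exhaust => //.
- apply: (@measurable_funS _ _ _ _ `]a, +oo[%classic) => //.
    by apply: subset_itv; rewrite bnd_simp.
  apply: open_continuous_measurable_fun; first exact: interval_open.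
  by move=> x; rewrite inE/= in_itv/= andbT; exact: cG.
- by move=> x /andP[ax _]; exact: G0.
move=> y /andP[ay yb].
have dd z : y <= z <= b -> is_derive z (1:R) (fun x => 2 * W x `^ 2^-1) (G z).
  by move=> /andP[yz _]; apply: dG; exact: lt_le_trans yz.
have cc z : y <= z <= b -> {for z, continuous G}.
  by move=> /andP[yz _]; apply: cG; exact: lt_le_trans yz.
by rewrite (FTC2e (ltW yb) dd cc) lee_fin gerBl mulr_ge0 ?powR_ge0.
Qed.

End GrowthFunction.

(** * Sobolev norm of functions of the time coordinate *)

Section OrbitNorm.
Context {R : realType}.
Notation mu := (@lebesgue_measure R).
Notation normc := ComplexField.Normc.normc.
Notation cRe := (complex.Re).
Implicit Types (x y s t B e : R) (v : R -> R[i]).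

(** A triangle inequality with a constant: the derivative of f1 - f3 is (g1 - g2) - (g3 - g2), of
    energy at most 2^p (e^p + e^p) <= (4 e)^p, and the energy of the derivative controls the
    norm. *)
Lemma sobolev_star_normD a b p (f1 f2 f3 : R -> R[i]) e : a < b -> 1 <= p ->
  sobolev_star a b p%:E f1 -> sobolev_star a b p%:E f2 -> sobolev_star a b p%:E f3 -> 0 < e ->
  (sobolev_norm a b p%:E (f1 - f2)%R < e%:E)%E ->
  (sobolev_norm a b p%:E (f3 - f2)%R < e%:E)%E ->
  (sobolev_norm a b p%:E (f1 - f3)%R <= (sobolev_const a b p * (4 * e))%:E)%E.
Proof.
move=> ab p1 X1 X2 X3 e0 H12 H32; have p0 : 0 < p := lt_le_trans ltr01 p1.
have [c1 a1 _ [g1 w1 _]] := sobolev_star_weak p1 X1.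
have [c2 a2 _ [g2 w2 _]] := sobolev_star_weak p1 X2.
have [c3 a3 _ [g3 w3 _]] := sobolev_star_weak p1 X3.
have cB (u v : R -> R[i]) : ccontinuous_on `[a, b] u -> ccontinuous_on `[a, b] v ->
    ccontinuous_on `[a, b] (u - v).
  by move=> cu cv x; exact: cvgB (cu x) (cv x).
have [E12 _] := sobolev_norm_energy ab p1 (cB _ _ c1 c2) (is_weak_derivativeB ab w1 w2) (ltW e0) H12.
have [E32 _] := sobolev_norm_energy ab p1 (cB _ _ c3 c2) (is_weak_derivativeB ab w3 w2) (ltW e0) H32.
have m12 := weak_derivative_measurable (is_weak_derivativeB ab w1 w2).
have m32 := weak_derivative_measurable (is_weak_derivativeB ab w3 w2).
apply: (sobolev_norm_le ab p1 (cB _ _ c1 c3) _ (is_weak_derivativeB ab w1 w3)).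
- by rewrite [LHS](_ : _ = f1 a - f3 a)// a1 a3 subrr.
- by rewrite mulr_gt0.
have -> : (fun x => g1 x - g3 x) = (fun x => (g1 x - g2 x) - (g3 x - g2 x)).
  by apply/funext => x; ring.
apply: (le_trans (energyB_le (ltW p0) (measurable_itv _) m12 m32)).
have -> : ((4 * e) `^ p)%:E = ((2 `^ p)%:E * (2 `^ p * e `^ p)%:E)%E.
  rewrite -EFinM mulrA -powRM ?ler0n// -powRM ?ltW ?mulr_gt0//.
  by congr ((_ `^ _)%:E); ring.
apply: lee_wpmul2l; first by rewrite lee_fin powR_ge0.
apply: (@le_trans _ _ ((e `^ p)%:E + (e `^ p)%:E)%E); first exact: (leeD E12 E32).
have H : 2 <= 2 `^ p :> R by rewrite -{1}[2]powRr1 ?ler0n// ler_powR// ler1n.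
rewrite -EFinD lee_fin; apply: le_trans (ler_wpM2r (powR_ge0 e p) H).
by rewrite mulr2n mulrDl mul1r.
Qed.

Variables (a b p : R) (F : R -> R) (h : R -> R[i]).
Hypotheses (ab : a < b) (p1 : 1 <= p) (FC1 : C1_on a b F).
Hypothesis Fa : F a = 0.
Hypothesis Fneg : forall z, a < z <= b -> F z < 0.
Hypothesis ch : ccontinuous_on `[a, b] h.
Variable M : R.
Hypothesis M0 : 0 <= M.
Hypothesis HM : forall x, a < x < b -> normc (h x - h a) <= M * `|F x|.
Let c := cRe (h a).
Variable tau : R -> R.
Hypothesis taub : tau b = 0.
Hypothesis dtau : forall x, a < x -> is_derive x (1:R) tau (extended_field a b F x)^-1.
Notation Ft := (extended_field a b F).
Notation w0 := (time_weight a b p F tau c).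
Let p0 : 0 < p. Proof. exact: lt_le_trans p1. Qed.

Variable A : R -> R[i].
Hypothesis Ab : A b = 0.
Hypothesis dA : forall x, a < x -> is_cderive A x (h (clamp a b x) * ((Ft x)^-1)%:C).

Variables (Phi : R -> R) (J : R).
Hypothesis Phi0 : forall s, 0 < Phi s.
Hypothesis Phimono : forall s t, s <= t -> Phi s <= Phi t.
Hypothesis PhiJ : (\int[mu]_(x in `]a, b]) (Phi (tau x) `^ p * w0 x)%:E <= J%:E)%E.

(** Pointwise, |v' - h v| <= (1 + H0) B Phi and the orbit factor is at most K0 exp (- c tau); after
    division by |F| the p-th power is a constant times B^p Phi^p w0. Bounds for s >= 0 suffice, as
    tau >= 0 on ]a, b]. *)
Lemma orbit_deriv_energy : exists2 C : R, 0 < C & forall v v' B, 0 < B ->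
  (forall s, 0 <= s -> normc (v s) <= B * Phi s) ->
  (forall s, 0 <= s -> normc (v' s) <= B * Phi s) ->
  (energy `[a, b] p (orbit_deriv a b F h tau A v v') <= ((C * B) `^ p)%:E)%E.
Proof.
have [H0 H00 hH] : exists2 H0 : R, 0 <= H0 & forall x, a <= x <= b -> normc (h (clamp a b x)) <= H0.
  by apply: ccontinuous_bounded => x _; exact: (@ccontinuous_clamp _ _ _ ab h ch x).
pose K0 := expR (M * (b - a)).
have K00 : 0 < K0 by exact: expR_gt0.
pose J1 := Num.max 1 J; have J10 : 0 < J1 by rewrite lt_max ltr01.
pose C2 := (1 + H0) * K0.
have C20 : 0 < C2 by rewrite mulr_gt0// ltr_pwDl.
exists (C2 * J1 `^ p^-1); first by rewrite mulr_gt0// powR_gt0.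
move=> v v' B B0 Hv Hv'; have CB0 : 0 <= C2 * B by rewrite mulr_ge0 ?ltW.
set g := orbit_deriv _ _ _ _ _ _ _ _.
have gb x : a < x <= b -> normc (g x) `^ p <= (C2 * B) `^ p * (Phi (tau x) `^ p * w0 x).
  move=> xab; have t0 := tau_ge0 ab Fneg taub dtau xab; have /andP[ax xb] := xab.
  have Fx : 0 < `|Ft x| by rewrite normr_gt0 (extended_field_neq0 ab Fneg ax).
  have -> : (C2 * B) `^ p * (Phi (tau x) `^ p * w0 x) =
      ((1 + H0) * (B * Phi (tau x)) * (K0 * expR (- (c * tau x))) * `|Ft x|^-1) `^ p.
    rewrite /time_weight.
    have -> : - p * c * tau x = (- (c * tau x)) * p by ring.
    rewrite expRM.
    have -> : (1 + H0) * (B * Phi (tau x)) * (K0 * expR (- (c * tau x))) * `|Ft x|^-1 =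
      C2 * B * (Phi (tau x) * (`|Ft x|^-1 * expR (- (c * tau x)))) by rewrite /C2; ring.
    rewrite [RHS]powRM ?CB0 ?mulr_ge0 ?expR_ge0 ?invr_ge0 ?(ltW (Phi0 _))//.
    rewrite [(Phi _ * _) `^ p]powRM ?mulr_ge0 ?expR_ge0 ?invr_ge0 ?(ltW (Phi0 _))//.
    rewrite [(`|Ft x|^-1 * _) `^ p]powRM ?expR_ge0 ?invr_ge0//.
    by rewrite -[`|Ft x|^-1]powR_inv1 ?(ltW Fx)// -powRrM mulN1r.
  apply: ge0_ler_powR; rewrite ?nnegrE ?(ltW p0) ?normc_ge0//.
    by rewrite !mulr_ge0 ?expR_ge0 ?invr_ge0 ?addr_ge0 ?(ltW (Phi0 _)) ?(ltW B0) ?(ltW K00).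
  rewrite /g /orbit_deriv 2!ComplexField.Normc.normcM normc_real normfV.
  rewrite ler_wpM2r ?invr_ge0//; apply: ler_pM; rewrite ?normc_ge0//; last first.
    exact: (normc_orbit_factor ab Fneg M0 HM taub dtau Ab dA).
  apply: (le_trans (normcB_le _ _)); rewrite mulrDl mul1r lerD ?Hv'//.
  rewrite ComplexField.Normc.normcM; apply: ler_pM; rewrite ?normc_ge0 ?Hv//.
  by apply: hH; rewrite ltW.
(* F a = 0 has inverse 0 by convention, so the closed end a contributes nothing. *)
have ga : g a = 0.
  by rewrite /g /orbit_deriv extended_fieldE ?lexx ?(ltW ab)// Fa invr0 mulr0.
apply: (@le_trans _ _ (((C2 * B) `^ p)%:E * \int[mu]_(x in `]a, b]) (Phi (tau x) `^ p * w0 x)%:E)%E).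
  rewrite -ge0_integralZl_EFin ?powR_ge0//; last 2 first.
  - move=> x; rewrite /= in_itv/= => /andP[ax _]; rewrite lee_fin mulr_ge0 ?powR_ge0// ltW//.
    exact: (time_weight_gt0 p ab Fneg).
  - apply/measurable_EFinP; apply: measurable_funM; last exact: (time_weight_measurable p ab FC1 Fneg dtau c).
    apply: (measurableT_comp (measurable_powR p)).
    apply: (@measurable_comp _ _ _ _ _ _ setT) => //.
      by apply: nondecreasing_measurable => // s t st; exact: Phimono.
    apply: (@measurable_funS _ _ _ _ `]a, +oo[%classic) => //.
      by apply: subset_itv; rewrite bnd_simp.
    apply: open_continuous_measurable_fun; first exact: interval_open.
    by move=> x; rewrite inE/= in_itv/= andbT => ax; exact: (tau_continuous dtau ax).
  rewrite /energy [leLHS]integral_mkcond [leRHS]integral_mkcond.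
  apply: ge0_le_integral_nomeas => x _; rewrite /patch.
    by case: ifP => _; rewrite ?lee_fin ?powR_ge0.
  case: ifPn => [/set_mem|_]; last first.
    case: ifPn => // /set_mem; rewrite /= in_itv/= => /andP[ax _].
    rewrite mule_ge0 ?lee_fin ?powR_ge0// mulr_ge0 ?powR_ge0// ltW//.
    exact: (time_weight_gt0 p ab Fneg).
  rewrite /= in_itv/= => /andP[ax xb]; case: ifPn => [/set_mem|/negP H].
    by rewrite /= in_itv/= => xab; rewrite -EFinM lee_fin gb.
  have -> : x = a.
    apply/eqP; rewrite eq_le ax andbT leNgt; apply/negP => ax'; apply: H.
    by rewrite inE/= in_itv/= ax'.
  by rewrite ga -[0]/(0%:C) normc_real normr0 powR0 ?gt_eqF.
apply: (@le_trans _ _ (((C2 * B) `^ p)%:E * J1%:E)%E).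
  apply: lee_wpmul2l; first by rewrite lee_fin powR_ge0.
  by apply: (le_trans PhiJ); rewrite lee_fin le_max lexx orbT.
rewrite -EFinM lee_fin.
have -> : C2 * J1 `^ p^-1 * B = C2 * B * J1 `^ p^-1 by ring.
by rewrite [leRHS]powRM ?powR_ge0// -powRrM mulVf ?gt_eqF// powRr1 ?(ltW J10).
Qed.

End OrbitNorm.

(** * Superposition of translated pieces *)

Section Superposition.
Context {R : realType}.
Notation normc := ComplexField.Normc.normc.
Implicit Types (s t B : R) (v : R -> R[i]).

Lemma is_cderiveB (f g : R -> R[i]) s d e : is_cderive f s d -> is_cderive g s e ->
  is_cderive (fun r => f r - g r) s (d - e).
Proof.
move=> df dg; have d1 := is_cderiveM (is_cderive_cst (-1) s) dg.
have -> : (fun r => f r - g r) = (fun r => f r + -1 * g r).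
  by apply/funext => r; rewrite mulN1r.
by apply: is_cderive_cong (is_cderiveD df d1) _; rewrite mul0r add0r mulN1r.
Qed.

Definition is_C1 (v v' : R -> R[i]) :=
  (forall s, is_cderive v s (v' s)) /\ (forall s, ccontinuous_at v' s).

Lemma is_C1_continuous v v' : is_C1 v v' -> forall s, ccontinuous_at v s.
Proof. by move=> [dv _] s; exact: is_cderive_continuous (dv s). Qed.

Lemma is_C1B u u' v v' : is_C1 u u' -> is_C1 v v' ->
  is_C1 (fun s => u s - v s) (fun s => u' s - v' s).
Proof.
by move=> [du cu] [dv cv]; split => s; [exact: is_cderiveB|exact: ccontinuous_atB].
Qed.

Lemma is_C1_shift v v' t : is_C1 v v' -> is_C1 (fun s => v (s + t)) (fun s => v' (s + t)).
Proof.
move=> [dv cv]; have ds s : is_derive s (1:R) (fun s => s + t) 1.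
  by apply: (is_derive_ext _ (is_derive_affine 1 t s)) => r; rewrite mul1r.
split=> s.
  apply: is_cderive_cong (@is_cderive_comp R v (fun s => s + t) s _ _ (dv _) (ds s)) _.
  by rewrite mulr1.
by apply: (@ccontinuous_at_comp _ _ (fun s => s + t)) => //; exact: is_derive_continuous (ds s).
Qed.

(** At most one term is nonzero, so the sum reduces to a single term. *)
Lemma normc_sum_le1 (x : nat -> R[i]) n B : 0 <= B -> (forall j, normc (x j) <= B) ->
  (forall i j, (i < j)%N -> x i = 0 \/ x j = 0) -> normc (\sum_(j < n) x j) <= B.
Proof.
move=> B0 xB x0; elim: n => [|n IH]; first by rewrite big_ord0 -[0]/(0%:C) normc_real normr0.
rewrite big_ord_recr/=; have [->|xn] := eqVneq (x n) 0; first by rewrite addr0.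
rewrite big1 ?add0r// => j _; have [//|E] := x0 j n (ltn_ord j).
by rewrite E eqxx in xn.
Qed.

(** Stands for the infinite sum of the u j. When u j vanishes before j - 1, only indices j <= s + 1
    count at s, and the truncation keeps them all. *)
Definition superpose (u : nat -> R -> R[i]) s := \sum_(j < (Num.truncn `|s|).+2) u j s.

Section LocallyFinite.
Variable u : nat -> R -> R[i].
Hypothesis u0 : forall j s, s < j%:R - 1 -> u j s = 0.

Lemma superposeE n s : s + 1 < n%:R -> superpose u s = \sum_(j < n) u j s.
Proof.
have ext k m : s + 1 < k%:R -> (k <= m)%N -> \sum_(j < m) u j s = \sum_(j < k) u j s.
  move=> sk km; rewrite -!(big_mkord xpredT (u^~ s)) (big_cat_nat _ (n := k))//=.
  rewrite [X in _ + X]big_nat_cond [X in _ + X]big1 ?addr0// => j /andP[/andP[kj _] _].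
  by apply: u0; rewrite ltrBrDr; apply: lt_le_trans sk _; rewrite ler_nat.
move=> sn; rewrite /superpose; set m := (_).+2.
have sm : s + 1 < m%:R.
  rewrite /m -natr1 ltrD2r; apply: le_lt_trans (ler_norm _) _; exact: truncnS_gt.
by case: (leqP n m) => [nm|/ltnW mn]; [exact: ext|apply/esym; exact: ext].
Qed.

(** Fixes the number of terms near s, so that smoothness can be checked on a finite sum; s + 2
    allows for every r < s + 1. *)
Lemma superpose_near s :
  \forall r \near s, superpose u r = \sum_(j < (Num.truncn `|s + 2|).+1) u j r.
Proof.
near=> r; apply: superposeE.
have rs : r < s + 1 by near: r; apply: lt_nbhsl; rewrite ltrDl.
have := truncnS_gt `|s + 2|; apply: lt_trans.
by apply: lt_le_trans (ler_norm _); lra.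
Unshelve. all: by end_near. Qed.

End LocallyFinite.

Lemma superpose_C1 (u u' : nat -> R -> R[i]) : (forall j, is_C1 (u j) (u' j)) ->
  (forall j s, s < j%:R - 1 -> u j s = 0) -> (forall j s, s < j%:R - 1 -> u' j s = 0) ->
  is_C1 (superpose u) (superpose u').
Proof.
move=> C1 u0 u'0; split=> s.
  rewrite (nbhs_singleton (superpose_near u'0 s)).
  apply: (@is_cderive_near _ _ _ _ _ _ (is_cderive_sum _ _)).
    by apply: filterS (superpose_near u0 s) => r ->.
  by move=> j; have [+ _] := C1 j; apply.
apply: (ccontinuous_at_near (f := fun r => \sum_(j < (Num.truncn `|s + 2|).+1) u' j r)).
  by apply: filterS (superpose_near u'0 s) => r ->.
by apply: ccontinuous_at_sum => j; case: (C1 j) => _; apply.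
Qed.

Section Train.
Variables (N T : nat -> R).
Hypothesis T_ge : forall j, j%:R <= T j.
Hypothesis T_sep : forall i j, (i < j)%N -> T i + N i + 1 < T j.

(** Piece j is placed at time T j; translation by T k brings piece k back to the origin. *)
Definition train (w : nat -> R -> R[i]) := superpose (fun j s => w j (s - T j)).

(** Times s >= 0 describe ]a, b]; the stretch [-1, 0] before them leaves room for a smooth
    cut-off. *)
Definition supported (w : nat -> R -> R[i]) := forall j s, (s < - 1) || (N j < s) -> w j s = 0.

Lemma train_early w : supported w -> forall j s, s < j%:R - 1 -> w j (s - T j) = 0.
Proof. by move=> w0 j s sj; have Tj := T_ge j; apply: w0; apply/orP; left; lra. Qed.

Lemma train_C1 w w' : (forall j, is_C1 (w j) (w' j)) -> supported w -> supported w' ->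
  is_C1 (train w) (train w').
Proof.
move=> C1 w0 w'0; apply: superpose_C1; [|exact: train_early|exact: train_early].
by move=> j; exact: is_C1_shift.
Qed.

(** Seen from T k, the pieces before k are over at time 0, piece k is subtracted, and no two of the
    later ones overlap. So at each s at most one later piece is left. *)
Lemma train_tail w k s B : supported w -> 0 <= s -> 0 <= B ->
  (forall j, (k < j)%N -> normc (w j (s + T k - T j)) <= B) ->
  normc (train w (s + T k) - w k s) <= B.
Proof.
move=> w0 s0 B0 wB.
pose n := maxn k.+1 (Num.truncn `|s + T k + 1|).+1.
have sn : s + T k + 1 < n%:R.
  apply: le_lt_trans (ler_norm _) _; apply: lt_le_trans (truncnS_gt _) _.
  by rewrite ler_nat leq_maxr.
rewrite /train (superposeE (train_early w0) sn).
have kn : (k < n)%N by exact: leq_maxl.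
pose x j := if j == k then 0 else w j (s + T k - T j).
have xlt j : (j < k)%N -> x j = 0.
  move=> jk; rewrite /x (ltn_eqF jk); apply: w0; apply/orP; right.
  by have := T_sep jk; lra.
have -> : \sum_(j < n) w j (s + T k - T j) - w k s = \sum_(j < n) x j.
  rewrite (bigD1 (Ordinal kn))//= [in RHS](bigD1 (Ordinal kn))//= /x eqxx add0r addrK [LHS]addrC addKr.
  by apply: eq_bigr => j jk; rewrite ifF//; apply: contraNF jk => /eqP E; apply/eqP/val_inj.
apply: normc_sum_le1 => // [j|i j ij].
  rewrite /x; case: eqVneq => [_|jk]; first by rewrite -[0]/(0%:C) normc_real normr0.
  have [kj|] := ltnP k j; first exact: wB.
  rewrite leq_eqVlt (negbTE jk)/= => jk'; have := xlt j jk'; rewrite /x (negbTE jk) => ->.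
  by rewrite -[0]/(0%:C) normc_real normr0.
rewrite /x; case: eqP => _; first by left.
case: eqP => _; first by right.
have [|ri] := ltP (N i) (s + T k - T i); first by move=> r; left; apply: w0; rewrite r orbT.
right; apply: w0; apply/orP; left; have := T_sep ij; lra.
Qed.

End Train.

End Superposition.

(** * A countable dense family *)

Section Separability.
Context {R : realType}.
Notation normc := ComplexField.Normc.normc.
Implicit Types (s t x y e : R) (f : R -> R[i]).

(** Only s is confined to the compact interval: in the application it is a grid point, while t may
    lie slightly outside. *)
Lemma ccontinuous_uniform f x y e : (forall s, ccontinuous_at f s) -> 0 < e ->
  exists2 d : R, 0 < d & forall s t, x <= s <= y -> `|s - t| < d -> normc (f s - f t) < e.
Proof.
move=> cf e0; have /compact_near_coveringP K := @segment_compact R x y.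
pose P (d : R) s := forall t, `|s - t| < d -> normc (f s - f t) < e.
have e20 : 0 < e / 2 by rewrite divr_gt0.
have : \forall d \near 0^'+, `[x, y]%classic `<=` P d.
  apply: K => s _; have [r r0 H] := continuous_normc_near (cf s) e20.
  exists (ball s (r / 2), [set d | d < r / 2]) => /=.
    split; first by apply: nbhsx_ballx; rewrite divr_gt0.
    by apply: nbhs_right_lt; rewrite divr_gt0.
  move=> [s' d] /= [ss' dr] t std.
  have h1 : normc (f s - f s') < e / 2.
    by apply: H; apply: lt_le_trans ss' _; rewrite ler_pdivrMr// ler_pMr// ler1n.
  have h2 : normc (f s - f t) < e / 2.
    apply: H; rewrite -(subrKA s'); apply: le_lt_trans (ler_normD _ _) _.
    by move: ss'; rewrite /ball/= => ss'; lra.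
  have -> : f s' - f t = (f s - f t) - (f s - f s') by ring.
  by apply: le_lt_trans (normcB_le _ _) _; lra.
move=> H; near (0:R)^'+ => d; exists d; first by near: d; exact: nbhs_right_gt.
move=> s t sxy; have : `[x, y]%classic `<=` P d by near: d.
by apply; rewrite /= in_itv.
Unshelve. all: by end_near. Qed.

(** Profiles paired with their derivatives. Through tau they describe functions vanishing near a,
    since tau tends to infinity there. *)
Definition core (w : (R -> R[i]) * (R -> R[i])) := is_C1 w.1 w.2 /\
  exists N B : R, [/\ 0 <= N, 0 < B,
    forall s, (s < - 1) || (N < s) -> w.1 s = 0 /\ w.2 s = 0 &
    forall s, normc (w.1 s) <= B /\ normc (w.2 s) <= B].

Definition complex_of_rats (q : rat * rat) : R[i] := ratr q.1 +i* ratr q.2.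

Lemma complex_rats_dense (z : R[i]) e : 0 < e -> exists q, normc (z - complex_of_rats q) < e.
Proof.
move=> e0; have apx x : exists q : rat, `|x - ratr q| < e / 2.
  have [|q] := @rat_in_itvoo R (x - e / 2) (x + e / 2).
    by rewrite ltrD2l gtrN// divr_gt0.
  by rewrite in_itv/= => /andP[h1 h2]; exists q; rewrite ltr_norml; lra.
have [q1 H1] := apx (complex.Re z); have [q2 H2] := apx (complex.Im z).
exists (q1, q2); apply: le_lt_trans (normc_le_abs _) _.
by rewrite complex_ReB complex_ImB /=; lra.
Qed.

(** A countable set of step functions with mesh 1 / n from -1 on, coded by n and a list of rational
    complex values for a profile and its derivative. Not being smooth, they serve only as labels for
    core elements. *)
Definition step_approx (k : nat * seq ((rat * rat) * (rat * rat))) s : R[i] * R[i] :=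
  if s < - 1 then (0, 0) else
  let q := nth ((0, 0), (0, 0)) k.2 (Num.truncn ((s + 1) * k.1%:R)) in
  (complex_of_rats q.1, complex_of_rats q.2).

Lemma step_approx_dense w e : core w -> 0 < e -> exists k, forall s,
  normc (w.1 s - (step_approx k s).1) <= e /\ normc (w.2 s - (step_approx k s).2) <= e.
Proof.
move=> [C1 [N [B [N0 _ w0 _]]]] e0; have e20 : 0 < e / 2 by rewrite divr_gt0.
have [d1 d10 H1] := @ccontinuous_uniform w.1 (- 1) N (e / 2) (is_C1_continuous C1) e20.
have [d2 d20 H2] := @ccontinuous_uniform w.2 (- 1) N (e / 2) C1.2 e20.
pose d := Num.min d1 d2; have d0 : 0 < d by rewrite lt_min d10.
pose n := (Num.truncn (d^-1)).+1; have n0 : 0 < n%:R :> R by rewrite ltr0n.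
have nd : n%:R^-1 < d.
  by rewrite -[d]invrK ltf_pV2 ?posrE ?invr_gt0//; exact: truncnS_gt.
pose si (i : nat) : R := - 1 + i%:R / n%:R.
have [|q Hq] := @choice nat ((rat * rat) * (rat * rat)) (fun i q =>
    normc (w.1 (si i) - complex_of_rats q.1) < e / 2 /\
    normc (w.2 (si i) - complex_of_rats q.2) < e / 2).
  move=> i; have [q1 h1] := complex_rats_dense (w.1 (si i)) e20.
  by have [q2 h2] := complex_rats_dense (w.2 (si i)) e20; exists (q1, q2).
pose L := (Num.truncn ((N + 1) * n%:R)).+1.
have rat0 : complex_of_rats (0, 0) = 0 by rewrite /complex_of_rats/= rmorph0.
have nc0 : normc (0 : R[i]) = 0 by rewrite -[0]/(0%:C) normc_real normr0.
exists (n, mkseq q L) => s; rewrite /step_approx; case: ltP => [s1|s1]/=.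
  by have [|-> ->] := w0 s; rewrite ?s1// subr0 nc0 ltW.
set i := Num.truncn _; have s10 : 0 <= (s + 1) * n%:R by rewrite mulr_ge0 ?ler0n//; lra.
have /andP[i1 i2] := truncn_itv s10; rewrite -/i in i1 i2.
(* Past the list [nth] returns its default 0, which is right because s > N there. *)
have [iL|Li] := ltnP i L; last first.
  rewrite nth_default ?size_mkseq//= rat0 !subr0.
  have [|-> ->] := w0 s; last by rewrite nc0 ltW.
  apply/orP; right.
  have : (N + 1) * n%:R < (s + 1) * n%:R.
    by apply: lt_le_trans i1; apply: lt_le_trans (truncnS_gt _) _; rewrite ler_nat.
  by rewrite ltr_pM2r//; lra.
rewrite nth_mkseq//; have [q1 q2] := Hq i.
have siN : - 1 <= si i <= N.
  rewrite /si lerDl divr_ge0 ?ler0n//= -lerBrDl opprK ler_pdivrMr//.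
  have Nn0 : 0 <= (N + 1) * n%:R by rewrite mulr_ge0 ?ler0n// addr_ge0.
  have /andP[H _] := truncn_itv Nn0; apply: le_trans H.
  by rewrite ler_nat -ltnS.
have sis : `|si i - s| < d.
  apply: lt_trans nd; have E : s - si i = ((s + 1) * n%:R - i%:R) / n%:R.
    by rewrite /si; field; rewrite gt_eqF.
  rewrite distrC E normrM normfV [`|n%:R|]gtr0_norm// ltr_pdivrMr// mulVf ?gt_eqF//.
  by rewrite ger0_norm ?subr_ge0// ltrBlDl natr1.
have [sd1 sd2] : `|si i - s| < d1 /\ `|si i - s| < d2.
  by move: sis; rewrite /d lt_min => /andP[].
split.
  have -> : w.1 s - complex_of_rats (q i).1 = (w.1 (si i) - complex_of_rats (q i).1) - (w.1 (si i) - w.1 s) by ring.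
  by apply: le_trans (normcB_le _ _) _; have := H1 _ _ siN sd1; lra.
have -> : w.2 s - complex_of_rats (q i).2 = (w.2 (si i) - complex_of_rats (q i).2) - (w.2 (si i) - w.2 s) by ring.
by apply: le_trans (normcB_le _ _) _; have := H2 _ _ siN sd2; lra.
Qed.

Lemma core0 : core (fun=> 0, fun=> 0).
Proof.
have nc0 : normc (0 : R[i]) = 0 by rewrite -[0]/(0%:C) normc_real normr0.
split; first by split => s /=; [exact: is_cderive_cst|exact: cvg_cst].
exists 0, 1; split => // s.
by split; rewrite [X in X <= _]nc0.
Qed.

(** A subset of a separable space is separable: for each code and each tolerance 1 / (m + 1), a core
    element that close to the code is chosen if there is one. Two elements close to the same code
    are within twice the tolerance of each other. *)
Lemma core_separable : exists q : nat -> (R -> R[i]) * (R -> R[i]), (forall j, core (q j)) /\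
  forall w e, core w -> 0 < e -> exists j, forall s,
    normc ((q j).1 s - w.1 s) <= e /\ normc ((q j).2 s - w.2 s) <= e.
Proof.
pose close w (k : (nat * seq ((rat * rat) * (rat * rat))) * nat) := forall s,
  normc (w.1 s - (step_approx k.1 s).1) <= k.2.+1%:R^-1 /\
  normc (w.2 s - (step_approx k.1 s).2) <= k.2.+1%:R^-1.
have [|f Hf] := @choice _ _ (fun k w => core w /\ ((exists2 w', core w' & close w' k) -> close w k)).
  move=> k; have [[w cw wk]|H] := pselect (exists2 w', core w' & close w' k).
    by exists w; split.
  by exists (fun=> 0, fun=> 0); split; first exact: core0.
pose q j := f (odflt ((0%N, [::]), 0%N) (unpickle j)).
exists q; split=> [j|w e cw e0]; first by have [] := Hf (odflt ((0%N, [::]), 0%N) (unpickle j)).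
pose m := Num.truncn ((e / 2)^-1).
have me : m.+1%:R^-1 <= e / 2.
  rewrite -[leRHS]invrK lef_pV2 ?posrE ?invr_gt0 ?divr_gt0 ?ltr0n//.
  by apply: ltW; exact: truncnS_gt.
have [k Hk] := step_approx_dense cw (e := m.+1%:R^-1) ltac:(by rewrite invr_gt0 ltr0n).
exists (pickle (k, m)) => s; rewrite /q pickleK/=.
have [_ /(_ (ex_intro2 _ _ w cw Hk)) /(_ s) [d1 d2]] := Hf (k, m).
have c1 : normc ((f (k, m)).1 s - (step_approx k s).1) <= m.+1%:R^-1 := d1.
have c2 : normc ((f (k, m)).2 s - (step_approx k s).2) <= m.+1%:R^-1 := d2.
have [k1 k2] := Hk s; split.
  have -> : (f (k, m)).1 s - w.1 s = ((f (k, m)).1 s - (step_approx k s).1) - (w.1 s - (step_approx k s).1) by ring.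
  by apply: le_trans (normcB_le _ _) _; apply: le_trans (lerD c1 k1) _; rewrite [leRHS]splitr lerD.
have -> : (f (k, m)).2 s - w.2 s = ((f (k, m)).2 s - (step_approx k s).2) - (w.2 s - (step_approx k s).2) by ring.
by apply: le_trans (normcB_le _ _) _; apply: le_trans (lerD c2 k2) _; rewrite [leRHS]splitr lerD.
Qed.

End Separability.

(** * Chaos of translations *)

Section TranslationChaos.
Context {R : realType}.
Notation normc := ComplexField.Normc.normc.
Implicit Types (s t B e : R) (f v : R -> R[i]).

Variables (X : set (R -> R[i])) (nrm : (R -> R[i]) -> \bar R).
Variables (S : R -> (R -> R[i]) -> R -> R[i]) (J : (R -> R[i]) -> R -> R[i]).
Variables (Phi : R -> R) (C K : R).
Hypotheses (C0 : 0 < C) (K0 : 0 < K).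
Hypothesis Phi0 : forall s, 0 < Phi s.
Hypothesis Phimono : forall s t, s <= t -> Phi s <= Phi t.
Hypothesis Phi_unbounded : forall B, exists s, B <= Phi s.
Hypothesis J_bounded : forall v v' B, is_C1 v v' -> 0 < B ->
  (forall s, 0 <= s -> normc (v s) <= B * Phi s) ->
  (forall s, 0 <= s -> normc (v' s) <= B * Phi s) ->
  X (J v) /\ (nrm (J v) <= (C * B)%:E)%E.
Hypothesis JB : forall u v, J u - J v = J (fun s => u s - v s).
Hypothesis J_eq : forall u v, (forall s, 0 <= s -> u s = v s) -> J u = J v.
Hypothesis J_shift : forall v v' t B, is_C1 v v' -> 0 <= t -> 0 < B ->
  (forall s, 0 <= s -> normc (v (s + t)) <= B * Phi s) -> S t (J v) = J (fun s => v (s + t)).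
Hypothesis J_dense : forall f e, X f -> 0 < e ->
  exists2 w, core w & (nrm (f - J w.1)%R < e%:E)%E.
Hypothesis nrm_triangle : forall f1 f2 f3 e, X f1 -> X f2 -> X f3 -> 0 < e ->
  (nrm (f1 - f2)%R < e%:E)%E -> (nrm (f3 - f2)%R < e%:E)%E -> (nrm (f1 - f3)%R <= (K * e)%:E)%E.

Lemma Phi_bound B : exists2 s, B <= s & B <= Phi s.
Proof.
have [s Bs] := Phi_unbounded B; exists (Num.max B s); first by rewrite le_max lexx.
by apply: le_trans Bs _; apply: Phimono; rewrite le_max lexx orbT.
Qed.

Lemma core_Phi_bound w : core w -> exists2 B, 0 < B & forall s, 0 <= s ->
  normc (w.1 s) <= B * Phi s /\ normc (w.2 s) <= B * Phi s.
Proof.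
move=> [_ [N [B [_ B0 _ wB]]]]; exists (B / Phi 0); first by rewrite divr_gt0.
move=> s s0; have [h1 h2] := wB s.
have H : B <= B / Phi 0 * Phi s.
  by rewrite mulrAC ler_pdivlMr// ler_pM2l// Phimono.
by split; [exact: le_trans h1 H|exact: le_trans h2 H].
Qed.

Lemma J_close_core w V V' (eta : R) : core w -> is_C1 V V' -> 0 < eta ->
  (forall s, 0 <= s -> normc (V s - w.1 s) <= eta * Phi s) ->
  (forall s, 0 <= s -> normc (V' s - w.2 s) <= eta * Phi s) ->
  [/\ exists2 B, 0 < B & forall s, 0 <= s -> normc (V s) <= B * Phi s, X (J V), X (J w.1) &
     (nrm (J V - J w.1)%R <= (C * eta)%:E)%E].
Proof.
move=> cw VC eta0 H1 H2; have [B B0 wB] := core_Phi_bound cw.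
have bd u (r : R -> R[i]) : (forall s, 0 <= s -> normc (u s - r s) <= eta * Phi s) ->
    (forall s, 0 <= s -> normc (r s) <= B * Phi s) ->
    forall s, 0 <= s -> normc (u s) <= (eta + B) * Phi s.
  move=> ur rB s s0; rewrite -[u s](subrK (r s)) mulrDl.
  by apply: le_trans (le_normcD _ _) (lerD (ur s s0) (rB s s0)).
have w1B s : 0 <= s -> normc (w.1 s) <= B * Phi s by move=> /wB[].
have w2B s : 0 <= s -> normc (w.2 s) <= B * Phi s by move=> /wB[].
have V1 := bd V w.1 H1 w1B.
have V2 := bd V' w.2 H2 w2B.
have eB0 : 0 < eta + B by rewrite addr_gt0.
split; first by exists (eta + B).
- by have [] := J_bounded VC eB0 V1 V2.
- by have [] := J_bounded (proj1 cw) B0 w1B w2B.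
by rewrite JB; have [] := J_bounded (is_C1B VC (proj1 cw)) eta0 H1 H2.
Qed.

(* The orbit of [y] comes close to [f] once some [V] represents [S t y] on [0, oo[ and is close
to a core element approximating [f]. *)
Lemma J_approx f e : X f -> 0 < e -> exists2 eta, 0 < eta & exists2 w, core w &
  forall V V', is_C1 V V' ->
  (forall s, 0 <= s -> normc (V s - w.1 s) <= eta * Phi s) ->
  (forall s, 0 <= s -> normc (V' s - w.2 s) <= eta * Phi s) ->
  [/\ exists2 B, 0 < B & forall s, 0 <= s -> normc (V s) <= B * Phi s, X (J V) &
    (nrm (J V - f)%R < e%:E)%E].
Proof.
(* K and C are the constants of [nrm_triangle] and [J_bounded]; the factors 2 turn their large
   inequalities into strict ones. *)
move=> Xf e0; pose e1 := e / (2 * K); have e10 : 0 < e1 by rewrite divr_gt0// mulr_gt0.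
have [w cw wf] := J_dense Xf e10.
exists (e1 / (2 * C)); first by rewrite divr_gt0// mulr_gt0.
exists w => // V V' VC H1 H2.
have eta0 : 0 < e1 / (2 * C) by rewrite divr_gt0// mulr_gt0.
have [VB XV Xw nV] := J_close_core cw VC eta0 H1 H2; split => //.
have nV' : (nrm (J V - J w.1)%R < e1%:E)%E.
  apply: le_lt_trans nV _; rewrite lte_fin.
  have -> : C * (e1 / (2 * C)) = e1 / 2 by field; rewrite gt_eqF.
  by rewrite ltr_pdivrMr// ltr_pMr// ltr1n.
apply: le_lt_trans (nrm_triangle XV Xw Xf e10 nV' wf) _; rewrite lte_fin /e1.
have -> : K * (e / (2 * K)) = e / 2 by field; rewrite gt_eqF.
by rewrite ltr_pdivrMr// ltr_pMr// ltr1n.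
Qed.

(** Equally spaced copies of one profile give a function that is periodic on [0, oo[. With a large
    spacing D every copy but the first sits where [Phi] is at least B / eta, hence is negligible in
    the norm. *)
Lemma translation_periodic_dense : dense_in X nrm (periodic_points X S).
Proof.
move=> f Xf e e0; have [eta eta0 [w cw H]] := J_approx Xf e0.
have [wC [N [B [N0 B0 w0 wB]]]] := cw.
have [D' D'1 D'2] := Phi_bound (Num.max (N + 2) (B / eta)).
(* The added 1 is there because a copy starts one unit before its nominal time: [Phi] has to be
   large from D - 1 on. *)
pose D := D' + 1.
have DN : N + 2 < D.
  by rewrite /D; apply: le_lt_trans (_ : D' < _); rewrite ?ltrDl//; apply: le_trans D'1; rewrite le_max lexx.
have DPhi : B <= eta * Phi (D - 1).
  rewrite mulrC -ler_pdivrMr// /D addrK; apply: le_trans D'2; by rewrite le_max lexx orbT.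
pose T (j : nat) := j%:R * D.
have T_ge j : j%:R <= T j by rewrite /T ler_peMr ?ler0n//; lra.
have T_sep i j : (i < j)%N -> T i + N + 1 < T j.
  move=> ij; have : T i + D <= T j.
    by rewrite /T -{2}[D]mul1r -mulrDl ler_wpM2r//; [lra|rewrite natr1 ler_nat].
  by lra.
have s1 : supported (fun=> N) (fun=> w.1) by move=> j s /w0[].
have s2 : supported (fun=> N) (fun=> w.2) by move=> j s /w0[].
pose V := train T (fun=> w.1); pose V' := train T (fun=> w.2).
have VC : is_C1 V V' := train_C1 T_ge (fun=> wC) s1 s2.
have tail (r : R -> R[i]) : supported (fun=> N) (fun=> r) -> (forall s, normc (r s) <= B) ->
    forall s, 0 <= s -> normc (train T (fun=> r) s - r s) <= eta * Phi s.
  move=> sr rB s s0; have T0 : T 0%N = 0 by rewrite /T mul0r.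
  have -> : train T (fun=> r) s = train T (fun=> r) (s + T 0%N) by rewrite T0 addr0.
  apply: (@train_tail _ (fun=> N) T T_ge T_sep (fun=> r) 0%N) => //.
    by rewrite mulr_ge0 ?ltW.
  move=> j j0; rewrite T0 addr0; have [h|h] := ltP (s - T j) (- 1).
    by rewrite (sr j) ?h// -[0]/(0%:C) normc_real normr0 mulr_ge0 ?ltW.
  apply: le_trans (rB _) _; apply: le_trans DPhi _; rewrite ler_pM2l// Phimono//.
  have : D <= T j by rewrite /T ler_peMl ?ler1n//; lra.
  by lra.
have [[BV BV0 VB] XV nV] := H V V' VC (tail w.1 s1 (fun s => proj1 (wB s))) (tail w.2 s2 (fun s => proj2 (wB s))).
exists (J V) => //; split => //; exists D; first by lra.
(* Translation by D loses the copy placed at 0, which is over by then, and renumbers the others. *)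
have VD s : 0 <= s -> V (s + D) = V s.
  move=> s0; pose n := (Num.truncn `|s + D + 1|).+1.
  have sn : s + D + 1 < n%:R by apply: le_lt_trans (ler_norm _) (truncnS_gt _).
  have sn1 : s + D + 1 < n.+1%:R by apply: lt_le_trans sn _; rewrite ler_nat.
  have sn2 : s + 1 < n%:R by lra.
  rewrite /V /train (superposeE (train_early T_ge s1) sn1) (superposeE (train_early T_ge s1) sn2).
  rewrite big_ord_recl/= (s1 0%N); last by apply/orP; right; rewrite /T mul0r; lra.
  rewrite add0r; apply: eq_bigr => j _; congr (w.1 _).
  by rewrite /T /bump/= add1n -natr1; ring.
rewrite (J_shift VC _ BV0).
- exact: J_eq.
- by lra.
by move=> s s0; rewrite VD// VB.
Qed.

(** Piece k is the member of index [logn 2 k] of the dense family. Each index occurs for infinitely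
    many k, so every member is met at times T k with errors 1 / (k + 1) tending to 0. *)
Lemma translation_hypercyclic : hypercyclic X nrm S.
Proof.
have [q [cq qdense]] := @core_separable R.
pose w k := q (logn 2 k).
have [|NB HNB] := @choice nat (R * R) (fun k NB => [/\ 0 <= NB.1, 0 < NB.2,
    forall s, (s < - 1) || (NB.1 < s) -> (w k).1 s = 0 /\ (w k).2 s = 0 &
    forall s, normc ((w k).1 s) <= NB.2 /\ normc ((w k).2 s) <= NB.2]).
  by move=> k; have [_ [N [B HB]]] := cq (logn 2 k); exists (N, B).
pose N k := (NB k).1; pose B k := (NB k).2.
(* The gap after piece k lets that piece end, and is so long that the next one, of size [B k.+1], is
   at most Phi(s) / (k + 2) wherever it appears at a time s seen from T k or from an earlier T i. *)
have [|D HD] := @choice nat R (fun k d => N k + 2 < d /\ k.+2%:R * B k.+1 <= Phi (d - 1)).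
  move=> k; have [d d1 d2] := Phi_bound (Num.max (N k + 2) (k.+2%:R * B k.+1)).
  exists (d + 1); rewrite addrK; split; last by apply: le_trans d2; rewrite le_max lexx orbT.
  by apply: le_lt_trans (_ : d < _); rewrite ?ltrDl//; apply: le_trans d1; rewrite le_max lexx.
pose T k := \sum_(i < k) D i.
have T0 : T 0%N = 0 by rewrite /T big_ord0.
have TS k : T k.+1 = T k + D k by rewrite /T big_ord_recr.
have N0 k : 0 <= N k by have [] := HNB k.
have D2 k : N k + 2 < D k by have [] := HD k.
have T_ge k : k%:R <= T k.
  elim: k => [|k IH]; first by rewrite T0.
  by rewrite TS -natr1; have := D2 k; have := N0 k; lra.
have Tmono i j : (i <= j)%N -> T i <= T j.
  elim: j => [|j IH]; first by rewrite leqn0 => /eqP ->.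
  rewrite leq_eqVlt => /predU1P[->//|]; rewrite ltnS => /IH.
  by rewrite TS; have := D2 j; have := N0 j; lra.
have T_sep i j : (i < j)%N -> T i + N i + 1 < T j.
  by move=> /Tmono; rewrite TS; have := D2 i; lra.
have s1 : supported N (fun k => (w k).1) by move=> j s; have [_ _ H _] := HNB j; move=> /H[].
have s2 : supported N (fun k => (w k).2) by move=> j s; have [_ _ H _] := HNB j; move=> /H[].
pose V := train T (fun k => (w k).1); pose V' := train T (fun k => (w k).2).
have VC : is_C1 V V' := train_C1 T_ge (fun k => proj1 (cq (logn 2 k))) s1 s2.
have tail (r : nat -> R -> R[i]) : supported N r -> (forall k s, normc (r k s) <= B k) ->
    forall k s, 0 <= s -> normc (train T r (s + T k) - r k s) <= k.+1%:R^-1 * Phi s.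
  move=> sr rB k s s0; apply: (@train_tail _ N T T_ge T_sep r) => //.
    by rewrite mulr_ge0 ?invr_ge0 ?ler0n ?ltW.
  move=> j kj; have [h|h] := ltP (s + T k - T j) (- 1).
    by rewrite (sr j) ?h// -[0]/(0%:C) normc_real normr0 mulr_ge0 ?invr_ge0 ?ler0n ?ltW.
  apply: le_trans (rB j _) _; case: j kj h => // j; rewrite ltnS => kj h.
  have [_ Dj] := HD j.
  have sD : D j - 1 <= s by move: h; rewrite TS; have := Tmono _ _ kj; lra.
  rewrite mulrC ler_pdivlMr ?ltr0n// mulrC; apply: le_trans (le_trans Dj (Phimono sD)).
  by rewrite ler_wpM2r ?ler_nat; [|have [_ /ltW] := HNB j.+1|exact: leqW].
have w1B k s : normc ((w k).1 s) <= B k by have [_ _ _ H] := HNB k; have [] := H s.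
have w2B k s : normc ((w k).2 s) <= B k by have [_ _ _ H] := HNB k; have [] := H s.
have tail1 := tail _ s1 w1B.
have tail2 := tail _ s2 w2B.
have XV : X (J V).
  have H1 s : 0 <= s -> normc (V s - (w 0%N).1 s) <= 1 * Phi s.
    by move=> s0; have := tail1 0%N s s0; rewrite T0 addr0 invr1.
  have H2 s : 0 <= s -> normc (V' s - (w 0%N).2 s) <= 1 * Phi s.
    by move=> s0; have := tail2 0%N s s0; rewrite T0 addr0 invr1.
  by have [_ XV _ _] := J_close_core (cq (logn 2 0)) VC ltr01 H1 H2.
exists (J V) => // f Xf e e0; have [eta eta0 [u cu H]] := J_approx Xf e0.
have [j Hj] := qdense u (eta / 2 * Phi 0) cu ltac:(by rewrite mulr_gt0// divr_gt0).
(* An odd multiple of 2^j has 2-adic valuation j, and this one exceeds m, which makes 1 / (k + 1) at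
   most eta / 2. *)
pose m := Num.truncn ((eta / 2)^-1); pose k := (2 ^ j * (m.*2).+1)%N.
have wk : w k = q j.
  rewrite /w /k lognM ?expn_gt0// pfactorK// -[X in (_ + X)%N](_ : 0%N = _) ?addn0//.
  by apply/esym; rewrite logn_coprime// coprime2n/= odd_double.
have mk : k.+1%:R^-1 <= eta / 2.
  rewrite -[leRHS]invrK lef_pV2 ?posrE ?invr_gt0 ?divr_gt0 ?ltr0n//.
  apply: ltW; apply: lt_le_trans (truncnS_gt _) _; rewrite ler_nat ltnS -/m /k.
  by rewrite (@leq_trans m.*2.+1)// ?leq_pmull ?expn_gt0// -addnn leqW// leq_addr.
have comb (g r l : R -> R[i]) : (forall s, 0 <= s -> normc (g s - r s) <= k.+1%:R^-1 * Phi s) ->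
    (forall s, normc (r s - l s) <= eta / 2 * Phi 0) ->
    forall s, 0 <= s -> normc (g s - l s) <= eta * Phi s.
  move=> gr rl s s0; rewrite -(subrKA (r s)); apply: le_trans (le_normcD _ _) _.
  rewrite [eta]splitr mulrDl; apply: lerD.
    by apply: le_trans (gr s s0) _; apply: ler_wpM2r mk; exact: ltW.
  by apply: le_trans (rl s) _; rewrite ler_pM2l ?divr_gt0// Phimono.
have VkC := is_C1_shift (T k) VC.
have [||[BV BV0 VB] XVk nV] := H _ _ VkC.
- by apply: (comb _ (w k).1) => [s s0|s]; [exact: tail1|rewrite wk; have [] := Hj s].
- by apply: (comb _ (w k).2) => [s s0|s]; [exact: tail2|rewrite wk; have [] := Hj s].
have Tk0 : 0 <= T k by apply: le_trans (T_ge k).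
exists (J (fun s => V (s + T k))) => //; exists (T k) => //.
exact: J_shift VC Tk0 BV0 VB.
Qed.

End TranslationChaos.

(** * Density of compactly supported functions *)

Section LpApproximation.
Context {R : realType}.
Notation mu := (@lebesgue_measure R).
Notation normc := ComplexField.Normc.normc.
Notation cRe := (complex.Re).
Notation cIm := (complex.Im).
Implicit Types (x y e n eta : R) (u v : R -> R).

Variables (a b p : R).
Hypotheses (ab : a < b) (p1 : 1 <= p).
Let p0 : 0 < p. Proof. exact: lt_le_trans p1. Qed.
Let D : set R := `[a, b]%classic.
Let mD : measurable D. Proof. exact: measurable_itv. Qed.
Let Dfin : (mu D < +oo)%E. Proof. exact: lebesgue_measure_itv_lty. Qed.
Let E u := energy D p (fun x => (u x)%:C).

Let cm u : measurable_fun D u -> cmeasurable D (fun x => (u x)%:C).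
Proof. by move=> mu'; split => //=; exact: measurable_cst. Qed.

Let E_triangle u v (w : R -> R) : measurable_fun D u -> measurable_fun D v -> measurable_fun D w ->
  (E (fun x => (u x - w x)%R) <= (2 `^ p)%:E * (E (fun x => (u x - v x)%R) + E (fun x => (w x - v x)%R)))%E.
Proof.
move=> mu' mv mw.
have H := energyB_le (ltW p0) mD (cm (measurable_funB mu' mv)) (cm (measurable_funB mw mv)).
apply: le_trans H; apply: ge0_le_integral_nomeas => x _; rewrite lee_fin ?powR_ge0//.
rewrite -rmorphB/=; have -> : u x - v x - (w x - v x) = u x - w x by ring.
exact: lexx.
Qed.

Lemma clamp_sym_cases n x : 0 <= n ->
  [\/ x <= - n /\ clamp (- n) n x = - n, n <= x /\ clamp (- n) n x = n | clamp (- n) n x = x].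
Proof.
move=> n0; have [xn|xn] := leP x (- n).
  by apply: Or31; split => //; rewrite /clamp (min_idPl _) ?(max_idPl xn)//; lra.
have [nx|nx] := leP n x; last by apply: Or33; rewrite clamp_id// !ltW.
by apply: Or32; split => //; rewrite /clamp (min_idPr nx) (max_idPr _)//; lra.
Qed.

Lemma clamp_dist n x y : 0 <= n -> `|y| <= n -> `|y - clamp (- n) n x| <= `|y - x|.
Proof.
move=> n0; rewrite ler_norml => /andP[y1 y2].
case: (clamp_sym_cases x n0) => [[xn ->]|[nx ->]|-> //].
  by rewrite !ger0_norm; lra.
by rewrite !ler0_norm; lra.
Qed.

Lemma clamp_norm n x : 0 <= n -> `|clamp (- n) n x| <= n.
Proof.
move=> n0; have /andP[h1 h2] := @clamp_itv R (- n) n x ltac:(lra).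
by rewrite ler_norml h1.
Qed.

Lemma measurable_clamp n u : measurable_fun D u -> measurable_fun D (fun x => clamp (- n) n (u x)).
Proof.
move=> mu'; apply: (measurableT_comp _ mu').
by apply: continuous_measurable_fun; exact: clamp_continuous.
Qed.

(** Dominated convergence: the error at x is 0 once n >= |u x|, and never exceeds |u x|. *)
Lemma truncation_energy u eta : measurable_fun D u -> (E u < +oo)%E -> 0 < eta ->
  exists n : nat, (E (fun x => (u x - clamp (- n%:R) n%:R (u x))%R) <= eta%:E)%E.
Proof.
move=> mu' Eu eta0.
pose f_ (n : nat) x := ((normc ((u x - clamp (- n%:R) n%:R (u x))%:C)) `^ p)%:E.
pose g x := ((normc (u x)%:C) `^ p)%:E.
have mf_ (k : nat) : measurable_fun D (f_ k).
  by apply: measurable_energy => //; apply: cm; apply: measurable_funB => //; exact: measurable_clamp.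
have ig : mu.-integrable D g.
  apply/integrableP; split; first by apply: measurable_energy => //; exact: cm.
  apply: le_lt_trans Eu; apply: ge0_le_integral_nomeas => x _.
    exact: abse_ge0.
  by rewrite gee0_abs// lee_fin powR_ge0.
have [||||_ _] := @dominated_convergence _ _ _ mu D mD f_ (cst 0%E) g mf_.
- exact: measurable_cst.
- apply: nearW => x _; apply: cvg_near_cst.
  exists (Num.truncn `|u x|).+1 => // n /= xn; rewrite /f_ clamp_id ?subrr.
    by rewrite normc_real normr0 powR0// gt_eqF.
  rewrite -ler_norml; apply: ltW; apply: lt_le_trans (truncnS_gt _) _.
  by rewrite ler_nat.
- exact: ig.
- apply: nearW => x n _; rewrite /f_ /g gee0_abs ?lee_fin ?powR_ge0// !normc_real.
  apply: ge0_ler_powR; rewrite ?nnegrE ?(ltW p0)//.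
  have n0 := ler0n R n; case: (clamp_sym_cases (u x) n0) => [[xn ->]|[nx ->]|->].
  - by rewrite !ler0_norm; lra.
  - by rewrite !ger0_norm; lra.
  - by rewrite subrr normr0.
rewrite integral0 => /fine_cvgP[[m _ fin]] /cvgrPdist_le /(_ _ eta0)[k _ H].
exists (maxn m k); have := H (maxn m k) (leq_maxr _ _); rewrite sub0r normrN/= => Hk.
rewrite -[leLHS](fineK (fin (maxn m k) (leq_maxl _ _))) lee_fin.
by apply: le_trans Hk; exact: ler_norm.
Qed.

(** Passage from L1 to Lp. Clamping the approximant to [-n, n] does not increase its distance to u
    and bounds the difference by 2 n, so the p-th power is at most (2 n)^(p - 1) times the
    difference itself. *)
Lemma bounded_approx u n eta : measurable_fun D u -> 0 <= n -> (forall x, `|u x| <= n) -> 0 < eta ->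
  exists v, [/\ continuous v, forall x, `|v x| <= n & (E (fun x => (u x - v x)%R) <= eta%:E)%E].
Proof.
move=> mu' n0 un eta0.
have iu : mu.-integrable D (EFin \o u).
  apply: (integrable_le mD mu' (g := cst n)) => //; exact: integrable_cst.
have [v_ [cv _]] := approximation_continuous_integrable mD Dfin iu.
pose L := (2 * n) `^ (p - 1) + 1; have L0 : 0 < L by rewrite ltr_wpDl ?powR_ge0.
have eL0 : 0 < eta / L by rewrite divr_gt0.
move=> /fine_cvgP[[m _ fin]] /cvgrPdist_le /(_ _ eL0)[k _ H].
pose j := maxn m k; have := H j (leq_maxr _ _); rewrite sub0r normrN/= => Hk.
exists (fun x => clamp (- n) n (v_ j x)); split.
- by move=> x; apply: continuous_comp; [exact: cv|exact: clamp_continuous].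
- by move=> x; exact: clamp_norm.
have H1 : (\int[mu]_(x in D) `|(u x - v_ j x)%:E| <= (eta / L)%:E)%E.
  rewrite -[leLHS](fineK (fin j (leq_maxl _ _))) lee_fin.
  by apply: le_trans Hk; exact: ler_norm.
apply: (@le_trans _ _ (L%:E * \int[mu]_(x in D) `|(u x - v_ j x)%:E|)%E); last first.
  apply: (le_trans (lee_wpmul2l _ H1)); first by rewrite lee_fin ltW.
  by rewrite -EFinM lee_fin mulrC divfK ?gt_eqF.
have mv : measurable_fun D (v_ j).
  by apply: measurable_funTS; apply: continuous_measurable_fun; exact: cv.
rewrite -ge0_integralZl ?lee_fin ?(ltW L0)//; last first.
  by apply: measurableT_comp => //; apply/measurable_EFinP; exact: measurable_funB.
apply: ge0_le_integral_nomeas => x _; rewrite lee_fin ?powR_ge0// normc_real.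
set y := `|_|; have y0 : 0 <= y by exact: normr_ge0.
have yn : y <= 2 * n.
  rewrite /y; apply: le_trans (ler_normB _ _) _.
  by have := un x; have := clamp_norm (v_ j x) n0; lra.
have yv : y <= `|u x - v_ j x| by exact: clamp_dist.
have [->|y_neq0] := eqVneq y 0; first by rewrite powR0 ?gt_eqF// mulr_ge0// ltW.
have -> : y `^ p = y `^ (p - 1) * y.
  by rewrite -{3}[y]powRr1// -powRD ?y_neq0 ?implybT// subrK.
apply: ler_pM; rewrite ?powR_ge0// /L.
apply: (@le_trans _ _ ((2 * n) `^ (p - 1))); last by rewrite lerDl.
by apply: ge0_ler_powR; rewrite ?nnegrE ?subr_ge0//; exact: le_trans yn.
Qed.

(** The cut-off vanishes up to a + d and is 1 from a + 2 d on; the error is at most n and lives on a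
    length 2 d, whence the factor 2 in [L]. *)
Lemma cutoff_approx v n eta : continuous v -> 0 <= n -> (forall x, `|v x| <= n) -> 0 < eta ->
  exists v0 (d : R), [/\ continuous v0, 0 < d, forall x, x <= a + d -> v0 x = 0 &
    (E (fun x => (v x - v0 x)%R) <= eta%:E)%E].
Proof.
move=> cv n0 vn eta0; pose L := 2 * (n `^ p + 1).
have L0 : 0 < L by rewrite mulr_gt0// ltr_wpDl ?powR_ge0.
pose d := Num.min ((b - a) / 2) (eta / L).
have d0 : 0 < d by rewrite lt_min !divr_gt0// subr_gt0.
pose psi x := step ((x - a - d) / d).
have cpsi : continuous psi.
  move=> x; apply: (@continuous_comp _ _ _ (fun x => (x - a - d) / d) step).
    by apply: cvgM; [apply: cvgB; [apply: cvgB; [exact: cvg_id|exact: cvg_cst]|exact: cvg_cst]|exact: cvg_cst].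
  exact: is_derive_continuous (is_derive_step _).
exists (fun x => psi x * v x), d; split => //.
- by move=> x; apply: cvgM; [exact: cpsi|exact: cv].
- move=> x xd; rewrite /psi step0 ?mul0r// pmulr_lle0 ?invr_gt0//; lra.
have mf : cmeasurable `[a, b] (fun x => (v x - psi x * v x)%:C).
  apply: cm; apply: measurable_funTS; apply: continuous_measurable_fun => x.
  by apply: cvgB; [exact: cv|apply: cvgM; [exact: cpsi|exact: cv]].
have ad : a <= a + 2 * d by lra.
have db : a + 2 * d <= b.
  have : d <= (b - a) / 2 by rewrite ge_min lexx.
  by lra.
rewrite /E /D (energy_itv_split p ad db mf).
have -> : energy `[a + 2 * d, b] p (fun x => (v x - psi x * v x)%:C) = 0%E.
  apply/eqP; rewrite eq_le energy_ge0 andbT.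
  have mf' : cmeasurable `[a + 2 * d, b] (fun x => (v x - psi x * v x)%:C).
    by apply: cmeasurableS mf => //; apply: subset_itv; rewrite bnd_simp.
  apply: le_trans (energy_le_bound (B := 0) (measurable_itv _) (ltW p0) mf' (lexx _) _) _; last first.
    by rewrite powR0 ?gt_eqF// mul0e.
  move=> x; rewrite /= in_itv/= => /andP[dx _].
  have -> : psi x = 1 by rewrite /psi step1// ler_pdivlMr// mul1r; lra.
  by rewrite mul1r subrr expr0n/= addr0 sqrtr0.
rewrite adde0.
have mf' : cmeasurable `[a, a + 2 * d] (fun x => (v x - psi x * v x)%:C).
  by apply: cmeasurableS mf => //; apply: subset_itv; rewrite bnd_simp.
apply: le_trans (energy_le_bound (B := n) (measurable_itv _) (ltW p0) mf' n0 _) _.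
  move=> x _; rewrite normc_real; have /andP[p0' p1'] := step_itv ((x - a - d) / d).
  have -> : v x - psi x * v x = (1 - psi x) * v x by ring.
  rewrite normrM -[leRHS]mul1r; apply: ler_pM => //.
  by rewrite ler_norml /psi; lra.
rewrite lebesgue_measure_itv/= lte_fin ltrDl mulr_gt0// -EFinD -EFinM lee_fin.
have -> : n `^ p * (a + 2 * d - a) = d * (2 * n `^ p) by ring.
have dL : d <= eta / L by rewrite ge_min lexx orbT.
apply: le_trans (ler_wpM2r _ dL) _; first by rewrite mulr_ge0 ?powR_ge0.
rewrite mulrAC ler_pdivrMr// ler_wpM2l ?(ltW eta0)// /L; lra.
Qed.

Lemma real_Lp_approx u eta : measurable_fun D u -> (E u < +oo)%E -> 0 < eta ->
  exists v0 (d : R), [/\ continuous v0, 0 < d, forall x, x <= a + d -> v0 x = 0 &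
    (E (fun x => (u x - v0 x)%R) <= eta%:E)%E].
Proof.
move=> mu' Eu eta0; pose q := 2 `^ p.
have q0 : 0 < q by rewrite powR_gt0.
(* Each triangle inequality multiplies the sum of two errors by q = 2^p; two of them are chained. *)
pose e1 := eta / (2 * q); have e10 : 0 < e1 by rewrite divr_gt0// mulr_gt0.
pose e2 := e1 / (2 * q); have e20 : 0 < e2 by rewrite divr_gt0// mulr_gt0.
have [n Hn] := truncation_energy mu' Eu e10.
pose un x := clamp (- n%:R) n%:R (u x).
have mun : measurable_fun D un by exact: measurable_clamp.
have [v [cv vn Hv]] := bounded_approx mun (ler0n R n) (fun x => clamp_norm (u x) (ler0n R n)) e20.
have [v0 [d [cv0 d0 v00 Hv0]]] := cutoff_approx cv (ler0n R n) vn e20.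
exists v0, d; split => //.
have mv : measurable_fun D v by apply: measurable_funTS; exact: continuous_measurable_fun.
have mv0 : measurable_fun D v0 by apply: measurable_funTS; exact: continuous_measurable_fun.
have sym f g : E (fun x => (f x - g x)%R) = E (fun x => (g x - f x)%R).
  by apply: eq_integral => x _; rewrite !normc_real distrC.
have H1 : (E (fun x => (v0 x - un x)%R) <= e1%:E)%E.
  apply: le_trans (E_triangle mv0 mv mun) _; rewrite (sym v0).
  apply: (@le_trans _ _ ((2 `^ p)%:E * (e2%:E + e2%:E))%E).
    by apply: lee_wpmul2l; [rewrite lee_fin powR_ge0|exact: (leeD Hv0 Hv)].
  by rewrite -EFinD -EFinM lee_fin /e2 -/q; rewrite le_eqVlt; apply/orP; left; apply/eqP; field; rewrite gt_eqF.
apply: le_trans (E_triangle mu' mun mv0) _.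
apply: (@le_trans _ _ ((2 `^ p)%:E * (e1%:E + e1%:E))%E).
  by apply: lee_wpmul2l; [rewrite lee_fin powR_ge0|exact: (leeD Hn H1)].
by rewrite -EFinD -EFinM lee_fin /e1 -/q; rewrite le_eqVlt; apply/orP; left; apply/eqP; field; rewrite gt_eqF.
Qed.

Lemma Lp_approx (g : R -> R[i]) (K : R) : cmeasurable D g -> (energy D p g < +oo)%E -> 0 < K ->
  exists (g0 : R -> R[i]) (d : R), [/\ forall x, ccontinuous_at g0 x, 0 < d,
    forall x, x <= a + d -> g0 x = 0 & (energy D p (fun x => (g x - g0 x)%R) <= (K `^ p)%:E)%E].
Proof.
move=> mg Eg K0; have [mr mi] := mg.
pose q := 2 `^ p; have q0 : 0 < q by rewrite powR_gt0.
have Kp : 0 < K `^ p by rewrite powR_gt0.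
pose e1 := K `^ p / (2 * q); have e10 : 0 < e1 by rewrite divr_gt0// mulr_gt0.
have Er : (E (fun x => cRe (g x)) < +oo)%E.
  apply: le_lt_trans Eg; apply: ge0_le_integral_nomeas => x _; rewrite lee_fin ?powR_ge0//.
  apply: ge0_ler_powR; rewrite ?nnegrE ?normc_ge0 ?(ltW p0)// normc_real.
  exact: normc_ge_absRe.
have Ei : (E (fun x => cIm (g x)) < +oo)%E.
  apply: le_lt_trans Eg; apply: ge0_le_integral_nomeas => x _; rewrite lee_fin ?powR_ge0//.
  apply: ge0_ler_powR; rewrite ?nnegrE ?normc_ge0 ?(ltW p0)// normc_real.
  exact: normc_ge_absIm.
have [r0 [d [cr d0 rd Hr]]] := real_Lp_approx mr Er e10.
have [i0 [d' [ci d'0 id Hi]]] := real_Lp_approx mi Ei e10.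
exists (fun x => r0 x +i* i0 x), (Num.min d d'); split.
- by move=> x; apply/ccontinuous_atP; split; [exact: cr|exact: ci].
- by rewrite lt_min d0.
- move=> x xd; rewrite rd ?id//; apply: le_trans xd _; by rewrite lerD2l ge_min lexx ?orbT.
have mr0 : measurable_fun D r0 by apply: measurable_funTS; exact: continuous_measurable_fun.
have mi0 : measurable_fun D i0 by apply: measurable_funTS; exact: continuous_measurable_fun.
pose f1 x := (cRe (g x) - r0 x)%:C.
(* The sign is reversed so that the total error is the difference f1 - f2 treated by
   [energyB_le]. *)
pose f2 x : R[i] := 0 +i* (i0 x - cIm (g x)).
have m1 : cmeasurable D f1 by apply: cm; exact: measurable_funB.
have m2 : cmeasurable D f2.
  by split => /=; [exact: measurable_cst|exact: measurable_funB].
have -> : (fun x => (g x - (r0 x +i* i0 x))%R) = (fun x => (f1 x - f2 x)%R).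
  apply/funext => x; apply/eqP; rewrite eq_complex /f1 /f2 !complex_ReB !complex_ImB/=.
  by apply/andP; split; apply/eqP; ring.
apply: le_trans (energyB_le (ltW p0) mD m1 m2) _.
apply: (@le_trans _ _ ((2 `^ p)%:E * (e1%:E + e1%:E))%E).
  apply: lee_wpmul2l; [by rewrite lee_fin powR_ge0|apply: (leeD Hr)].
  apply: le_trans Hi; apply: ge0_le_integral_nomeas => x _; rewrite lee_fin ?powR_ge0//.
  by rewrite normc_real /f2 /= expr0n/= add0r sqrtr_sqr distrC.
by rewrite -EFinD -EFinM lee_fin /e1 -/q; rewrite le_eqVlt; apply/orP; left; apply/eqP; field; rewrite gt_eqF.
Qed.

End LpApproximation.

(** * Density of the core functions *)

Section CoreDense.
Context {R : realType}.
Notation normc := ComplexField.Normc.normc.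
Notation cRe := (complex.Re).
Notation cIm := (complex.Im).
Implicit Types (x y s t B e : R) (v : R -> R[i]).

Variables (a b p : R) (F : R -> R) (h : R -> R[i]).
Hypotheses (ab : a < b) (p1 : 1 <= p) (FC1 : C1_on a b F).
Hypothesis Finv : forward_invariant a b F.
Hypothesis Fneg : forall z, a < z <= b -> F z < 0.
Hypothesis ch : ccontinuous_on `[a, b] h.
Variable tau : R -> R.
Hypothesis taub : tau b = 0.
Hypothesis dtau : forall x, a < x -> is_derive x (1:R) tau (extended_field a b F x)^-1.
Notation Ft := (extended_field a b F).
Let X := sobolev_star a b p%:E.
Let p0 : 0 < p. Proof. exact: lt_le_trans p1. Qed.

Variable A : R -> R[i].
Hypothesis dA : forall x, a < x -> is_cderive A x (h (clamp a b x) * ((Ft x)^-1)%:C).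
Notation J := (orbit_fun a b tau A).

Lemma tau_inverse_derive (xi : R -> R) : (forall s, a < xi s) -> (forall s, tau (xi s) = s) ->
  (forall x, a < x -> xi (tau x) = x) -> forall s, is_derive s (1:R) xi (Ft (xi s)).
Proof.
move=> axi tauxi xitau s; rewrite -{1}(tauxi s) -[Ft _]invrK.
apply: is_derive_inverse (dtau (axi s)) _.
- by near=> y; apply: xitau; near: y; exact: lt_nbhsr.
- by near=> y; apply: (tau_continuous dtau); near: y; exact: lt_nbhsr.
- by rewrite invr_eq0 (extended_field_neq0 ab Fneg (axi s)).
Unshelve. all: by end_near. Qed.

Lemma cprimitive_exists (g : R -> R[i]) (d : R) : (forall x, ccontinuous_at g x) -> 0 < d ->
  (forall x, x <= a + d -> g x = 0) ->
  exists P : R -> R[i], (forall x, is_cderive P x (g x)) /\ (forall x, x <= a + d -> P x = 0).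
Proof.
move=> cg d0 g0.
have real (k : R -> R) : continuous k -> (forall x, x <= a + d -> k x = 0) ->
    exists K : R -> R, (forall x, is_derive x (1:R) K (k x)) /\ (forall x, x <= a + d -> K x = 0).
  move=> ck k0; have [|||K HK] := @primitive_exists R k setT.
  - exact: openT.
  - by [].
  - by move=> x _; exact: ck.
  have dK x : is_derive x (1:R) (fun x => K x - K (a + d)) (k x).
    by apply: (is_derive_cong (is_derive_fB (HK x I) (is_derive_cst (K (a + d)) x _))); rewrite subr0.
  exists (fun x => K x - K (a + d)); split=> // x xd.
  have [z /andP[_ zd] E] := MVT_is_derive xd (fun z _ => dK z).
  move: E; rewrite subrr sub0r k0// mul0r => /eqP; rewrite oppr_eq0 => /eqP.
  by [].
have [|x xd|K1 [dK1 K10]] := real (fun x => cRe (g x)).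
- by move=> x; have /ccontinuous_atP[] := cg x.
- by rewrite g0.
have [|x xd|K2 [dK2 K20]] := real (fun x => cIm (g x)).
- by move=> x; have /ccontinuous_atP[] := cg x.
- by rewrite g0.
exists (fun x => K1 x +i* K2 x); split; first by move=> x; split; [exact: dK1|exact: dK2].
by move=> x xd; rewrite K10 ?K20.
Qed.

(** With P the primitive of g vanishing near a and xi the inverse of tau, the profile P(xi) exp
    (A(xi)) is carried by [J] to P. It vanishes once xi s <= a + d, that is for large s; the cut-off
    [chi] makes it vanish before -1 and is 1 for s >= 0, so that [J] does not see it. *)
Lemma core_primitive (g : R -> R[i]) (d : R) : (forall x, ccontinuous_at g x) -> 0 < d ->
  (forall x, x <= a + d -> g x = 0) ->
  exists2 w, core w & is_weak_derivative a b (J w.1) g /\ X (J w.1).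
Proof.
move=> cg d0 g0; have [P [dP P0]] := cprimitive_exists cg d0 g0.
have cP x : ccontinuous_at P x := is_cderive_continuous (dP x).
have [xi [axi tauxi xitau ximono]] := tau_inverse ab Finv Fneg taub dtau.
have dxi := tau_inverse_derive axi tauxi xitau.
pose ht x := h (clamp a b x).
have cht x : ccontinuous_at ht x := @ccontinuous_clamp _ _ _ ab h ch x.
pose EA x := cexp (A x).
have dEA x : a < x -> is_cderive EA x (ht x * ((Ft x)^-1)%:C * EA x).
  by move=> ax; exact: is_cderive_cexp (dA ax).
pose Q x := P x * EA x.
(* F times the derivative of Q, as xi' = F(xi) and [EA] has logarithmic derivative h / F. *)
pose Q' x := (g x * EA x) * (Ft x)%:C + P x * (ht x * EA x).
have cEA x : a < x -> ccontinuous_at EA x by move=> ax; exact: is_cderive_continuous (dEA x ax).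
have cQ' x : a < x -> ccontinuous_at Q' x.
  move=> ax; apply: ccontinuous_atD; apply: ccontinuous_atM => //.
  - by apply: ccontinuous_atM; [exact: cg|exact: cEA].
  - by apply: ccontinuous_at_real; exact: extended_field_continuous.
  - by apply: ccontinuous_atM; [exact: cht|exact: cEA].
have dQ s : is_cderive (fun s => Q (xi s)) s (Q' (xi s)).
  have ax := axi s; have Fx := extended_field_neq0 ab Fneg ax.
  apply: is_cderive_cong (@is_cderive_comp R Q xi s _ _ (is_cderiveM (dP _) (dEA _ ax)) (dxi s)) _.
  rewrite /Q' mulrDl; congr (_ + _).
  have E : ((Ft (xi s))^-1)%:C * (Ft (xi s))%:C = 1 :> R[i] by rewrite -rmorphM/= mulVf.
  move: E; move: (EA _) (ht _) (P _) (((Ft (xi s))^-1)%:C) ((Ft (xi s))%:C) => u1 u2 u3 u4 u5 E.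
  by rewrite -!mulrA (mulrCA u4) E mulr1.
pose chi s := step (s + 1).
have dchi s : is_derive s (1:R) chi (derive1 step (s + 1)).
  have ds : is_derive s (1:R) (fun s => s + 1) 1.
    by apply: (is_derive_ext _ (is_derive_affine 1 1 s)) => r; rewrite mul1r.
  by apply: (is_derive_cong (@is_derive_fcomp R step (fun s => s + 1) s _ _ (is_derive_step _) ds)); rewrite mulr1.
pose v s := (chi s)%:C * Q (xi s).
pose v' s := (derive1 step (s + 1))%:C * Q (xi s) + (chi s)%:C * Q' (xi s).
have vC : is_C1 v v'.
  split=> s; first exact: is_cderiveM (is_cderive_real (dchi s)) (dQ s).
  have cxi : {for s, continuous xi} := is_derive_continuous (dxi s).
  apply: ccontinuous_atD; apply: ccontinuous_atM.
  - apply: ccontinuous_at_real; apply: (@continuous_comp _ _ _ (fun s => s + 1) (derive1 step)).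
      by apply: cvgD; [exact: cvg_id|exact: cvg_cst].
    exact: step_derive1_continuous.
  - exact: is_cderive_continuous (dQ s).
  - by apply: ccontinuous_at_real; exact: is_derive_continuous (dchi s).
  - exact: (@ccontinuous_at_comp _ Q' xi s (cQ' _ (axi s)) cxi).
pose N := Num.max 0 (tau (a + d)).
have v0 s : (s < - 1) || (N < s) -> v s = 0 /\ v' s = 0.
  move=> /orP[s1|]; rewrite /v /v' /chi.
    rewrite step0 ?step_derive1_eq0 ?mul0r ?addr0//; last by lra.
    by apply/orP; left; lra.
  rewrite /N gt_max => /andP[_ sN].
  have xd : xi s <= a + d.
    rewrite leNgt; apply/negP => H; have ad : a < a + d by rewrite ltrDl.
    have := tau_decreasing ab Fneg dtau ad H; rewrite tauxi => /(lt_trans sN).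
    by rewrite ltxx.
  by rewrite /Q /Q' P0// g0// !mul0r !addr0 !mulr0 addr0.
have [|B1 B10 vB1] := @ccontinuous_bounded R v (- 1) N.
  by move=> s _; exact: is_C1_continuous vC _.
have [|B2 B20 vB2] := @ccontinuous_bounded R v' (- 1) N.
  by move=> s _; case: vC.
exists (v, v').
  split => //; exists N, (B1 + B2 + 1); split => //=.
  - by rewrite le_max lexx.
  - by lra.
  - move=> s; have [s1|s1] := ltP s (- 1).
      have [|-> ->] := v0 s; rewrite ?s1// -[0]/(0%:C) normc_real normr0; split; lra.
    have [sN|sN] := ltP N s.
      have [|-> ->] := v0 s; rewrite ?sN ?orbT// -[0]/(0%:C) normc_real normr0; split; lra.
    have sI : - 1 <= s <= N by rewrite s1.
    by have := vB1 s sI; have := vB2 s sI; split; lra.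
have JE x : J v x = if a < x <= b then P x else 0.
  rewrite /orbit_fun; case: ifPn => // /[dup] xab /andP[ax _].
  have t0 := tau_ge0 ab Fneg taub dtau xab.
  rewrite /v /chi step1 ?lerDr// mul1r xitau// /Q /EA /orbit_factor -mulrA -cexpD subrr cexp0.
  by rewrite mulr1.
have Pa : P a = 0 by apply: P0; rewrite lerDl ltW.
have [|eB eB0 gB] := @ccontinuous_bounded R g a b; first by move=> x _; exact: cg.
have mg : cmeasurable `[a, b] g.
  by split; apply: measurable_funTS; apply: continuous_measurable_fun => x;
    have /ccontinuous_atP[] := cg x.
apply: (C1_sobolev_star ab p1).
- apply: (@ccontinuous_on_eq _ _ P) => [x|].
    rewrite /= in_itv/= => /andP[]; rewrite JE le_eqVlt => /predU1P[<- _|-> ->//].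
    by rewrite ltxx.
  by apply/(cvg_right_ccontinuous _ ab); split => //; [exact: cvg_at_right_filter (cP a)|exact: cvg_at_left_filter (cP b)].
- by rewrite JE ltxx.
- by move=> x xab; rewrite JE ifF//; apply: contraNF xab => /andP[/ltW -> ->].
- move=> x /andP[ax xb]; apply: (@is_cderive_near _ P) (dP x).
  near=> y; rewrite JE ifT//; apply/andP; split; first by near: y; exact: lt_nbhsr.
  by apply: ltW; near: y; exact: lt_nbhsl.
- by move=> x _; exact: cg.
have H := energy_le_bound (measurable_itv _) (ltW p0) mg eB0 (fun x => _).
apply: (le_lt_trans (H _)).
  by move=> x; rewrite /= in_itv/=; exact: gB.
by rewrite lebesgue_measure_itv/= lte_fin ab -EFinD -EFinM ltry.
Unshelve. all: by end_near. Qed.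

(** It is enough to approximate the weak derivative in Lp by a continuous function vanishing near a:
    both functions are 0 at a, so the energy of the difference of derivatives controls the Sobolev
    norm. *)
Lemma core_dense f e : X f -> 0 < e ->
  exists2 w, core w & X (J w.1) /\ (sobolev_norm a b p%:E (f - J w.1)%R < e%:E)%E.
Proof.
move=> Xf e0; have [cf fa _ [g fg gp]] := sobolev_star_weak p1 Xf.
have Cs := sobolev_const_gt0 p ab.
pose K := e / (2 * sobolev_const a b p); have K0 : 0 < K by rewrite divr_gt0// mulr_gt0.
have [g0 [d [cg0 d0 g00 Hg]]] := Lp_approx ab p1 (weak_derivative_measurable fg) gp K0.
have [w cw [wd XJ]] := core_primitive cg0 d0 g00.
exists w => //; split => //; have [cJ Ja _ _] := sobolev_star_weak p1 XJ.
have cB : ccontinuous_on `[a, b] (f - J w.1) by move=> x; exact: cvgB (cf x) (cJ x).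
have aB : (f - J w.1) a = 0 by rewrite [LHS](_ : _ = f a - J w.1 a)// fa Ja subrr.
apply: le_lt_trans (sobolev_norm_le ab p1 cB aB (is_weak_derivativeB ab fg wd) K0 Hg) _.
rewrite lte_fin /K.
have -> : sobolev_const a b p * (e / (2 * sobolev_const a b p)) = e / 2.
  by field; rewrite gt_eqF.
by rewrite ltr_pdivrMr// ltr_pMr// ltr1n.
Qed.

End CoreDense.

(** * Conclusion *)

Section Sufficiency.
Context {R : realType}.
Notation mu := (@lebesgue_measure R).
Notation normc := ComplexField.Normc.normc.
Variables (a b p : R) (F : R -> R) (h : R -> R[i]).
Hypotheses (ab : a < b) (p1 : 1 <= p) (FC1 : C1_on a b F).
Hypothesis Fa : F a = 0.
Hypothesis Finv : forward_invariant a b F.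
Hypothesis ch : ccontinuous_on `[a, b] h.
Variable M : R.
Hypothesis M0 : 0 <= M.
Hypothesis HM : forall x, a < x < b -> normc (h x - h a) <= M * `|F x|.

Lemma cond_some_chaotic : cond_some a b F h p ->
  chaotic (sobolev_star a b p%:E) (sobolev_norm a b p%:E) (S_ a b F h).
Proof.
move=> /[dup] cs [_ Hcs]; have [Fneg c0] := cond_some_sign ab p1 FC1 Fa Finv cs.
have [tau [taub dtau]] := primitive_ray b (extended_field_inv_continuous ab FC1 Fneg).
have w0fin : (\int[mu]_(w in `]a, b[) (time_weight a b p F tau (complex.Re (h a)) w)%:E < +oo)%E.
  pose z := (a + b) / 2; have zab : a < z < b by rewrite !midf_lt.
  have Az : (`]a, b[ `\` zeros a b F) z.
    by rewrite (zeros_empty Fneg) setD0 /= in_itv.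
  have comp : is_component (`]a, b[ `\` zeros a b F) `]a, b[.
    have zc : is_component (`]a, b[ `\` zeros a b F) (connected_component (`]a, b[ `\` zeros a b F) z).
      by exists z.
    by rewrite -[X in is_component _ X](component_full Fneg zc).
  have [x] := Hcs _ comp; rewrite /= in_itv/= => xab.
  by move/(component_integral_fin p ab FC1 Fneg dtau (erefl _) xab).
have [A [Ab dA]] := weight_primitive ab FC1 Fneg ch.
have [Phi [I [Phi0 Phimono Phiinf Phiexp PhiI]]] := growth_function ab p1 FC1 Finv Fneg c0 taub dtau w0fin.
pose J := orbit_fun a b tau A.
have [C C0 HC] := orbit_deriv_energy ab p1 FC1 Fa Fneg ch M0 HM taub dtau Ab dA Phi0 Phimono PhiI.
have Cs := sobolev_const_gt0 p ab.
(* [Phi] lies below exp (c s / 2), so a bound by [Phi] also provides the growth condition that gives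
   continuity at a. *)
have growth v B : 0 < B -> (forall s, 0 <= s -> normc (v s) <= B * Phi s) ->
    forall s, 0 <= s -> normc (v s) <= B * expR (complex.Re (h a) * s / 2).
  by move=> B0 Hv s s0; apply: le_trans (Hv s s0) _; rewrite ler_pM2l.
have J_bounded v v' B : is_C1 v v' -> 0 < B -> (forall s, 0 <= s -> normc (v s) <= B * Phi s) ->
    (forall s, 0 <= s -> normc (v' s) <= B * Phi s) -> sobolev_star a b p%:E (J v) /\
    (sobolev_norm a b p%:E (J v) <= ((sobolev_const a b p * C) * B)%:E)%E.
  move=> vC B0 Hv Hv'; have E := HC v v' B B0 Hv Hv'.
  have cJ : ccontinuous_on `[a, b] (J v).
    apply: (orbit_fun_continuous ab Finv Fneg M0 HM c0 taub dtau Ab dA _ (ltW B0) (growth v B B0 Hv)).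
    exact: is_C1_continuous vC.
  have Ja : J v a = 0 by rewrite /J /orbit_fun ltxx.
  have [wJ XJ] : is_weak_derivative a b (J v) (orbit_deriv a b F h tau A v v') /\
      sobolev_star a b p%:E (J v).
    apply: (C1_sobolev_star ab p1 cJ Ja).
    - by move=> x xab; rewrite /J /orbit_fun ifF//; apply: contraNF xab => /andP[/ltW -> ->].
    - by move=> x xab; exact: (orbit_fun_cderive dtau dA xab (proj1 vC (tau x))).
    - move=> x /andP[ax _]; apply: (orbit_deriv_continuous ab FC1 Fneg ch dtau dA ax).
        exact: is_C1_continuous vC _.
      by case: vC.
    - by apply: le_lt_trans E _; rewrite ltry.
  split=> //; rewrite -mulrA; apply: (sobolev_norm_le ab p1 cJ Ja wJ _ E).
  by rewrite mulr_gt0.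
have JB u v : J u - J v = J (fun s => u s - v s).
  apply/funext => x; rewrite [LHS](_ : _ = J u x - J v x)// /J /orbit_fun.
  by case: ifP => _; rewrite ?subrr// mulrBl.
have J_eq u v : (forall s, 0 <= s -> u s = v s) -> J u = J v.
  move=> uv; apply/funext => x; rewrite /J /orbit_fun; case: ifPn => // xab.
  by rewrite uv// (tau_ge0 ab Fneg taub dtau xab).
have J_shift v v' t B : is_C1 v v' -> 0 <= t -> 0 < B ->
    (forall s, 0 <= s -> normc (v (s + t)) <= B * Phi s) ->
    S_ a b F h t (J v) = J (fun s => v (s + t)).
  move=> vC t0 B0 Hv.
  apply: (S_orbit_fun ab Finv Fneg ch M0 HM c0 taub dtau Ab dA t0 _ (ltW B0)).
    exact: is_C1_continuous vC.
  exact: (growth (fun s => v (s + t))).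
have J_dense f e : sobolev_star a b p%:E f -> 0 < e ->
    exists2 w, core w & (sobolev_norm a b p%:E (f - J w.1)%R < e%:E)%E.
  move=> Xf e0; have [w cw [_ H]] := core_dense ab p1 FC1 Finv Fneg ch taub dtau dA Xf e0.
  by exists w.
have triangle f1 f2 f3 e : sobolev_star a b p%:E f1 -> sobolev_star a b p%:E f2 ->
    sobolev_star a b p%:E f3 -> 0 < e ->
    (sobolev_norm a b p%:E (f1 - f2)%R < e%:E)%E ->
    (sobolev_norm a b p%:E (f3 - f2)%R < e%:E)%E ->
    (sobolev_norm a b p%:E (f1 - f3)%R <= ((sobolev_const a b p * 4) * e)%:E)%E.
  by move=> X1 X2 X3 e0 H1 H2; rewrite -mulrA; exact: (sobolev_star_normD ab p1 X1 X2 X3).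
have CC0 : 0 < sobolev_const a b p * C by rewrite mulr_gt0.
have C40 : 0 < sobolev_const a b p * 4 by rewrite mulr_gt0.
split.
  exact: (translation_hypercyclic CC0 C40 Phi0 Phimono Phiinf J_bounded JB J_shift J_dense triangle).
exact: (translation_periodic_dense CC0 C40 Phi0 Phimono Phiinf J_bounded JB J_eq J_shift J_dense triangle).
Qed.

End Sufficiency.

Theorem theorem8 (R : realType) (p a b : R) (F : R -> R) (h : R -> R[i])
  (p1 : 1 <= p) (ab : a < b)
  (FC1 : C1_on a b F) (Fa : F a = 0) (Finv : forward_invariant a b F)
  (hW : sobolev a b +oo%E h)
  (ha_real : complex.Im (h a) = 0)
  (h_zeros : forall x, zeros a b F x -> h x = h a)
  (h_quot : inLp `[a, b] +oo%E
     (fun y => if F y == 0 then 0 else (h y - h a) / (F y)%:C)) :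
  (chaotic (sobolev_star a b p%:E) (sobolev_norm a b p%:E) (S_ a b F h) <->
   cond_some a b F h p) /\
  (chaotic (sobolev_star a b p%:E) (sobolev_norm a b p%:E) (S_ a b F h) <->
   cond_all a b F h p).
Proof.
have [ch _ _] := hW; have [M M0 HM] := weight_bound ab FC1 ch h_zeros h_quot.
have nec := chaotic_cond_all ab p1 FC1 Finv ch M0 HM.
have suf := cond_some_chaotic ab p1 FC1 Fa Finv ch M0 HM.
split; split.
- by move=> /nec; exact: cond_all_some.
- exact: suf.
- exact: nec.
- by move=> /cond_all_some; exact: suf.
Qed.
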